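(* Choose $q_1=q$, $q_2=q^{-1}t$, $q_3=t^{-1}$. Under the isomorphism of vector spaces $$W^N\xrightarrow{\ \sim\ }\mathbb C(q,t)[x_1^{\pm1},\dots,x_N^{\pm1}]^{\mathfrak S_N},\qquad |\lambda\rangle\mapsto P_\lambda(x),$$ one has the identifications $$(1-q_1)e_0=\text{multiplication by }\sum_{i=1}^Nx_i,\qquad -(1-q_1^{-1})f_0=\text{multiplication by }\sum_{i=1}^Nx_i^{-1},$$ $$\psi_1^+=q_3^{N-1}(1-q_2)(1-q_3)\,D_N^1(q,t),\qquad \psi^-_{-1}=q_3^{-N+1}(1-q_2^{-1})(1-q_3^{-1})\,D_N^{-1}(q,t).$$
   Context: Work over the field $\mathbb C(q,t)$. Let $\mathcal P^N=\{\lambda=(\lambda_1,\dots,\lambda_N)\in\mathbb Z^N\mid\lambda_1\ge\dots\ge\lambda_N\}$ and let $W^N$ be the vector space with basis $|\lambda\rangle$, $\lambda\in\mathcal P^N$. It is a module over the algebra $\mathcal E$ (quantum continuous $\mathfrak{gl}_\infty$ with parameters $q_1q_2q_3=1$, generated by the coefficients of $e(z)=\sum_{i\in\mathbb Z}e_iz^{-i}$, $f(z)=\sum_{i\in\mathbb Z}f_iz^{-i}$, $\psi^\pm(z)=\sum_{\pm i\ge0}\psi^\pm_iz^{-i}$) on which, with $\delta(z)=\sum_{n\in\mathbb Z}z^n$ and $\lambda\pm\mathbf 1_i=(\lambda_1,\dots,\lambda_i\pm1,\dots,\lambda_N)$, the generators act by $$(1-q_1)e(z)|\lambda\rangle=\sum_{i=1}^N\prod_{j=1}^{i-1}\frac{(1-q_1^{\lambda_i-\lambda_j}q_3^{i-j-1})(1-q_1^{\lambda_i-\lambda_j+1}q_3^{i-j+1})}{(1-q_1^{\lambda_i-\lambda_j}q_3^{i-j})(1-q_1^{\lambda_i-\lambda_j+1}q_3^{i-j})}\,\delta(q_1^{\lambda_i}q_3^{i-1}/z)\,|\lambda+\mathbf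 1_i\rangle,$$ $$-(1-q_1^{-1})f(z)|\lambda\rangle=\sum_{i=1}^N\prod_{j=i+1}^N\frac{(1-q_1^{\lambda_j-\lambda_i+1}q_3^{j-i+1})(1-q_1^{\lambda_j-\lambda_i}q_3^{j-i-1})}{(1-q_1^{\lambda_j-\lambda_i+1}q_3^{j-i})(1-q_1^{\lambda_j-\lambda_i}q_3^{j-i})}\,\delta(q_1^{\lambda_i-1}q_3^{i-1}/z)\,|\lambda-\mathbf 1_i\rangle,$$ $$\psi^\pm(z)|\lambda\rangle=\Big(\prod_{i=1}^N\frac{(1-q_1^{\lambda_i}q_3^{i}/z)(1-q_1^{\lambda_i-1}q_3^{i-2}/z)}{(1-q_1^{\lambda_i}q_3^{i-1}/z)(1-q_1^{\lambda_i-1}q_3^{i-1}/z)}\Big)^{\pm}|\lambda\rangle,$$ where $\gamma(z)^\pm$ denotes the expansion of a rational function $\gamma(z)$ as a power series in $z^{\mp1}$, and terms with $\lambda\pm\mathbf 1_i\notin\mathcal P^N$ are absent (their coefficients vanish). (This is the submodule $W^N(u)$, $u=1$, of the tensor product $V(u)\otimes V(uq_2^{-1})\otimes\dots\otimes V(uq_2^{-N+1})$ of vector representations, spanned by $|\lambda\rangle=[u]_{\lambda_1}\otimes[uq_2^{-1}]_{\lambda_2-1}\otimes\dots\otimes[uq_2^{-N+1}]_{\lambda_N-N+1}$.) Macdonald operators: $(T_{q,x_i}h)(x_1,\dots,x_N)=h(x_1,\dots,qx_i,\dots,x_N)$; for $0\le r\le N$, $D_N^r=\sum_{|I|=r}t^{r(r-1)/2}\prod_{i\in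 I,j\notin I}\frac{tx_i-x_j}{x_i-x_j}\prod_{i\in I}T_{q,x_i}$, where $I$ runs over subsets of $\{1,\dots,N\}$ of cardinality $r$. In particular $D_N^1(q,t)=\sum_{i=1}^N\prod_{j\ne i}\frac{tx_i-x_j}{x_i-x_j}T_{q,x_i}$, and $D_N^{-1}(q,t):=D_N^1(q^{-1},t^{-1})$. Macdonald polynomials: for $\lambda\in\mathcal P^N$ with $\lambda_N\ge0$, $P_\lambda=P_\lambda(x;q,t)$ is the unique symmetric polynomial with $P_\lambda=m_\lambda+\sum_{\mu<\lambda}u_{\lambda\mu}m_\mu$ ($u_{\lambda\mu}\in\mathbb C(q,t)$, $m_\mu$ monomial symmetric functions, $<$ the dominance order) and $\sum_{r=0}^ND_N^rX^r\,P_\lambda=\prod_{i=1}^N(1+Xq^{\lambda_i}t^{N-i})P_\lambda$. For general $\lambda\in\mathcal P^N$, $P_\lambda=\prod_{i=1}^Nx_i^{\lambda_N}\cdot P_{(\lambda_1-\lambda_N,\dots,\lambda_{N-1}-\lambda_N,0)}$. *)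

(* Defs.v *)
From HB Require Import structures.
From mathcomp Require Import all_boot all_order all_fingroup all_algebra.
From mathcomp Require Import boolp classical_sets reals.
From mathcomp Require Import complex.
From mathcomp Require Import freeg mpoly.

Set Implicit Arguments.
Unset Strict Implicit.
Unset Printing Implicit Defensive.

Import Order.TTheory GRing.Theory Num.Theory.
Local Open Scope ring_scope.
Local Open Scope quotient_scope.

(* C(q,t) as Frac(C[q][t]), where C = R[i]: the inner indeterminate is q, the
   outer one is t. *)
Definition Cqt (R : realType) : fieldType := {fraction {poly {poly R[i]}}}.
Definition qvar (R : realType) : Cqt R := tofrac (('X : {poly R[i]})%:P).
Definition tvar (R : realType) : Cqt R := tofrac ('X : {poly {poly R[i]}}).

(* Indices i : 'I_N are 0-based: the usual lambda_i is part la (i - 1), and the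
   exponents i - 1, i, i - 2 of q3 below become i, i + 1, i - 1. *)
Definition domwt (N : nat) := {la : N.-tuple int | sorted >=%R la}.

Definition part N (la : domwt N) (i : 'I_N) : int := tnth (val la) i.

(* lambda_N (the default value 0 is only reached when N = 0) *)
Definition last_part N (la : domwt N) : int := last 0 (val la).

(* lambda + d 1_i, or None when it is not dominant *)
Definition move N (la : domwt N) (i : 'I_N) (d : int) : option (domwt N) :=
  insub [tuple part la j + (if j == i then d else 0) | j < N].

Definition WN (K : fieldType) (N : nat) := {freeg (domwt N) / K}.

Section Module.
Variables (K : fieldType) (N : nat) (q1 q3 : K).
Local Notation W := (WN K N).

Definition ket (la : domwt N) : W := << la >>.

Definition oket (o : option (domwt N)) : W :=
  if o is Some la then ket la else 0.

(* delta(a/z) = \sum_m a^m z^(-m): its coefficient of z^(-m) *)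
Definition delta_coef (a : K) (m : int) : K := a ^ m.

Definition e_factor (la : domwt N) (i : 'I_N) : K :=
  \prod_(j < N | (j < i)%N)
    let d := part la i - part la j in
    let r := i%:Z - j%:Z in
    ((1 - q1 ^ d * q3 ^ (r - 1)) * (1 - q1 ^ (d + 1) * q3 ^ (r + 1))) /
    ((1 - q1 ^ d * q3 ^ r) * (1 - q1 ^ (d + 1) * q3 ^ r)).

Definition f_factor (la : domwt N) (i : 'I_N) : K :=
  \prod_(j < N | (i < j)%N)
    let d := part la j - part la i in
    let r := j%:Z - i%:Z in
    ((1 - q1 ^ (d + 1) * q3 ^ (r + 1)) * (1 - q1 ^ d * q3 ^ (r - 1))) /
    ((1 - q1 ^ (d + 1) * q3 ^ r) * (1 - q1 ^ d * q3 ^ r)).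

(* e_m and f_m are the coefficients of z^(-m) in e(z) and f(z) *)
Definition e_op (m : int) : W -> W :=
  fglift (fun la : domwt N => (1 - q1)^-1 *:
    \sum_(i < N) (e_factor la i *
      delta_coef (q1 ^ part la i * q3 ^ i%:Z) m) *: oket (move la i 1)).

Definition f_op (m : int) : W -> W :=
  fglift (fun la : domwt N => (- (1 - q1^-1))^-1 *:
    \sum_(i < N) (f_factor la i *
      delta_coef (q1 ^ (part la i - 1) * q3 ^ i%:Z) m) *: oket (move la i (-1))).

Definition ratz := {fraction {poly K}}.
Definition zvar : ratz := tofrac ('X : {poly K}).
Definition zcst (c : K) : ratz := tofrac c%:P.

(* c is the expansion of g as a power series in x (which is z or z^-1 below):
   g = p(x) / d(x) for polynomials p, d with d(0) != 0, and
   d(X) * (\sum_n c_n X^n) = p(X) as formal power series. *)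
Definition is_expansion (g x : ratz) (c : nat -> K) : Prop :=
  exists p d : {poly K},
    [/\ d`_0 != 0,
        g * (map_poly zcst d).[x] = (map_poly zcst p).[x]
      & forall n, \sum_(k < n.+1) d`_k * c (n - k)%N = p`_n].

Definition expansion_coef (g x : ratz) (n : nat) : K :=
  xget 0 [set a | exists2 c, is_expansion g x c & c n = a]%classic.

Definition psi_eigen (la : domwt N) : ratz :=
  \prod_(i < N)
    let l := part la i in
    ((1 - zcst (q1 ^ l * q3 ^ (i%:Z + 1)) / zvar) *
     (1 - zcst (q1 ^ (l - 1) * q3 ^ (i%:Z - 1)) / zvar)) /
    ((1 - zcst (q1 ^ l * q3 ^ i%:Z) / zvar) *
     (1 - zcst (q1 ^ (l - 1) * q3 ^ i%:Z) / zvar)).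

(* psi_plus n is psi^+_n, psi_minus n is psi^-_(-n), for n >= 0 *)
Definition psi_plus (n : nat) : W -> W :=
  fglift (fun la : domwt N =>
    expansion_coef (psi_eigen la) (zvar^-1) n *: ket la).

Definition psi_minus (n : nat) : W -> W :=
  fglift (fun la : domwt N =>
    expansion_coef (psi_eigen la) zvar n *: ket la).

End Module.

Definition ratfun (K : fieldType) (N : nat) := {fraction {mpoly K[N]}}.

HB.instance Definition _ (K : fieldType) (N : nat) :=
  GRing.Field.on (ratfun K N).

Definition ofpoly (K : fieldType) (N : nat) (p : {mpoly K[N]}) : ratfun K N :=
  tofrac p.

Definition ofcst (K : fieldType) (N : nat) (c : K) : ratfun K N :=
  ofpoly c%:MP.

Definition xvar (K : fieldType) (N : nat) (i : 'I_N) : ratfun K N :=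
  ofpoly 'X_i.

Section RatfunLmodule.
Variables (K : fieldType) (N : nat).

Definition ratfun_scale (c : K) (f : ratfun K N) : ratfun K N := ofcst N c * f.

Fact ratfun_scaleA a b f :
  ratfun_scale a (ratfun_scale b f) = ratfun_scale (a * b) f.
Proof.
by rewrite /ratfun_scale mulrA; congr (_ * _); rewrite /ofcst /ofpoly mpolyCM tofracM.
Qed.

Fact ratfun_scale1 : left_id 1 ratfun_scale.
Proof. by move=> f; rewrite /ratfun_scale /ofcst /ofpoly mpolyC1 tofrac1 mul1r. Qed.

Fact ratfun_scaleDr : right_distributive ratfun_scale +%R.
Proof. by move=> c f g; rewrite /ratfun_scale mulrDr. Qed.

Fact ratfun_scaleDl f : {morph ratfun_scale^~ f : a b / a + b}.
Proof.
move=> a b; rewrite /ratfun_scale -mulrDl; congr (_ * _).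
by rewrite /ofcst /ofpoly mpolyCD tofracD.
Qed.

HB.instance Definition _ := GRing.Zmodule_isLmodule.Build K (ratfun K N)
  ratfun_scaleA ratfun_scale1 ratfun_scaleDr ratfun_scaleDl.

End RatfunLmodule.

(* The action on fractions of an injective ring endomorphism h of the
   polynomial ring (the result does not depend on the representative). *)
Definition frac_map (K : fieldType) (N : nat)
    (h : {mpoly K[N]} -> {mpoly K[N]}) (f : ratfun K N) : ratfun K N :=
  ofpoly (h (\n_(generic_quotient.repr f))) / ofpoly (h (\d_(generic_quotient.repr f))).

(* C(q,t)[x_1^{+-1}, .., x_N^{+-1}]^{S_N}, inside K(x_1, .., x_N) *)
Definition sym_laurent (K : fieldType) (N : nat) (f : ratfun K N) : Prop :=
  (exists (k : nat) (p : {mpoly K[N]}),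
     f * (\prod_(i < N) xvar K i) ^+ k = ofpoly p) /\
  (forall s : 'S_N, frac_map (msym s) f = f).

Section Macdonald.
Variables (K : fieldType) (N : nat) (q t : K).

Definition Tshift (i : 'I_N) : ratfun K N -> ratfun K N :=
  frac_map (fun p => p \mPo [tuple (if j == i then q *: 'X_j else 'X_j) | j < N]).

Definition macD (r : nat) (h : ratfun K N) : ratfun K N :=
  \sum_(I : {set 'I_N} | #|I| == r)
    t ^+ (r * r.-1)./2 *:
    ((\prod_(i in I) \prod_(j in ~: I)
        ((t *: xvar K i - xvar K j) / (xvar K i - xvar K j))) *
     (\big[comp/idfun]_(i in I) Tshift i) h).

Local Open Scope nat_scope.

Definition is_partition (m : 'X_{1..N}) : bool := sorted geq m.

Definition dominated (m1 m2 : 'X_{1..N}) : bool :=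
  (mdeg m1 == mdeg m2) &&
  [forall k : 'I_N, \sum_(i < N | i <= k) m1 i <= \sum_(i < N | i <= k) m2 i].

Definition sdominated (m1 m2 : 'X_{1..N}) : bool :=
  (m1 != m2) && dominated m1 m2.

Local Close Scope nat_scope.

(* m_mu: the sum of the distinct monomials obtained by permuting x^mu; the
   degree bound only serves to make the range of summation a finite type. *)
Definition monsym (mu : 'X_{1..N}) : {mpoly K[N]} :=
  \sum_(m : 'X_{1..N < (mdeg mu).+1} | perm_eq (m : 'X_{1..N}) mu) 'X_[m].

Definition is_macdonald (la : 'X_{1..N}) (p : {mpoly K[N]}) : Prop :=
  [/\ p \is symmetric,
      exists u : 'X_{1..N} -> K,
        p = monsym la +
            \sum_(mu : 'X_{1..N < (mdeg la).+1}
                   | is_partition mu && sdominated mu la) u mu *: monsym mu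
    & \sum_(r < N.+1) macD r (ofpoly p) *: 'X^r =
      ofpoly p *:
        \prod_(i < N) (1 + ofcst N (q ^+ la i * t ^+ (N - i.+1)) *: 'X)].

Definition mnm_of (la : domwt N) : 'X_{1..N} := [multinom `|part la i|%N | i < N].

(* Here la0 is the weight la - (la_N, .., la_N). *)
Definition macdonald_family (P : domwt N -> ratfun K N) : Prop :=
  (forall la : domwt N, 0 <= last_part la ->
     exists2 p, is_macdonald (mnm_of la) p & P la = ofpoly p) /\
  (forall la la0 : domwt N,
     (forall i, part la0 i = part la i - last_part la) ->
     P la = (\prod_(i < N) xvar K i) ^ last_part la * P la0).

End Macdonald.

(* Main.v *)
Require Import Defs.
From HB Require Import structures.
From mathcomp Require Import all_boot all_order all_fingroup all_algebra.
From mathcomp Require Import ring zify.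
From mathcomp Require classical_sets.
From mathcomp Require Import reals complex freeg mpoly.

Set Implicit Arguments.
Unset Strict Implicit.
Unset Printing Implicit Defensive.

Import Order.TTheory GRing.Theory Num.Theory.
Local Open Scope ring_scope.

(** Attach to an integer weight w the point z_w = (q^(w_i) t^(N - i))_i, and
    let a_I(x) be the product of (t x_i - x_j) / (x_i - x_j) over i in I and j
    outside I, so that D^r is the sum of t^(r(r-1)/2) a_I(x) T_I over |I| = r.
    On P_la the operators D^r have the eigenvalues e_r(z_la). This spectrum is
    simple, so the P_la are linearly independent; they span the symmetric
    Laurent polynomials because x^la is the leading monomial of P_la. The
    eigenvalues of psi^+_1 and psi^-_(-1) are e_1(z_la) and e_1(z_la^(-1)) up to
    the stated constants, and D^(-1) is controlled by D^(N-1), since the product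
    of all shifts but the i-th is T_i^(-1) times the total dilation.

    What remains are the Pieri rules for e_1 and for e_(N-1) / e_N, the sum of
    the inverse variables. They rest on one rational identity, mac_coef_comm,
    which is a partial fraction expansion and is read at two kinds of points.

    At the generic point x it says [D^(r+1), e_1] = q K D^r - D^r K, where
    K = sum_i x_i a_i(x) T_i (macD_e1). Between P_mu and P_nu this relation gives
      (1 + w X) prod_i (1 + z_nu,i X) = (1 + q w X) prod_i (1 + z_mu,i X)
    with w = (e_1(z_nu) - e_1(z_mu)) / (q - 1), and this forces w = z_mu,i and
    nu = mu + 1_i for some i: only the expected P_nu occur in e_1 P_mu
    (pieri_support). Next, at t^rho = z_0 all terms of D^r vanish except the one
    of I = {1, .., r}. Evaluating D^r (e_1 P_mu) at t^rho in two ways, for all r,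
    yields a linear system for the numbers c_i P_(mu + 1_i)(t^rho), where the c_i
    are the Pieri coefficients, and the generating function of the system at
    X = -1 / z_mu,i isolates the i-th unknown (pieri1_values). Hence none of the
    P_la(t^rho) vanishes, and on P_la / P_la(t^rho) multiplication by e_1 has the
    coefficients a_i(z_la).

    At the points z_la the same identity is the recursion which the relation
    [D^1, e_(r+1)] = q e_r K - K e_r imposes on Pieri coefficients; thus e_r has
    the coefficients t^(r(r-1)/2) a_I(z_la) on P_la / P_la(t^rho) (pieri_P_norm).
    Comparing leading monomials there gives the ratio of P_(la + omega_r)(t^rho)
    to P_la(t^rho), for omega_r = (1^r, 0^(N-r)) (rho_val_seg). As la and
    la + 1_i differ from kappa = la - omega_(i-1) by omega_(i-1) and omega_i, the
    ratio of their values at t^rho is a quotient of two such coefficients, and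
    the Pieri coefficients in the normalization of the P_la follow for e_1 and,
    with r = N - 1, for e_(N-1). *)

(** * A partial fraction identity *)

Section Lagrange.
Variables (F : fieldType) (T : finType).

(** The difference of the two monic polynomials with roots y and y' has degree
    less than the number of nodes; the two sides are its coefficient in the
    highest possible degree, by Lagrange interpolation at the y_a and by expansion. *)
Lemma lagrange_sum (A : {set T}) (y y' : T -> F) :
  {in A &, injective y} ->
  \sum_(a in A) (\prod_(b in A) (y a - y' b)) /
     (\prod_(b in A | b != a) (y a - y b)) = \sum_(b in A) (y b - y' b).
Proof.
move=> y_inj; have [->|[a0 a0A]] := set_0Vmem A; first by rewrite !big_set0.
have A_gt0 : (0 < #|A|)%N by apply/card_gt0P; exists a0.
pose M (z : T -> F) : {poly F} := \prod_(b in A) ('X - (z b)%:P).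
pose Q a : {poly F} := \prod_(b in A | b != a) ('X - (y b)%:P).
have sizeM z : size (M z) = #|A|.+1.
  by rewrite /M big_mkcond /= -big_mkcond /= -big_enum size_prod_XsubC -cardE.
have coefM z : (M z)`_(#|A|.-1) = - \sum_(b in A) z b.
  rewrite -big_enum /= -(big_map z xpredT id) -coefPn_prod_XsubC; last first.
    by rewrite size_map -cardE -lt0n.
  by rewrite size_map -cardE /M -big_enum /= big_map.
have monicM z : (M z) \is monic by rewrite monic_prod // => b _; apply: monicXsubC.
have MQ a : a \in A -> M y = ('X - (y a)%:P) * Q a.
  by move=> aA; rewrite /M (bigD1 a).
have sizeQ a : a \in A -> size (Q a) = #|A|.
  move=> aA; have := sizeM y; rewrite (MQ a aA) size_monicM ?monicXsubC ?size_XsubC //.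
    by rewrite addnC addn2 /= => -[].
  by apply: monic_neq0; rewrite monic_prod // => b _; apply: monicXsubC.
have coefQ a : a \in A -> (Q a)`_(#|A|.-1) = 1.
  move=> aA; rewrite -(sizeQ a aA) -lead_coefE; apply/monicP.
  by rewrite monic_prod // => b _; apply: monicXsubC.
have hornerQ a c : (Q a).[c] = \prod_(b in A | b != a) (c - y b).
  by rewrite /Q horner_prod; apply: eq_bigr => b _; rewrite hornerXsubC.
have hornerM z c : (M z).[c] = \prod_(b in A) (c - z b).
  by rewrite /M horner_prod; apply: eq_bigr => b _; rewrite hornerXsubC.
pose H := M y' - M y.
pose L := \sum_(a in A) (H.[y a] / (Q a).[y a]) *: Q a.
have Hya a : a \in A -> H.[y a] = \prod_(b in A) (y a - y' b).
  by move=> aA; rewrite !hornerE !hornerM [X in _ - X](bigD1 a) //= subrr mul0r subr0.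
have Qne0 a : a \in A -> (Q a).[y a] != 0.
  move=> aA; rewrite hornerQ; apply/prodf_neq0 => b /andP[bA ba].
  by rewrite subr_eq0; apply: contra ba => /eqP/y_inj->.
have LH a : a \in A -> L.[y a] = H.[y a].
  move=> aA; rewrite /L horner_sum (bigD1 a) //= hornerZ divfK ?Qne0 //.
  rewrite big1 ?addr0 // => b /andP[bA ba].
  rewrite hornerZ [(Q b).[y a]]hornerQ (bigD1 a) /= ?subrr ?mul0r ?mulr0 //.
  by rewrite aA eq_sym.
have sizeH : (size H <= #|A|)%N.
  rewrite -ltnS -(sizeM y'); apply: leq_trans (_ : (size H < (#|A|.+1))%N) _; last first.
    by rewrite sizeM.
  apply/leq_sizeP => j; rewrite leq_eqVlt => /orP[/eqP<-|ltAj].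
    rewrite coefB; have := monicP (monicM y'); have := monicP (monicM y).
    by rewrite !lead_coefE !sizeM /= => -> ->; rewrite subrr.
  by rewrite coefB !nth_default ?subrr // sizeM.
have sizeL : (size L <= #|A|)%N.
  apply: (leq_trans (size_sum _ _ _)); apply/bigmax_leqP => a aA.
  by apply: (leq_trans (size_scale_leq _ _)); rewrite sizeQ.
have eqLH : L = H.
  apply/eqP; rewrite -subr_eq0; apply/eqP.
  apply: (@roots_geq_poly_eq0 _ _ [seq y a | a <- enum A]).
  - apply/allP => c /mapP[a]; rewrite mem_enum => aA ->.
    by rewrite /root hornerD hornerN LH // subrr.
  - rewrite map_inj_in_uniq ?enum_uniq // => a b; rewrite !mem_enum.
    exact: y_inj.
  - rewrite size_map -cardE; apply: (leq_trans (size_polyD _ _)).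
    by rewrite size_polyN geq_max sizeL.
have := congr1 (fun p : {poly F} => p`_(#|A|.-1)) eqLH.
rewrite coefB !coefM opprK addrC -sumrB => <-.
rewrite /L coef_sum; apply: eq_bigr => a aA.
by rewrite coefZ coefQ // mulr1 Hya // hornerQ.
Qed.

End Lagrange.

(** * The coefficients of the Macdonald operators *)

Section OperatorCoefficients.
Variables (F : fieldType) (T : finType) (q t : F).

Local Notation phi u v := ((t * u - v) / (u - v)).

Definition mac_coef (x : T -> F) (I : {set T}) : F :=
  \prod_(i in I) \prod_(j in ~: I) phi (x i) (x j).

Definition qshift (J : {set T}) (x : T -> F) (i : T) : F :=
  if i \in J then q * x i else x i.

Hypotheses (q_neq0 : q != 0) (t_neq0 : t != 0).
Hypotheses (q_neq1 : q != 1) (t_neq1 : t != 1) (q_neqt : q != t).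

Lemma mac_coef_eq x y (I : {set T}) : x =1 y -> mac_coef x I = mac_coef y I.
Proof. by move=> e; apply: eq_bigr => i _; apply: eq_bigr => j _; rewrite !e. Qed.

Lemma mac_coef_scale (c : F) x (I : {set T}) : c != 0 ->
  mac_coef (fun i => c * x i) I = mac_coef x I.
Proof.
move=> c0; apply: eq_bigr => i _; apply: eq_bigr => j _.
by rewrite mulrCA -!mulrBr -mulf_div divff // mul1r.
Qed.

Lemma mac_coef1 x (I : {set T}) i : i \in I ->
  mac_coef x [set i] =
  (\prod_(l in ~: I) phi (x i) (x l)) *
  (\prod_(k in I | k != i) phi (x i) (x k)).
Proof.
move=> iI; rewrite /mac_coef big_set1 (bigID (mem I)) /= mulrC; congr (_ * _).
  apply: eq_bigl => j; rewrite !inE andbC.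
  by case: (boolP (j \in I)) => //= jI; apply: contraNneq jI => ->.
by apply: eq_bigl => j; rewrite !inE andbC.
Qed.

Lemma mac_coefD1 x (I : {set T}) i : i \in I ->
  mac_coef x I = (\prod_(l in ~: I) phi (x i) (x l)) *
  (\prod_(k in I | k != i) \prod_(l in ~: I) phi (x k) (x l)).
Proof. by move=> iI; rewrite /mac_coef (bigD1 i). Qed.

Lemma mac_coef_setD1 x (I : {set T}) i : i \in I ->
  mac_coef x (I :\ i) =
  \prod_(k in I | k != i) (phi (x k) (x i) * \prod_(l in ~: I) phi (x k) (x l)).
Proof.
move=> iI; rewrite /mac_coef; apply: eq_big => [k|k].
  by rewrite !inE andbC.
rewrite !inE => /andP[ki kI]; rewrite (bigD1 i) ?inE ?eqxx //=.
congr (_ * _); apply: eq_bigl => l; rewrite !inE.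
by case: (eqVneq l i) => [->|_] /=; rewrite ?iI ?andbF ?andbT.
Qed.

(** Both sides are the coefficient of T_i T_J, for i in J, in a product of the
    first-order operator with a_i and the operator with a_J, taken in the two
    orders. *)
Lemma mac_coef_swap x (J : {set T}) i : i \in J ->
  mac_coef x [set i] * mac_coef (qshift [set i] x) J =
  mac_coef x J * mac_coef (qshift J x) [set i].
Proof.
move=> iJ; rewrite (mac_coef1 x iJ) (mac_coef1 (qshift J x) iJ).
rewrite !(mac_coefD1 _ iJ) mulrACA [in RHS]mulrACA.
congr (_ * _); last first.
  rewrite mulrC; congr (_ * _).
    apply: eq_bigr => k /andP[kJ ki]; apply: eq_bigr => l; rewrite inE => lJ.
    rewrite /qshift !inE (negPf ki) ifN //.
    by apply: contraNneq lJ => ->.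
  apply: eq_bigr => k /andP[kJ ki]; rewrite /qshift iJ kJ.
  by rewrite mulrCA -!mulrBr -mulf_div divff // mul1r.
congr (_ * _); apply: eq_bigr => l; rewrite inE => lJ.
rewrite /qshift inE eqxx iJ (negPf lJ) inE ifN //.
by apply: contraNneq lJ => ->.
Qed.

(** Splitting i off I from the left; for r = #|I| this and the next lemma give
    the coefficients of T_I in D^1 D^(r-1) and D^(r-1) D^1. *)
Lemma mac_coef_lstep x (I : {set T}) i : i \in I ->
  mac_coef x [set i] * mac_coef (qshift [set i] x) (I :\ i) =
  mac_coef x I * \prod_(k in I | k != i) (phi (x i) (x k) * phi (x k) (q * x i)).
Proof.
move=> iI; rewrite (mac_coef1 x iI) (mac_coef_setD1 _ iI) (mac_coefD1 x iI).
rewrite -!mulrA; congr (_ * _); rewrite -!big_split /=.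
apply: eq_bigr => k /andP[kI ki].
rewrite [RHS]mulrC -[RHS]mulrA; congr (_ * _); rewrite /qshift !inE (negPf ki) eqxx.
congr (_ * _).
apply: eq_bigr => l; rewrite !inE => lI; rewrite ifN //.
by apply: contraNneq lI => ->.
Qed.

Lemma mac_coef_rstep x (I : {set T}) i : i \in I ->
  mac_coef x (I :\ i) * mac_coef (qshift (I :\ i) x) [set i] =
  mac_coef x I * \prod_(k in I | k != i) (phi (x k) (x i) * phi (x i) (q * x k)).
Proof.
move=> iI; rewrite (mac_coef1 _ iI) (mac_coef_setD1 _ iI) (mac_coefD1 x iI).
rewrite mulrCA -[RHS]mulrA; congr (_ * _).
  apply: eq_bigr => l; rewrite !inE => lI.
  by rewrite /qshift !inE eqxx (negPf lI) andbF.
rewrite -!big_split /=; apply: eq_bigr => k /andP[kI ki].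
rewrite /qshift !inE eqxx ki kI /=; ring.
Qed.

(** Up to a common factor, the two kinds of terms on the left are the residues at
    z = x_i and z = x_i / q of the product over k in I of
    (t z - x_k) (t x_k - q z) / ((z - x_k) (x_k - q z)), and the right-hand side is
    its coefficient of 1/z at infinity. *)
Lemma lagrange_mac x (I : {set T}) :
  {in I, forall i, x i != 0} ->
  {in I &, forall i j, i != j -> x i != x j} ->
  {in I &, forall i j, i != j -> x i != q * x j} ->
  \sum_(i in I) x i *
    (q * \prod_(k in I | k != i) (phi (x i) (x k) * phi (x k) (q * x i))
     - \prod_(k in I | k != i) (phi (x k) (x i) * phi (x i) (q * x k))) =
  (q - 1) * t ^+ #|I|.-1 * \sum_(i in I) x i.
Proof.
move=> x0 xx xqx.
(* The second component selects the pole x_k / q rather than x_k; y' lists the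
   zeros x_k / t and t x_k / q. *)
pose y (p : T * bool) := if p.2 then x p.1 / q else x p.1.
pose y' (p : T * bool) := if p.2 then t * x p.1 / q else x p.1 / t.
pose A := [set p : T * bool | p.1 \in I].
have y_inj : {in A &, injective y}.
  move=> [i b] [j c]; rewrite !inE /= => iI jI.
  have [<-{j jI}|ij] := eqVneq i j.
    have hq : x i / q != x i.
      rewrite -subr_eq0 (_ : _ - _ = (1 - q) / q * x i); last by field.
      by rewrite !mulf_neq0 ?invr_eq0 ?x0 // subr_eq0 eq_sym.
    case: b c => [] [] //; rewrite /y /= => /eqP; first by rewrite (negPf hq).
    by rewrite eq_sym (negPf hq).
  have ji : j != i by rewrite eq_sym.
  case: b c => [] []; rewrite /y /=.
  - by move=> /(mulIf (invr_neq0 q_neq0))/eqP; rewrite (negPf (xx _ _ iI jI ij)).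
  - move=> /(canRL (divfK q_neq0)) /eqP; rewrite mulrC.
    by rewrite (negPf (xqx _ _ iI jI ij)).
  - move=> /esym /(canRL (divfK q_neq0)) /eqP; rewrite mulrC.
    by rewrite (negPf (xqx _ _ jI iI ji)).
  - by move=> /eqP; rewrite (negPf (xx _ _ iI jI ij)).
have sumA (G : T * bool -> F) :
  \sum_(p in A) G p = \sum_(i in I) (G (i, true) + G (i, false)).
  transitivity (\sum_(i in I) \sum_(b : bool) G (i, b)).
    rewrite (pair_big (mem I) predT (fun i b => G (i, b))) /=.
    by apply: eq_big => [[i b]|[i b]] //; rewrite inE andbT.
  by apply: eq_bigr => i _; rewrite big_bool.
have prodA (G : T * bool -> F) :
  \prod_(p in A) G p = \prod_(i in I) (G (i, true) * G (i, false)).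
  transitivity (\prod_(i in I) \prod_(b : bool) G (i, b)).
    rewrite (pair_big (mem I) predT (fun i b => G (i, b))) /=.
    by apply: eq_big => [[i b]|[i b]] //; rewrite inE andbT.
  by apply: eq_bigr => i _; rewrite big_bool.
have prodD (G : T * bool -> F) i c : i \in I ->
  \prod_(p in A | p != (i, c)) G p =
  G (i, ~~ c) * \prod_(k in I | k != i) (G (k, true) * G (k, false)).
  move=> iI; rewrite (bigD1 (i, ~~ c)) /=; last first.
    by rewrite inE iI xpair_eqE eqxx; case: c.
  congr (_ * _).
  transitivity (\prod_(k in I | k != i) \prod_(b : bool) G (k, b)).
    rewrite (pair_big (fun k => (k \in I) && (k != i)) predT (fun i b => G (i, b))) /=.
    apply: eq_big => [[k b]|[k b]] //; rewrite inE andbT /= !xpair_eqE -andbA.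
    by case: (k == i); case: b c => [] [].
  by apply: eq_bigr => k _; rewrite big_bool.
have rhs : \sum_(b in A) (y b - y' b) =
   (1 - t^-1) * (1 - t / q) * \sum_(i in I) x i.
  rewrite sumA mulr_sumr; apply: eq_bigr => i _; rewrite /y /y' /=.
  by field; rewrite q_neq0.
have rI k : (k \in I) = true -> forall i, i \in I -> k != i ->
    [/\ x i - x k != 0, x i - q * x k != 0, x k - q * x i != 0 & q * x i - x k != 0].
  move=> kI i iI ki; have ik : i != k by rewrite eq_sym.
  by rewrite !subr_eq0 xx // !xqx // eq_sym xqx.
have prodt i (f : T -> F) : i \in I ->
  \prod_(k in I | k != i) (t^-1 * f k) = t^-1 ^+ #|I|.-1 * \prod_(k in I | k != i) f k.
  move=> iI; rewrite big_split /=; congr (_ * _).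
  rewrite prodr_const; congr (_ ^+ _); rewrite (cardD1 i I) iI add1n /=.
  by apply: eq_card => k; rewrite !inE unfold_in /= andbC.
have cardI i : i \in I -> #|I| = #|I|.-1.+1 by move=> iI; rewrite (cardD1 i I) iI.
(* The residues at x_i and x_i / q have the prefactors C and - C / q. *)
pose C := (t - 1) * (q - t) / (t * (q - 1)).
have q1 : q - 1 != 0 by rewrite subr_eq0.
have q1' : 1 - q != 0 by rewrite subr_eq0 eq_sym.
have term1 i : i \in I ->
  (\prod_(b in A) (y (i, false) - y' b)) /
     (\prod_(b in A | b != (i, false)) (y (i, false) - y b)) =
  C * t^-1 ^+ #|I|.-1 * (x i *
    \prod_(k in I | k != i) (phi (x i) (x k) * phi (x k) (q * x i))).
  move=> iI; rewrite prodD // prodA (bigD1 i) //= /y /y' /=.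
  rewrite -mulf_div -prodf_div.
  rewrite (eq_bigr (fun k => t^-1 * (phi (x i) (x k) * phi (x k) (q * x i)))); last first.
    move=> k /andP[kI ki]; have [h1 h2 h3 h4] := rI k kI i iI ki.
    by field; rewrite t_neq0 q_neq0 h1 h3 mulrC h4.
  rewrite prodt // [LHS]mulrA [RHS]mulrA; congr (_ * _); rewrite [RHS]mulrAC; congr (_ * _).
  rewrite /C.
  field; rewrite t_neq0 q_neq0 q1 /=.
  rewrite (_ : _ - _ = (q - 1) * x i); last by ring.
  by rewrite mulf_neq0 ?x0.
have term2 i : i \in I ->
  (\prod_(b in A) (y (i, true) - y' b)) /
     (\prod_(b in A | b != (i, true)) (y (i, true) - y b)) =
  - (C / q) * t^-1 ^+ #|I|.-1 * (x i *
    \prod_(k in I | k != i) (phi (x k) (x i) * phi (x i) (q * x k))).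
  move=> iI; rewrite prodD // prodA (bigD1 i) //= /y /y' /=.
  rewrite -mulf_div -prodf_div.
  rewrite (eq_bigr (fun k => t^-1 * (phi (x k) (x i) * phi (x i) (q * x k)))); last first.
    move=> k /andP[kI ki]; have [h1 h2 h3 h4] := rI k kI i iI ki.
    have h5 : x k - x i != 0 by rewrite -oppr_eq0 opprB.
    by field; rewrite ?t_neq0 ?q_neq0 ?h1 ?h2 ?h3 ?h4 ?h5.
  rewrite prodt // [LHS]mulrA [RHS]mulrA; congr (_ * _); rewrite [RHS]mulrAC; congr (_ * _).
  rewrite /C.
  field; rewrite t_neq0 q_neq0 q1 /=.
  rewrite (_ : x i + - x i * q = (1 - q) * x i); last by ring.
  by rewrite mulf_neq0 ?x0.
have := lagrange_sum y' y_inj; rewrite rhs sumA => eq1.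
have C0 : C != 0.
  by rewrite /C !mulf_neq0 ?invr_eq0 ?mulf_neq0 ?subr_eq0.
case: (set_0Vmem I) => [->|[i0 i0I]]; first by rewrite !big_set0 mulr0.
apply: (mulfI C0).
apply: (mulfI (expf_neq0 #|I|.-1 (invr_neq0 t_neq0))).
transitivity (q * ((1 - t^-1) * (1 - t / q) * \sum_(i in I) x i)); last first.
  rewrite /C exprVn; field.
  by rewrite q1 t_neq0 expf_neq0.
rewrite -eq1 !mulr_sumr; apply: eq_bigr => i iI; rewrite term1 // term2 //.
by field.
Qed.

(** The identity behind every step. Summing it against an arbitrary function Phi
    of the pair (i, J) makes it applicable in any module: for Phi i J = T_i T_J h
    it is an operator identity, and for Phi i J a basis vector moved by 1_i + 1_J
    it is an identity between Pieri coefficients. *)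
Lemma mac_coef_comm (V : lmodType F) (x : T -> F) (r : nat)
    (Phi : T -> {set T} -> V) (Psi : {set T} -> V) :
  (forall i, x i != 0) ->
  (forall i j, i != j -> x i != x j) ->
  (forall i j, i != j -> x i != q * x j) ->
  (forall i (J : {set T}), i \notin J -> Phi i J = Psi (i |: J)) ->
  \sum_(i : T) \sum_(J : {set T} | #|J| == r)
    (q * x i * (mac_coef x [set i] * mac_coef (qshift [set i] x) J)
     - mac_coef x J * (qshift J x i * mac_coef (qshift J x) [set i])) *: Phi i J =
  \sum_(I : {set T} | #|I| == r.+1)
    ((q - 1) * t ^+ r * (\sum_(i in I) x i) * mac_coef x I) *: Psi I.
Proof.
move=> x0 xx xqx PhiPsi.
pose G i (I : {set T}) := x i *
  (q * \prod_(k in I | k != i) (phi (x i) (x k) * phi (x k) (q * x i))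
     - \prod_(k in I | k != i) (phi (x k) (x i) * phi (x i) (q * x k))).
transitivity (\sum_(I : {set T} | #|I| == r.+1) \sum_(i in I)
   (G i I * mac_coef x I) *: Psi I); last first.
  apply: eq_bigr => I /eqP cI; rewrite -scaler_suml -mulr_suml.
  by rewrite lagrange_mac ?cI //= => i j _ _ ij; [apply: xx|apply: xqx].
rewrite [RHS](exchange_big_dep predT) //=; apply: eq_bigr => i _.
rewrite (bigID (fun J : {set T} => i \in J)) /= big1 ?add0r; last first.
  move=> J /andP[_ iJ]; rewrite mac_coef_swap // /qshift iJ -/(qshift J x).
  by rewrite [X in _ - X]mulrCA subrr scale0r.
rewrite [RHS](reindex_onto (fun J => i |: J) (fun I => I :\ i)) /=; last first.
  by move=> I /andP[_ iI]; rewrite setD1K.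
apply: eq_big => [J|J /andP[/eqP cJ iJ]].
  rewrite setU11 andbT cardsU1; case: (boolP (i \in J)) => /= iJ.
    rewrite andbF; apply/esym/negP => /andP[_ /eqP eJ].
    by move: iJ; rewrite -eJ !inE eqxx.
  by rewrite setU1K // eqxx !andbT.
rewrite PhiPsi //; congr (_ *: _).
have e : J = (i |: J) :\ i by rewrite setU1K.
have iI : i \in i |: J by rewrite setU11.
have sJi : qshift J x i = x i by rewrite /qshift (negPf iJ).
rewrite sJi [X in _ - X]mulrCA {1 2 3}e.
by rewrite mac_coef_lstep // mac_coef_rstep // /G; ring.
Qed.

End OperatorCoefficients.

(** * Rational functions: dilations and values *)

Lemma frac_numden (D : idomainType) (x : {fraction D}) :
  x * tofrac \d_(generic_quotient.repr x) = tofrac \n_(generic_quotient.repr x).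
Proof.
unlock tofrac; set r := generic_quotient.repr x.
have d0 : \d_r != 0 by exact: denom_ratioP.
rewrite -[X in X * _]generic_quotient.reprK -/r -[LHS]FracField.pi_mul.
apply/generic_quotient.eqmodP; rewrite /= FracField.equivfE /FracField.mulf.
by rewrite !numden_Ratio ?mulf_neq0 ?oner_neq0 // !mulr1 mulrC.
Qed.

Section RationalFunctions.
Variables (K : fieldType) (N : nat).
Local Notation R := (ratfun K N).
Local Notation P := {mpoly K[N]}.
Implicit Types (f g : R) (p n d : P) (a b : K) (z : 'I_N -> K).

Lemma ofpoly_zmod : zmod_morphism (@ofpoly K N).
Proof. exact: tofracB. Qed.

Lemma ofpoly_monoid : monoid_morphism (@ofpoly K N).
Proof. by split; [exact: tofrac1 | exact: tofracM]. Qed.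

HB.instance Definition _ :=
  GRing.isZmodMorphism.Build P R (@ofpoly K N) ofpoly_zmod.
HB.instance Definition _ :=
  GRing.isMonoidMorphism.Build P R (@ofpoly K N) ofpoly_monoid.

Lemma ofcst_zmod : zmod_morphism (@ofcst K N).
Proof. by move=> a b; rewrite /ofcst mpolyCB rmorphB. Qed.

Lemma ofcst_monoid : monoid_morphism (@ofcst K N).
Proof. by split=> [|a b]; rewrite /ofcst ?rmorph1 // mpolyCM rmorphM. Qed.

HB.instance Definition _ :=
  GRing.isZmodMorphism.Build K R (@ofcst K N) ofcst_zmod.
HB.instance Definition _ :=
  GRing.isMonoidMorphism.Build K R (@ofcst K N) ofcst_monoid.

Lemma ofpoly_eq0 p : (ofpoly p == 0) = (p == 0).
Proof. exact: tofrac_eq0. Qed.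

Lemma ofpoly_inj : injective (@ofpoly K N).
Proof. by move=> p p' /eqP; rewrite tofrac_eq => /eqP. Qed.

Lemma scale_ratfunE a f : a *: f = ofcst N a * f.
Proof. by []. Qed.

Lemma scale_ratfunAl a f g : a *: (f * g) = a *: f * g.
Proof. by rewrite !scale_ratfunE mulrA. Qed.

Lemma scale_ratfunAr a f g : a *: (f * g) = f * (a *: g).
Proof. by rewrite !scale_ratfunE mulrCA. Qed.

Lemma ofpolyZ a p : ofpoly (a *: p) = a *: ofpoly p.
Proof. by rewrite -mul_mpolyC rmorphM. Qed.

Lemma xvar_neq0 (i : 'I_N) : xvar K i != 0.
Proof.
rewrite ofpoly_eq0; apply/eqP => /(congr1 (mcoeff U_(i))).
by rewrite mcoeffX eqxx mcoeff0 => /eqP; rewrite oner_eq0.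
Qed.

Lemma ratfunP f : exists n d, d != 0 /\ f = ofpoly n / ofpoly d.
Proof.
exists \n_(generic_quotient.repr f), \d_(generic_quotient.repr f).
have d0 : \d_(generic_quotient.repr f) != 0 by exact: denom_ratioP.
split=> //; apply: (canRL (mulfK _)); first by rewrite ofpoly_eq0.
exact: frac_numden.
Qed.

Lemma frac_eq n d n' d' : d != 0 -> d' != 0 ->
  (ofpoly n / ofpoly d == ofpoly n' / ofpoly d') = (n * d' == n' * d).
Proof.
move=> d0 d'0; rewrite eqr_div ?ofpoly_eq0 // -!rmorphM.
by apply/eqP/eqP => [/ofpoly_inj|->].
Qed.

Lemma frac_mapE (h : P -> P) n d :
  {morph h : p q / p * q} -> (forall p, h p = 0 -> p = 0) -> d != 0 ->
  frac_map h (ofpoly n / ofpoly d) = ofpoly (h n) / ofpoly (h d).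
Proof.
move=> hM h0 d0; rewrite /frac_map; set f : R := ofpoly n / ofpoly d.
have e0 : \d_(generic_quotient.repr f) != 0 by exact: denom_ratioP.
have hn0 p : p != 0 -> h p != 0 by move=> p0; apply: contra_neq p0; apply: h0.
apply/eqP; rewrite frac_eq ?hn0 // -!hM; apply/eqP; congr (h _).
have e : f * ofpoly \d_(generic_quotient.repr f) =
  ofpoly \n_(generic_quotient.repr f) := frac_numden f.
apply: ofpoly_inj; rewrite !rmorphM /= -e mulrAC; congr (_ * _).
by rewrite divfK ?ofpoly_eq0.
Qed.

Section FracMapMorphism.
Variable h : P -> P.
Hypotheses (hD : {morph h : p q / p + q}) (hM : {morph h : p q / p * q}).
Hypotheses (h1 : h 1 = 1) (h0 : forall p, h p = 0 -> p = 0).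

Let hn0 p : p != 0 -> h p != 0.
Proof. by move=> p0; apply: contra_neq p0; apply: h0. Qed.

Lemma frac_map_poly p : frac_map h (ofpoly p) = ofpoly (h p).
Proof.
rewrite -[ofpoly p]divr1 -[1](rmorph1 (@ofpoly K N)) frac_mapE ?oner_neq0 //.
by rewrite h1 rmorph1 divr1.
Qed.

Lemma frac_mapD : {morph frac_map h : f g / f + g}.
Proof.
move=> f g.
have [n [d [d0 ->]]] := ratfunP f; have [n' [d' [d'0 ->]]] := ratfunP g.
rewrite addf_div ?ofpoly_eq0 // -!rmorphM -rmorphD /= !frac_mapE ?mulf_neq0 //.
by rewrite hD !hM rmorphD !(rmorphM (@ofpoly K N)) addf_div ?ofpoly_eq0 ?hn0.
Qed.

Lemma frac_mapM : {morph frac_map h : f g / f * g}.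
Proof.
move=> f g.
have [n [d [d0 ->]]] := ratfunP f; have [n' [d' [d'0 ->]]] := ratfunP g.
rewrite mulf_div -!rmorphM /= !frac_mapE ?mulf_neq0 //.
by rewrite !hM !(rmorphM (@ofpoly K N)) mulf_div.
Qed.

End FracMapMorphism.

(** The shift operators and their composites. Such a map is determined by the
    scalars c, which replaces computations with numerators and denominators. *)
Definition dilation (c : 'I_N -> K) (h : R -> R) : Prop :=
  [/\ {morph h : f g / f + g}, {morph h : f g / f * g},
      forall a, h (ofcst N a) = ofcst N a
    & forall i, h (xvar K i) = ofcst N (c i) * xvar K i].

Definition dil_tuple (c : 'I_N -> K) : N.-tuple P := [tuple c i *: 'X_i | i < N].

Lemma dilation_poly c h p : dilation c h ->
  h (ofpoly p) = ofpoly (p \mPo dil_tuple c).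
Proof.
case=> hD hM hC hX.
have h0 : h 0 = 0 by have := hC 0; rewrite !rmorph0.
have h1 : h 1 = 1 by have := hC 1; rewrite !rmorph1.
have hS I (r : seq I) (G : I -> R) : h (\sum_(i <- r) G i) = \sum_(i <- r) h (G i).
  exact: (big_morph h hD h0).
have hPr I (r : seq I) (G : I -> R) : h (\prod_(i <- r) G i) = \prod_(i <- r) h (G i).
  exact: (big_morph h hM h1).
rewrite {1}[p]mpolyE rmorph_sum hS comp_mpolyE rmorph_sum; apply: eq_bigr => m _.
rewrite -mul_mpolyC -[RHS]/(ofpoly _) !ofpolyZ !rmorphM hM [h (ofpoly _%:MP)]hC.
congr (_ * _); rewrite mpolyXE_id !rmorph_prod hPr; apply: eq_bigr => i _ /=.
rewrite rmorphXn tnth_mktuple /=.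
have hXn k : h (xvar K i ^+ k) = h (xvar K i) ^+ k.
  by elim: k => [|k IHk]; rewrite ?expr0 // !exprS hM IHk.
by rewrite [LHS]hXn hX rmorphXn /= ofpolyZ.
Qed.

Lemma dilationV c h f : dilation c h -> h f^-1 = (h f)^-1.
Proof.
case=> hD hM hC hX.
have h0 : h 0 = 0 by have := hC 0; rewrite !rmorph0.
have h1 : h 1 = 1 by have := hC 1; rewrite !rmorph1.
have [->|f0] := eqVneq f 0; first by rewrite invr0 h0 invr0.
have e : h f * h f^-1 = 1 by rewrite -hM divff.
have hf0 : h f != 0 by apply: contra_eq_neq e => ->; rewrite mul0r eq_sym oner_eq0.
by apply: (mulfI hf0); rewrite e divff.
Qed.

Lemma dilation_frac c h n d : dilation c h ->
  h (ofpoly n / ofpoly d) =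
  ofpoly (n \mPo dil_tuple c) / ofpoly (d \mPo dil_tuple c).
Proof.
move=> hc; rewrite -!(dilation_poly _ hc) -(dilationV _ hc).
by case: hc.
Qed.

Lemma dilation_eq c h c' h' : dilation c h -> dilation c' h' -> c =1 c' -> h =1 h'.
Proof.
move=> hc hc' cc f; have [n [d [d0 ->]]] := ratfunP f.
rewrite (dilation_frac _ _ hc) (dilation_frac _ _ hc').
suff -> : dil_tuple c = dil_tuple c' by [].
by apply: eq_from_tnth => i; rewrite !tnth_mktuple cc.
Qed.

Lemma dilation_id : dilation (fun=> 1) idfun.
Proof. by split=> // i; rewrite rmorph1 mul1r. Qed.

Lemma dilation_ext c c' h : dilation c h -> c =1 c' -> dilation c' h.
Proof. by case=> hD hM hC hX cc; split=> // i; rewrite hX cc. Qed.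

Lemma dilation_comp c h c' h' : dilation c h -> dilation c' h' ->
  dilation (fun i => c i * c' i) (h \o h').
Proof.
case=> hD hM hC hX [hD' hM' hC' hX']; split=> /=.
- by move=> f g /=; rewrite hD' hD.
- by move=> f g /=; rewrite hM' hM.
- by move=> a /=; rewrite hC' hC.
- by move=> i; rewrite hX' hM hC hX mulrA -rmorphM [c' i * _]mulrC.
Qed.

Lemma dilationZ c h a f : dilation c h -> h (a *: f) = a *: h f.
Proof. by case=> hD hM hC hX; rewrite !scale_ratfunE hM hC. Qed.

Lemma dilation_sum c h I (r : seq I) (Q : pred I) (G : I -> R) : dilation c h ->
  h (\sum_(i <- r | Q i) G i) = \sum_(i <- r | Q i) h (G i).
Proof.
case=> hD hM hC hX; apply: (big_morph h hD).
by have := hC 0; rewrite !rmorph0.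
Qed.

Lemma dilation_prod c h I (r : seq I) (Q : pred I) (G : I -> R) : dilation c h ->
  h (\prod_(i <- r | Q i) G i) = \prod_(i <- r | Q i) h (G i).
Proof.
case=> hD hM hC hX; apply: (big_morph h hM).
by have := hC 1; rewrite !rmorph1.
Qed.

(** Used for the injectivity of substitutions x_i := c_i x_i. *)
Lemma mcoeff_dil c p m :
  (p \mPo dil_tuple c)@_m = p@_m * \prod_(i < N) c i ^+ m i.
Proof.
have dilX m' : 'X_[m'] \mPo dil_tuple c = (\prod_(i < N) c i ^+ m' i) *: 'X_[m'].
  rewrite comp_mpolyX [X in _ = _ *: X]mpolyXE_id -scaler_prod.
  by apply: eq_bigr => i _; rewrite tnth_mktuple exprZn.
rewrite {1}[p]mpolyE (raddf_sum (comp_mpoly (dil_tuple c))) (raddf_sum (mcoeff m)) /=.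
transitivity (\sum_(m' <- msupp p) p@_m' * (\prod_(i < N) c i ^+ m' i) * (m' == m)%:R).
  by apply: eq_bigr => m' _; rewrite comp_mpolyZ dilX !mcoeffZ mcoeffX mulrA.
have [mp|mp] := boolP (m \in msupp p).
  rewrite (bigD1_seq m) ?msupp_uniq //= eqxx mulr1 [X in _ + X]big1 ?addr0 // => m' /negPf->.
  by rewrite mulr0.
rewrite (memN_msupp_eq0 mp) mul0r big_seq big1 // => m' m'p.
by rewrite (_ : (m' == m) = false) ?mulr0 //; apply: contraNF mp => /eqP <-.
Qed.

Lemma comp_dil_eq0 c p : (forall i, c i != 0) -> p \mPo dil_tuple c = 0 -> p = 0.
Proof.
move=> c0 e; apply/mpolyP => m; have := congr1 (mcoeff m) e.
rewrite mcoeff_dil !mcoeff0 => /eqP; rewrite mulf_eq0 => /orP[/eqP//|/prodf_eq0[i _]].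
by rewrite expf_eq0 (negPf (c0 i)) andbF.
Qed.

Definition one_at (q : K) (A : {set 'I_N}) (i : 'I_N) : K := if i \in A then q else 1.

Lemma dilation_Tshift q i : q != 0 -> dilation (one_at q [set i]) (Tshift q i).
Proof.
move=> q0; set c := one_at q [set i].
have c0 j : c j != 0 by rewrite /c /one_at; case: ifP => // _; rewrite oner_neq0.
pose h p := p \mPo dil_tuple c.
have hE : Tshift q i =1 frac_map h.
  move=> f; rewrite /Tshift /frac_map /h.
  suff -> : dil_tuple c = [tuple (if j == i then q *: 'X_j else 'X_j) | j < N] by [].
  apply: eq_from_tnth => j; rewrite !tnth_mktuple /c /one_at inE.
  by case: ifP => // _; rewrite scale1r.
have hM : {morph h : p q / p * q} by move=> p p'; exact: rmorphM.
have hD : {morph h : p q / p + q} by move=> p p'; exact: rmorphD.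
have h0 p : h p = 0 -> p = 0 by exact: comp_dil_eq0.
have h1 : h 1 = 1 by exact: comp_mpoly1.
have hp p : frac_map h (ofpoly p) = ofpoly (h p) by exact: frac_map_poly.
split.
- by move=> f g; rewrite !hE frac_mapD.
- by move=> f g; rewrite !hE frac_mapM.
- by move=> a; rewrite hE hp /h comp_mpolyC.
- move=> j; rewrite hE hp /h comp_mpolyXU -tnth_nth tnth_mktuple.
  by rewrite ofpolyZ.
Qed.

Definition Tset (q : K) (A : {set 'I_N}) : R -> R :=
  \big[comp/idfun]_(i in A) Tshift q i.

Lemma dilation_Tset q A : q != 0 -> dilation (one_at q A) (Tset q A).
Proof.
move=> q0; rewrite /Tset.
have : uniq (index_enum 'I_N) by exact: index_enum_uniq.
suff H (r : seq 'I_N) : uniq r -> dilation (fun j => if (j \in A) && (j \in r) then q else 1)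
    (\big[comp/idfun]_(i <- r | i \in A) Tshift q i).
  move=> /H; move/dilation_ext; apply=> j.
  by rewrite mem_index_enum andbT.
elim: r => [_|i r IHr /= /andP[ir /IHr IH]].
  by rewrite big_nil; apply: (dilation_ext dilation_id) => j; rewrite andbF.
rewrite big_cons; case: ifP => iA.
  apply: (dilation_ext (dilation_comp (dilation_Tshift i q0) IH)) => j.
  rewrite /one_at !inE; have [->|] := eqVneq j i; last by rewrite mul1r.
  by rewrite iA (negPf ir) /= mulr1.
apply: (dilation_ext IH) => j; rewrite inE; have [->|//] := eqVneq j i.
by rewrite iA.
Qed.

(** Values of rational functions are handled as a relation: f takes the value a
    at z when some denominator of f does not vanish there. *)
Definition evals z f a : Prop :=
  exists n d, [/\ d.@[z] != 0, f = ofpoly n / ofpoly d & a = n.@[z] / d.@[z]].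

Lemma meval_neq0 z p : p.@[z] != 0 -> p != 0.
Proof. by apply: contra_neq => ->; rewrite meval0. Qed.

Lemma evals_uniq z f a b : evals z f a -> evals z f b -> a = b.
Proof.
move=> [n [d [d0 -> ->]]] [n' [d' [d'0 /eqP e ->]]].
rewrite frac_eq ?(meval_neq0 d0) ?(meval_neq0 d'0) // in e.
by apply/eqP; rewrite eqr_div // -!mevalM (eqP e).
Qed.

Lemma evals_poly z p : evals z (ofpoly p) p.@[z].
Proof. by exists p, 1; rewrite meval1 oner_neq0 rmorph1 !divr1. Qed.

Lemma evals_cst z a : evals z (ofcst N a) a.
Proof. by have := evals_poly z a%:MP; rewrite mevalC. Qed.

Lemma evals_xvar z i : evals z (xvar K i) (z i).
Proof. by have := evals_poly z 'X_i; rewrite mevalXU. Qed.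

Lemma evalsD z f g a b : evals z f a -> evals z g b -> evals z (f + g) (a + b).
Proof.
move=> [n [d [d0 -> ->]]] [n' [d' [d'0 -> ->]]].
exists (n * d' + n' * d), (d * d'); rewrite mevalM mulf_neq0 //; split=> //.
  by rewrite addf_div ?ofpoly_eq0 ?(meval_neq0 d0) ?(meval_neq0 d'0) // -!rmorphM -rmorphD.
by rewrite addf_div // mevalD !mevalM.
Qed.

Lemma evalsM z f g a b : evals z f a -> evals z g b -> evals z (f * g) (a * b).
Proof.
move=> [n [d [d0 -> ->]]] [n' [d' [d'0 -> ->]]].
exists (n * n'), (d * d'); rewrite mevalM mulf_neq0 //; split=> //.
  by rewrite mulf_div -!rmorphM.
by rewrite mulf_div !mevalM.
Qed.

Lemma evalsZ z a f b : evals z f b -> evals z (a *: f) (a * b).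
Proof. by rewrite scale_ratfunE; apply: evalsM; apply: evals_cst. Qed.

Lemma evalsV z f a : a != 0 -> evals z f a -> evals z f^-1 a^-1.
Proof.
move=> a0 [n [d [d0 -> ea]]]; rewrite ea in a0 *.
have n0 : n.@[z] != 0 by apply: contra_neq a0 => ->; rewrite mul0r.
by exists d, n; rewrite n0 !invf_div.
Qed.

Lemma evals0 z : evals z 0 0.
Proof. by have := evals_cst z 0; rewrite rmorph0. Qed.

Lemma evals1 z : evals z 1 1.
Proof. by have := evals_cst z 1; rewrite rmorph1. Qed.

Lemma evals_sum z I (r : seq I) (Q : pred I) (F : I -> R) (G : I -> K) :
  (forall i, Q i -> evals z (F i) (G i)) ->
  evals z (\sum_(i <- r | Q i) F i) (\sum_(i <- r | Q i) G i).
Proof.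
move=> FG; apply: (big_ind2 (evals z)) => //; first exact: evals0.
by move=> *; apply: evalsD.
Qed.

Lemma evals_prod z I (r : seq I) (Q : pred I) (F : I -> R) (G : I -> K) :
  (forall i, Q i -> evals z (F i) (G i)) ->
  evals z (\prod_(i <- r | Q i) F i) (\prod_(i <- r | Q i) G i).
Proof.
move=> FG; apply: (big_ind2 (evals z)) => //; first exact: evals1.
by move=> *; apply: evalsM.
Qed.

Lemma evals_exp z f a k : a != 0 -> evals z f a -> evals z (f ^ k) (a ^ k).
Proof.
move=> a0 fa; have H m : evals z (f ^+ m) (a ^+ m).
  elim: m => [|m IHm]; first exact: evals1.
  by rewrite !exprS; apply: evalsM.
case: k => m; first exact: H.
by rewrite !NegzE -!exprnN; apply: evalsV => //; rewrite expf_neq0.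
Qed.

Lemma evals_ext z z' f a : z =1 z' -> evals z f a -> evals z' f a.
Proof.
move=> e [n [d [d0 -> ->]]]; exists n, d.
by rewrite -!(meval_eq _ e); split=> //; rewrite -(meval_eq _ e).
Qed.

Lemma evals_dilation c h z f a : dilation c h ->
  evals (fun i => c i * z i) f a -> evals z (h f) a.
Proof.
move=> hc [n [d [d0 -> ->]]]; exists (n \mPo dil_tuple c), (d \mPo dil_tuple c).
have e p : (p \mPo dil_tuple c).@[z] = p.@[fun i => c i * z i].
  rewrite comp_mpoly_meval; apply: meval_eq => i.
  by rewrite tnth_mktuple mevalZ mevalXU.
by rewrite !e; split=> //; exact: (dilation_frac _ _ hc).
Qed.

End RationalFunctions.

(** * Elementary symmetric sums *)

Section ElementarySums.
Variables (F : comNzRingType) (T : finType).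
Implicit Types (x : T -> F) (r : nat).

Definition elsym x r : F := \sum_(I : {set T} | #|I| == r) \prod_(i in I) x i.

Definition elsymD1 x i r : F :=
  \sum_(I : {set T} | (#|I| == r) && (i \notin I)) \prod_(j in I) x j.

Lemma elsym_recl x i r : elsym x r.+1 = x i * elsymD1 x i r + elsymD1 x i r.+1.
Proof.
rewrite /elsym (bigID (fun I : {set T} => i \in I)) /=; congr (_ + _).
rewrite (reindex_onto (fun J => i |: J) (fun I => I :\ i)) /=; last first.
  by move=> I /andP[_ iI]; rewrite setD1K.
rewrite /elsymD1 mulr_sumr; apply: eq_big => [J|J].
  rewrite setU11 andbT cardsU1; case: (boolP (i \in J)) => /= iJ.
    rewrite andbF; apply/negP => /andP[_ /eqP eJ].
    by move: iJ; rewrite -eJ !inE eqxx.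
  by rewrite setU1K // eqxx !andbT.
move=> /andP[/andP[_ _] /eqP eJ]; have iJ : i \notin J by rewrite -eJ !inE eqxx.
by rewrite big_setU1.
Qed.

Lemma elsym0 x : elsym x 0 = 1.
Proof.
rewrite /elsym (big_pred1 set0) ?big_set0 // => I.
by rewrite cards_eq0.
Qed.

Lemma elsymD10 x i : elsymD1 x i 0 = 1.
Proof.
rewrite /elsymD1 (big_pred1 set0) ?big_set0 // => I.
rewrite cards_eq0 /=; have [->|//] := eqVneq I set0.
by rewrite inE.
Qed.

Lemma elsymD1_eq x y i r : (forall j, j != i -> x j = y j) ->
  elsymD1 x i r = elsymD1 y i r.
Proof.
move=> xy; apply: eq_bigr => I /andP[_ iI]; apply: eq_bigr => j jI.
by apply: xy; apply: contraNneq iI => <-.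
Qed.

Lemma elsym_gt x r : (#|T| < r)%N -> elsym x r = 0.
Proof.
move=> rT; rewrite /elsym big1 // => I /eqP cI.
by have := max_card (mem I); rewrite cI leqNgt rT.
Qed.

Lemma sum_card1 (V : nmodType) (G : {set T} -> V) :
  \sum_(I : {set T} | #|I| == 1%N) G I = \sum_i G [set i].
Proof.
rewrite -(big_imset G (h := fun i : T => [set i]) (A := mem T)) /=; last first.
  by move=> i j _ _ /set1_inj.
apply: eq_bigl => I; apply/idP/imsetP => [/cards1P[i ->]|[i _ ->]].
  by exists i.
by rewrite cards1.
Qed.

Lemma sum_cardC1 (V : nmodType) (G : {set T} -> V) : (0 < #|T|)%N ->
  \sum_(I : {set T} | #|I| == #|T|.-1) G I = \sum_i G (~: [set i]).
Proof.
move=> T0; rewrite -(sum_card1 (fun I => G (~: I))).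
rewrite (reindex_inj (inv_inj (@setCK T))) /=; apply: eq_bigl => I.
have := cardsC I; move: T0; case: #|T| => // n _ /= e; apply/eqP/eqP; lia.
Qed.

Lemma sum_cardT (V : nmodType) (G : {set T} -> V) :
  \sum_(I : {set T} | #|I| == #|T|) G I = G setT.
Proof.
rewrite (big_pred1 setT) // => I; apply/eqP/eqP => [cI|->]; last by rewrite cardsT.
by apply/eqP; rewrite eqEcard subsetT cardsT cI /=.
Qed.

Lemma elsym1 x : elsym x 1 = \sum_i x i.
Proof. by rewrite /elsym sum_card1; apply: eq_bigr => i _; rewrite big_set1. Qed.

Lemma elsym_gen x y : \prod_i (1 + y * x i) = \sum_(r < #|T|.+1) y ^+ r * elsym x r.
Proof.
transitivity (\sum_(I : {set T}) y ^+ #|I| * \prod_(i in I) x i).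
  rewrite (eq_bigr (fun i => y * x i + 1)) => [|i _]; last by rewrite addrC.
  rewrite bigA_distr /=; apply: eq_bigr => I _.
  rewrite -prodr_const -big_split /=; rewrite [RHS]big_mkcond /=.
  by apply: eq_bigr.
rewrite (partition_big (fun I : {set T} => inord #|I| : 'I_#|T|.+1) predT) //=.
apply: eq_bigr => r _; rewrite /elsym mulr_sumr.
have cI (I : {set T}) : (inord #|I| == r) = (#|I| == r).
  by rewrite -val_eqE /= inordK // ltnS max_card.
by apply: eq_big => I; rewrite cI // => /eqP ->.
Qed.

Lemma elsym_eq x y r :
  x =1 y -> elsym x r = elsym y r.
Proof. by move=> e; apply: eq_bigr => I _; apply: eq_bigr => i _; rewrite e. Qed.

Lemma elsymZ (c : F) x r :
  elsym (fun i => c * x i) r = c ^+ r * elsym x r.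
Proof.
rewrite /elsym mulr_sumr; apply: eq_bigr => I /eqP <-.
by rewrite -prodr_const -big_split.
Qed.

End ElementarySums.

Lemma elsym_rmorph (F F' : comNzRingType) (T : finType) (f : {rmorphism F -> F'})
  (c : T -> F) r : elsym (f \o c) r = f (elsym c r).
Proof.
rewrite /elsym rmorph_sum; apply: eq_bigr => I _.
by rewrite rmorph_prod.
Qed.

Lemma elsym_pred (F : fieldType) (T : finType) (x : T -> F) :
  (0 < #|T|)%N -> (forall i, x i != 0) ->
  elsym x #|T|.-1 = (\prod_i x i) * \sum_i (x i)^-1.
Proof.
move=> T0 x0; rewrite /elsym sum_cardC1 // mulr_sumr; apply: eq_bigr => i _.
rewrite [in RHS](bigD1 i) //= mulrAC divff ?x0 // mul1r.
by apply: eq_bigl => j; rewrite !inE.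
Qed.

(** * Macdonald operators and multiplication operators *)

Lemma half_mulS r : ((r.+1 * r)./2 = (r * r.-1)./2 + r)%N.
Proof.
case: r => [|r]; first by [].
rewrite (_ : (r.+2 * r.+1 = r.+1 * r.+1.-1 + r.+1.*2)%N); last by lia.
by rewrite halfD doubleK odd_double andbF.
Qed.

Section Operators.
Variables (K : fieldType) (N : nat) (q t : K).
Hypotheses (q_neq0 : q != 0) (t_neq0 : t != 0).
Hypotheses (q_neq1 : q != 1) (t_neq1 : t != 1) (q_neqt : q != t).
Local Notation R := (ratfun K N).
Implicit Types (f g h : R) (I J A B : {set 'I_N}).

Local Notation x := (@xvar K N).
Local Notation oc := (@ofcst K N).
Local Notation T := (@Tset K N q).
Local Notation A x := (mac_coef (oc t) x).

Let TP B := @dilation_Tset K N q B q_neq0.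

Lemma Tset_sum B (S0 : Type) (r : seq S0) (Q : pred S0) (G : S0 -> R) :
  T B (\sum_(i <- r | Q i) G i) = \sum_(i <- r | Q i) T B (G i).
Proof. exact: dilation_sum (TP B). Qed.

Lemma Tset_prod B (S0 : Type) (r : seq S0) (Q : pred S0) (G : S0 -> R) :
  T B (\prod_(i <- r | Q i) G i) = \prod_(i <- r | Q i) T B (G i).
Proof. exact: dilation_prod (TP B). Qed.

Lemma TsetM B f g : T B (f * g) = T B f * T B g.
Proof. by case: (TP B). Qed.

Lemma TsetD B f g : T B (f + g) = T B f + T B g.
Proof. by case: (TP B). Qed.

Lemma TsetZ B a f : T B (a *: f) = a *: T B f.
Proof. exact: dilationZ (TP B). Qed.

Lemma Tset_xvar B i : T B (x i) = qshift (oc q) B x i.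
Proof.
case: (TP B) => _ _ _ ->; rewrite /one_at /qshift.
by case: ifP => // _; rewrite rmorph1 mul1r.
Qed.

Lemma Tset_cst B a : T B (oc a) = oc a.
Proof. by case: (TP B). Qed.

Lemma TsetN B f : T B (- f) = - T B f.
Proof. by rewrite -scaleN1r TsetZ scaleN1r. Qed.

Lemma TsetV B f : T B f^-1 = (T B f)^-1.
Proof. exact: dilationV (TP B). Qed.

Lemma Tset_mac B I : T B (A x I) = A (qshift (oc q) B x) I.
Proof.
rewrite /mac_coef Tset_prod; apply: eq_bigr => i _; rewrite Tset_prod.
apply: eq_bigr => j _; rewrite TsetM TsetV !TsetD !TsetN TsetM.
by rewrite Tset_cst !Tset_xvar.
Qed.

Lemma TsetC B C h : T B (T C h) = T C (T B h).
Proof.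
have H := dilation_eq (dilation_comp (TP B) (TP C)) (dilation_comp (TP C) (TP B)).
by apply: H => i; rewrite mulrC.
Qed.

Lemma TsetU i J h : i \notin J -> T [set i] (T J h) = T (i |: J) h.
Proof.
move=> iJ; apply: (dilation_eq (dilation_comp (TP [set i]) (TP J)) (TP _)) => j.
rewrite /one_at !inE; have [->|_] := eqVneq j i; last by rewrite mul1r.
by rewrite (negPf iJ) mulr1.
Qed.

Lemma macDE r h : macD q t r h =
  \sum_(I : {set 'I_N} | #|I| == r) t ^+ (r * r.-1)./2 *: (A x I * T I h).
Proof. by []. Qed.

Lemma macDD r f g : macD q t r (f + g) = macD q t r f + macD q t r g.
Proof.
rewrite !macDE -big_split /=; apply: eq_bigr => I _.
by rewrite TsetD mulrDr scalerDr.
Qed.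

Lemma macDZ r a f : macD q t r (a *: f) = a *: macD q t r f.
Proof.
rewrite !macDE scaler_sumr; apply: eq_bigr => I _.
by rewrite TsetZ -scale_ratfunAr scalerA mulrC -scalerA.
Qed.

Lemma macD_sum r (S0 : Type) (s : seq S0) (Q : pred S0) (G : S0 -> R) :
  macD q t r (\sum_(i <- s | Q i) G i) = \sum_(i <- s | Q i) macD q t r (G i).
Proof.
apply: (big_morph (macD q t r) (macDD r)).
by have := macDZ r 0 0; rewrite !scale0r.
Qed.

(** Up to the factor q - 1, the commutator of D^1 with multiplication by e_1. *)
Definition Kop h : R := \sum_(i < N) x i * A x [set i] * T [set i] h.

Lemma KopD f g : Kop (f + g) = Kop f + Kop g.
Proof.
by rewrite /Kop -big_split /=; apply: eq_bigr => i _; rewrite TsetD mulrDr.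
Qed.

Lemma KopZ a f : Kop (a *: f) = a *: Kop f.
Proof.
rewrite /Kop scaler_sumr; apply: eq_bigr => i _.
by rewrite TsetZ -scale_ratfunAr.
Qed.

Lemma Kop_sum (S0 : Type) (s : seq S0) (Q : pred S0) (G : S0 -> R) :
  Kop (\sum_(i <- s | Q i) G i) = \sum_(i <- s | Q i) Kop (G i).
Proof.
apply: (big_morph Kop KopD).
by have := KopZ 0 0; rewrite !scale0r.
Qed.

Lemma ofcst_eq1 a : (oc a == 1) = (a == 1).
Proof. by rewrite -(rmorph1 oc) (inj_eq (fmorph_inj _)). Qed.

Lemma xvar_dist i j : i != j -> x i != x j.
Proof.
move=> ij; apply/eqP => /ofpoly_inj /(congr1 (mcoeff U_(i))).
rewrite !mcoeffX eqxx eq_mnm1 eq_sym (negPf ij) => /eqP.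
by rewrite oner_eq0.
Qed.

Lemma xvar_qdist i j : i != j -> x i != oc q * x j.
Proof.
move=> ij; apply/eqP; rewrite -scale_ratfunE -ofpolyZ => /ofpoly_inj.
move/(congr1 (mcoeff U_(i))).
rewrite mcoeffZ !mcoeffX eqxx eq_mnm1 eq_sym (negPf ij) mulr0 => /eqP.
by rewrite oner_eq0.
Qed.

(** T_I multiplies e_1 by e_1 + (q - 1) times the sum of the x_i, i in I, so the
    left-hand side is, up to a power of t, the right-hand side of mac_coef_comm at
    the generic point. *)
Lemma macD_e1 r h :
  macD q t r.+1 ((\sum_i x i) * h) - (\sum_i x i) * macD q t r.+1 h =
  q *: Kop (macD q t r h) - macD q t r (Kop h).
Proof.
pose Phi i J := T [set i] (T J h).
have inj_oc : injective oc by exact: fmorph_inj.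
have oc_neq a b : a != b -> oc a != oc b by rewrite (inj_eq inj_oc).
have := @mac_coef_comm R 'I_N (oc q) (oc t) _ _ _ _ _ R^o x r Phi (fun I => T I h)
  (@xvar_neq0 _ _) xvar_dist xvar_qdist.
rewrite !fmorph_eq0 !ofcst_eq1 (inj_eq inj_oc) => /(_ q_neq0 t_neq0 q_neq1 t_neq1 q_neqt).
move=> /(_ (fun i J iJ => TsetU h iJ)) key.
pose S : R := \sum_(i : 'I_N) \sum_(J : {set 'I_N} | #|J| == r)
    (oc q * x i * (A x [set i] * A (qshift (oc q) [set i] x) J)
     - A x J * (qshift (oc q) J x i * A (qshift (oc q) J x) [set i])) * Phi i J.
have {}key : S = \sum_(I : {set 'I_N} | #|I| == r.+1)
    ((oc q - 1) * oc t ^+ r * (\sum_(i in I) x i) * A x I) * T I h := key.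
transitivity (oc (t ^+ (r * r.-1)./2) * S).
  rewrite key !macDE half_mulS mulr_sumr mulr_sumr -sumrB.
  apply: eq_bigr => I _; rewrite TsetM Tset_sum !scale_ratfunE exprD !rmorphM /=.
  rewrite !rmorphXn /=.
  have -> : \sum_(i < N) T I (x i) = \sum_i x i + (oc q - 1) * \sum_(i in I) x i.
    rewrite mulr_sumr [X in _ = _ + X]big_mkcond -big_split /=.
    apply: eq_bigr => i _; rewrite Tset_xvar /qshift; case: ifP => _; ring.
  ring.
rewrite /S macDE Kop_sum scaler_sumr exchange_big /= mulr_sumr.
rewrite [X in _ = _ - X]macDE -sumrB; apply: eq_bigr => J _.
rewrite KopZ /Kop Tset_sum !(mulr_sumr, scaler_sumr) -sumrB; apply: eq_bigr => i _.
rewrite !TsetM Tset_mac Tset_mac Tset_xvar (TsetC J) /Phi.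
by rewrite !scale_ratfunE; ring.
Qed.

Definition e_sym r : R := elsym x r.

Lemma macD1E h : macD q t 1 h = \sum_i A x [set i] * T [set i] h.
Proof. by rewrite macDE sum_card1; apply: eq_bigr => i _; rewrite expr0 scale1r. Qed.

Lemma Tset_elsym B r : T B (e_sym r) = elsym (qshift (oc q) B x) r.
Proof.
rewrite /e_sym /elsym Tset_sum; apply: eq_bigr => I _; rewrite Tset_prod.
by apply: eq_bigr => i _; rewrite Tset_xvar.
Qed.

(** T_i only changes x_i, and both sides reduce to (q - 1) times the sum of
    x_i e_r(x without x_i) a_i T_i. *)
Lemma macD1_e_sym r h :
  macD q t 1 (e_sym r.+1 * h) - e_sym r.+1 * macD q t 1 h =
  q *: (e_sym r * Kop h) - Kop (e_sym r * h).
Proof.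
rewrite !macD1E /Kop !mulr_sumr !scaler_sumr -!sumrB; apply: eq_bigr => i _.
rewrite !TsetM !Tset_elsym /e_sym !(elsym_recl _ i).
have eqD k : elsymD1 (qshift (oc q) [set i] x) i k = elsymD1 x i k.
  by apply: elsymD1_eq => j ji; rewrite /qshift inE (negPf ji).
have -> : qshift (oc q) [set i] x i = oc q * x i by rewrite /qshift inE eqxx.
rewrite !eqD !scale_ratfunE.
case: r => [|r]; first by rewrite !elsym0 !elsymD10; ring.
by rewrite !(elsym_recl _ i) !eqD (_ : qshift _ _ _ _ = oc q * x i);
  [ring | rewrite /qshift inE eqxx].
Qed.

Lemma Ttot_e_sym r h : T setT (e_sym r * h) = q ^+ r *: (e_sym r * T setT h).
Proof.
rewrite TsetM scale_ratfunAl; congr (_ * _).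
rewrite Tset_elsym /e_sym /elsym scaler_sumr; apply: eq_bigr => I /eqP cI.
rewrite -cI scale_ratfunE rmorphXn /= -prodr_const -big_split /=.
by apply: eq_bigr => i _; rewrite /qshift inE.
Qed.

Lemma macD_N h : macD q t N h = t ^+ (N * N.-1)./2 *: T setT h.
Proof.
have e : N = #|'I_N| by rewrite card_ord.
rewrite macDE; under eq_bigl do rewrite [in X in _ == X]e.
rewrite sum_cardT /mac_coef setCT big1 ?mul1r // => i _.
by rewrite big_set0.
Qed.

Lemma macD_0 h : macD q t 0 h = h.
Proof.
rewrite macDE (big_pred1 set0) => [|I]; last by rewrite cards_eq0.
rewrite expr0 scale1r /mac_coef big_set0 mul1r.
by rewrite /Tset big_set0.
Qed.

(** All terms of D^r scale alike, since T_I multiplies e_N by q^|I|. *)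
Lemma macD_shift r k h :
  macD q t r ((\prod_i x i) ^ k * h) = q ^ (r%:Z * k) *: ((\prod_i x i) ^ k * macD q t r h).
Proof.
rewrite !macDE mulr_sumr scaler_sumr; apply: eq_bigr => I /eqP cI.
rewrite TsetM.
have Tp : T I (\prod_i x i) = oc (q ^+ r) * \prod_i x i.
  rewrite Tset_prod rmorphXn /= -cI -prodr_const [X in _ = X * _]big_mkcond /= -big_split /=.
  by apply: eq_bigr => i _; rewrite Tset_xvar /qshift; case: ifP; rewrite ?mul1r.
have TXn (f : R) n : T I (f ^+ n) = T I f ^+ n.
  by elim: n => [|n IHn]; rewrite ?expr0 ?exprS ?TsetM ?IHn // -(rmorph1 oc) Tset_cst.
have TX (f : R) (m : int) : T I (f ^ m) = T I f ^ m.
  by case: m => n; rewrite ?NegzE -?exprnN ?TsetV TXn.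
rewrite TX Tp expfzMl !scale_ratfunE -exprz_exp -[q ^ r%:Z]/(q ^+ r) fmorphXz /=; ring.
Qed.

End Operators.

(** * Leading monomials and eigenvalues *)

Section Triangularity.
Variables (K : fieldType) (N : nat).
Implicit Types (m mu : 'X_{1..N}) (p : {mpoly K[N]}).

(** At the first place where two weights of the same degree differ, comparing
    partial sums amounts to comparing entries. *)
Lemma dominated_lemc m1 m2 : dominated m1 m2 -> (m1 <= m2)%O.
Proof.
move=> /andP[/eqP dg /forallP dom]; rewrite leNgt; apply/negP.
move=> /(ltmcP (esym dg)) [i eqji lti].
have := dom i; rewrite (bigD1 i) //= [X in (_ <= X)%N](bigD1 i) //=.
rewrite (eq_bigr m2); first by rewrite leq_add2r leqNgt lti.
move=> j /andP[leji neji]; rewrite eqji //.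
by rewrite ltn_neqAle leji andbT.
Qed.

Lemma mcoeff_monsym mu m : (monsym K mu)@_m = (perm_eq m mu)%:R.
Proof.
rewrite /monsym raddf_sum /=.
have [pm|pm] := boolP (perm_eq m mu); last first.
  rewrite big1 // => m' pm'; rewrite mcoeffX (_ : _ == m = false) //.
  by apply: contraNF pm => /eqP <-.
have dm : (mdeg m < (mdeg mu).+1)%N.
  have e : mdeg m = mdeg mu by rewrite /mdeg; exact: perm_big.
  by rewrite ltnS e.
rewrite (bigD1 (BMultinom dm)) //= mcoeffX eqxx big1 ?addr0 // => m' /andP[_ nem].
by rewrite mcoeffX (_ : _ == m = false) //; apply: contraNF nem => /eqP e; apply/eqP/val_inj.
Qed.

Lemma partition_perm_eq m mu : is_partition m -> is_partition mu ->
  perm_eq m mu -> m = mu.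
Proof.
move=> pm pmu e; apply: val_inj; apply: val_inj => /=.
apply: (sorted_eq (leT := geq)) => //.
  by move=> a b c /= ab ca; apply: leq_trans ca ab.
by move=> a b /= ; rewrite andbC => /anti_leq.
Qed.

Lemma mlead_partition p : p \is symmetric -> is_partition (mlead p).
Proof.
move=> sp; rewrite /is_partition; apply/(sortedP 0%N) => i.
rewrite size_tuple => lt_iN; have lt_i'N : (i < N)%N by lia.
have := @mlead_msym_sorted _ _ p sp (Ordinal lt_i'N) (Ordinal lt_iN) (leqnSn i).
by rewrite !(mnm_nth 0%N).
Qed.

(** The leading monomial of a symmetric polynomial is a partition, hence occurs
    in some m_nu of the expansion only as x^nu itself, with nu dominated by mu. *)
Lemma macdonald_lead (q t : K) mu p : is_partition mu -> is_macdonald q t mu p ->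
  p@_mu = 1 /\ mlead p = mu.
Proof.
move=> pmu [sp [u pE] _].
have coefE m : p@_m = (perm_eq m mu)%:R +
  \sum_(nu : 'X_{1..N < (mdeg mu).+1} | is_partition nu && sdominated nu mu)
     u nu * (perm_eq m nu)%:R.
  rewrite {1}pE mcoeffD mcoeff_monsym raddf_sum /=; congr (_ + _).
  by apply: eq_bigr => nu _; rewrite mcoeffZ mcoeff_monsym.
have c1 : p@_mu = 1.
  rewrite coefE perm_refl big1 ?addr0 // => nu /andP[pnu /andP[nenu _]].
  case: (boolP (perm_eq mu nu)) => [/(partition_perm_eq pmu pnu) e|_]; last by rewrite mulr0.
  by move: nenu; rewrite -[X in X != _]e eqxx.
split=> //; have p0 : p != 0.
  by apply/eqP => p0; move: c1; rewrite p0 mcoeff0 => /eqP; rewrite eq_sym oner_eq0.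
have mu_le : (mu <= mlead p)%O.
  by apply: msupp_le_mlead; rewrite mcoeff_msupp c1 oner_neq0.
apply/eqP; rewrite eq_le mu_le andbT.
have : p@_(mlead p) != 0 by rewrite mleadc_eq0.
have plead := mlead_partition sp.
apply: contraNT; rewrite -ltNge => lt_mu.
have ne_mu : perm_eq (mlead p) mu = false.
  by apply: contraTF lt_mu => /(partition_perm_eq plead pmu) ->; rewrite ltxx.
rewrite coefE ne_mu add0r big1 // => nu /andP[pnu /andP[_ dnu]].
case: (boolP (perm_eq _ _)) => [/(partition_perm_eq plead pnu) e|_]; last by rewrite mulr0.
by move: lt_mu; rewrite ltNge e dominated_lemc.
Qed.

Lemma macdonald_eigen (q t : K) mu p r : is_macdonald q t mu p ->
  macD q t r (ofpoly p) =
  elsym (fun i : 'I_N => q ^+ mu i * t ^+ (N - i.+1)) r *: ofpoly p.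
Proof.
case=> _ _ eig; have [Nr|rN] := ltnP N r.
  rewrite elsym_gt ?card_ord // scale0r macDE big1 // => I /eqP cI.
  by have := max_card (mem I); rewrite cI card_ord leqNgt Nr.
have := congr1 (fun s : {poly ratfun K N} => s`_r) eig.
rewrite coef_sum (bigD1 (Ordinal (rN : (r < N.+1)%N))) //= coefZ coefXn eqxx mulr1.
rewrite big1 ?addr0 => [->|j jr]; last first.
  rewrite coefZ coefXn (_ : (r == j) = false) ?mulr0 //.
  by apply: contraNF jr => /eqP e; apply/eqP/val_inj.
set c := fun i : 'I_N => _ * _.
have -> : \prod_(i < N) (1 + ofcst N (q ^+ mu i * t ^+ (N - i.+1)) *: 'X) =
   \prod_(i < N) (1 + 'X * ((polyC \o @ofcst K N) \o c) i).
  by apply: eq_bigr => i _; rewrite -mul_polyC mulrC.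
rewrite elsym_gen card_ord coefZ coef_sum.
rewrite (bigD1 (Ordinal (rN : (r < N.+1)%N))) //= elsym_rmorph /= coefMC coefXn eqxx mul1r.
rewrite [X in _ + X]big1 => [|j jr].
  by rewrite addr0 scale_ratfunE [LHS]mulrC.
rewrite elsym_rmorph coefMC coefXn (_ : (r == j) = false) ?mul0r //.
by apply: contraNF jr => /eqP e; apply/eqP/val_inj.
Qed.

End Triangularity.

(** * Expansions of rational functions in one variable *)

Section Expansion.
Variable K : fieldType.
Implicit Types (p d : {poly K}) (g x : Defs.ratz K) (c : nat -> K).

Lemma zcst_zmod : zmod_morphism (@zcst K).
Proof. by move=> a b; rewrite /zcst polyCB tofracB. Qed.

Lemma zcst_monoid : monoid_morphism (@zcst K).
Proof. by split=> [|a b]; rewrite /zcst ?tofrac1 // polyCM tofracM. Qed.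

HB.instance Definition _ := GRing.isZmodMorphism.Build K (Defs.ratz K) (@zcst K) zcst_zmod.
HB.instance Definition _ := GRing.isMonoidMorphism.Build K (Defs.ratz K) (@zcst K) zcst_monoid.

Definition zeval x p : Defs.ratz K := (map_poly (@zcst K) p).[x].

Lemma zevalM x p d : zeval x (p * d) = zeval x p * zeval x d.
Proof. by rewrite /zeval rmorphM hornerM. Qed.

Lemma zevalB x p d : zeval x (p - d) = zeval x p - zeval x d.
Proof. by rewrite /zeval rmorphB /= hornerD hornerN. Qed.

Lemma zeval_lin x a : zeval x (1 - a *: 'X) = 1 - zcst a * x.
Proof.
rewrite zevalB /zeval rmorph1 hornerC map_polyZ map_polyX.
by rewrite hornerZ hornerX.
Qed.

Lemma zeval_prod x (I : Type) (r : seq I) (Q : pred I) (F : I -> {poly K}) :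
  zeval x (\prod_(i <- r | Q i) F i) = \prod_(i <- r | Q i) zeval x (F i).
Proof.
by apply: (big_morph (zeval x) (zevalM x)); rewrite /zeval rmorph1 hornerC.
Qed.

(** Polynomials may be compared through their values at such a point. *)
Definition transcendental x := forall p, zeval x p = 0 -> p = 0.

Lemma zevalE x p : zeval x p = \sum_(i < size p) zcst p`_i * x ^+ i.
Proof.
rewrite /zeval horner_coef size_map_poly; apply: eq_bigr => i _.
by rewrite coef_map.
Qed.

Lemma zvar_neq0 : zvar K != 0.
Proof. by rewrite tofrac_eq0 polyX_eq0. Qed.

Lemma zcst_zvar a n : zcst a * zvar K ^+ n = tofrac (a *: 'X^n).
Proof. by rewrite -mul_polyC tofracM tofracXn. Qed.

Lemma transcendental_zvar : transcendental (zvar K).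
Proof.
move=> p; rewrite zevalE; under eq_bigr do rewrite zcst_zvar.
by rewrite -rmorph_sum /= -poly_def coefK => /eqP; rewrite tofrac_eq0 => /eqP.
Qed.

Lemma transcendental_zvarV : transcendental (zvar K)^-1.
Proof.
move=> p; rewrite zevalE => /(congr1 ( *%R (zvar K ^+ size p))).
rewrite mulr0 mulr_sumr.
rewrite (eq_bigr (fun i : 'I_(size p) => tofrac (p`_i *: 'X^(size p - i)))); last first.
  move=> i _.
  rewrite mulrCA exprVn -zcst_zvar; congr (_ * _).
  rewrite -{1}(subnK (ltnW (ltn_ord i))) exprD mulfK //.
  by rewrite expf_neq0 ?zvar_neq0.
rewrite -rmorph_sum /= => /eqP; rewrite tofrac_eq0 => /eqP e.
apply/polyP => k; rewrite coef0; have [kp|pk] := ltnP k (size p); last by rewrite nth_default.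
have := congr1 (fun s : {poly K} => s`_(size p - k)) e.
rewrite coef_sum coef0 (bigD1 (Ordinal kp)) //= coefZ coefXn eqxx mulr1 big1 ?addr0 // => i ik.
rewrite coefZ coefXn (_ : (_ == _) = false) ?mulr0 //.
apply: contraNF ik => /eqP ei; apply/eqP/val_inj => /=; have := ltn_ord i; lia.
Qed.

Lemma lin_neq0 x b : transcendental x -> 1 - zcst b * x != 0.
Proof.
move=> tr; rewrite -zeval_lin; apply/eqP => /tr/(congr1 (fun s : {poly K} => s`_0)).
rewrite coefB coef1 coefZ coefX mulr0 subr0 coef0 => /eqP.
by rewrite oner_eq0.
Qed.

(** The coefficients are computed one at a time from d_0 c_n = p_n - ..., the
    list of the first n of them being the state of the recursion. *)
Lemma power_series_quotient p d : d`_0 != 0 ->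
  exists c, forall n, \sum_(k < n.+1) d`_k * c (n - k)%N = p`_n.
Proof.
move=> d0.
pose nextc (s : seq K) :=
  (p`_(size s) - \sum_(k < size s) d`_k.+1 * s`_(size s - k.+1)) / d`_0.
pose s n := iter n (fun s => rcons s (nextc s)) [::].
have size_s n : size (s n) = n by elim: n => //= n IHn; rewrite size_rcons IHn.
have nth_s n k : (k < n)%N -> (s n)`_k = (s k.+1)`_k.
  elim: n => // n IHn; rewrite ltnS leq_eqVlt => /orP[/eqP -> //|kn].
  by rewrite /= nth_rcons size_s kn IHn.
exists (fun n => (s n.+1)`_n) => n.
rewrite big_ord_recl subn0 /= nth_rcons size_s ltnn eqxx /nextc size_s.
rewrite mulrC divfK // [X in _ - X](eq_bigr (fun k : 'I_n =>
  d`_(bump 0 k) * (rcons (s (n - bump 0 k)%N) (nextc (s (n - bump 0 k)%N)))`_(n - bump 0 k))).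
  by rewrite subrK.
move=> k _; rewrite /bump /= add1n; congr (_ * _).
by rewrite nth_s ?ltn_subrL //; have := ltn_ord k; lia.
Qed.

(** Two representations p / d and p' / d' of g satisfy p d' = p' d, because x is
    transcendental; comparing the constant and linear coefficients suffices. *)
Lemma expansion_uniq g x c c' : transcendental x ->
  is_expansion g x c -> is_expansion g x c' -> c 1%N = c' 1%N.
Proof.
move=> tr [p [d [d0 gp cp]]] [p' [d' [d'0 gp' cp']]].
have pd : p * d' = p' * d.
  apply/eqP; rewrite -subr_eq0; apply/eqP; apply: tr.
  by rewrite zevalB !zevalM /zeval -gp -gp'; ring.
have e0 := cp 0%N; have e1 := cp 1%N; have e0' := cp' 0%N; have e1' := cp' 1%N.
move: e0 e1 e0' e1'; rewrite !big_ord_recr !big_ord0 /= !add0r !subn0 subnn => e0 e1 e0' e1'.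
have := congr1 (fun s : {poly K} => s`_0) pd; have := congr1 (fun s : {poly K} => s`_1) pd.
rewrite !coefM !big_ord_recr !big_ord0 /= !add0r !subn0 subnn -e0 -e1 -e0' -e1' => f1 f0.
have {f0} c00 : c 0%N = c' 0%N.
  by apply: (mulfI (mulf_neq0 d0 d'0)); rewrite mulrAC f0; ring.
apply: (mulfI (mulf_neq0 d0 d'0)); rewrite c00 in f1.
apply/eqP; rewrite -subr_eq0; apply/eqP; move/eqP: f1; rewrite -subr_eq0 => /eqP f1.
rewrite -[RHS]f1; ring.
Qed.

Lemma expansion_coef1 g x p d : transcendental x -> p`_0 = 1 -> d`_0 = 1 ->
  g * zeval x d = zeval x p -> expansion_coef g x 1 = p`_1 - d`_1.
Proof.
move=> tr p0 d0 gp; have dn0 : d`_0 != 0 by rewrite d0 oner_neq0.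
have [c cp] := power_series_quotient p dn0.
have ec : is_expansion g x c by exists p, d.
rewrite /expansion_coef; set S := (X in classical_sets.xget _ X).
have : exists a, S a by exists (c 1%N), c.
move/(classical_sets.xgetPex 0) => [c' ec' <-].
rewrite (expansion_uniq tr ec' ec).
have e0 := cp 0%N; have e1 := cp 1%N.
move: e0 e1; rewrite !big_ord_recr !big_ord0 /= !add0r !subn0 subnn d0 p0 !mul1r => e0.
by rewrite e0 mulr1 => <-; rewrite addrK.
Qed.

Lemma coef0_prod_lin (I : finType) (u : I -> K) : (\prod_i (1 - u i *: 'X))`_0 = 1.
Proof.
rewrite coef0_prod big1 // => i _.
by rewrite coefB coef1 coefZ coefX mulr0 subr0.
Qed.

Lemma coef1_prod_lin (I : finType) (u : I -> K) : (\prod_i (1 - u i *: 'X))`_1 = - \sum_i u i.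
Proof.
rewrite /index_enum; elim: (Finite.enum I) => [|i r IHr].
  by rewrite !big_nil coef1 oppr0.
have c0 : (\prod_(j <- r) (1 - u j *: 'X))`_0 = 1.
  by rewrite coef0_prod big1 // => j _; rewrite coefB coef1 coefZ coefX mulr0 subr0.
rewrite !big_cons mulrBl mul1r coefB IHr -scalerAl coefZ coefXM /= c0.
by rewrite mulr1 opprD addrC.
Qed.

Lemma expansion_coef_prod x (I : finType) (a a' b b' : I -> K) g :
  transcendental x ->
  g = \prod_i (((1 - zcst (a i) * x) * (1 - zcst (a' i) * x)) /
     ((1 - zcst (b i) * x) * (1 - zcst (b' i) * x))) ->
  expansion_coef g x 1 = \sum_i (b i + b' i - a i - a' i).
Proof.
move=> tr ->.
pose pr (u u' : I -> K) := (\prod_i (1 - u i *: 'X)) * (\prod_i (1 - u' i *: 'X)).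
have pr0 u u' : (pr u u')`_0 = 1.
  by rewrite coefM big_ord_recr big_ord0 /= add0r !coef0_prod_lin mulr1.
have pr1 u u' : (pr u u')`_1 = - \sum_i u i - \sum_i u' i.
  rewrite coefM !big_ord_recr big_ord0 /= add0r !coef0_prod_lin !coef1_prod_lin.
  by rewrite mul1r mulr1 addrC.
have prE u u' : zeval x (pr u u') = \prod_i ((1 - zcst (u i) * x) * (1 - zcst (u' i) * x)).
  rewrite zevalM !zeval_prod -big_split /=.
  by apply: eq_bigr => i _; rewrite !zeval_lin.
rewrite (@expansion_coef1 _ x (pr a a') (pr b b')) //.
  rewrite !pr1 opprD !opprK -!sumrN -!big_split /=.
  by apply: eq_bigr => i _; ring.
rewrite !prE -big_split /=; apply: eq_bigr => i _.
by rewrite divfK // mulf_neq0 ?lin_neq0.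
Qed.

Variables (N : nat) (q1 q3 : K).
Hypotheses (q1_neq0 : q1 != 0) (q3_neq0 : q3 != 0).
Implicit Types la : domwt N.

Lemma psi_plus_coef la :
  expansion_coef (psi_eigen q1 q3 la) (zvar K)^-1 1 =
  \sum_(i < N) (1 - q1^-1 * q3^-1) * (1 - q3) * (q1 ^ part la i * q3 ^ i%:Z).
Proof.
rewrite (expansion_coef_prod transcendental_zvarV (erefl (psi_eigen q1 q3 la))).
apply: eq_bigr => i _; rewrite !expfzDr // expr1z !exprN1.
by field; rewrite q1_neq0 q3_neq0.
Qed.

(** Each linear factor 1 - C / z equals - (C / z) (1 - z / C), and the prefactors
    cancel when A A' = B B': this passes from the expansion in 1/z to that in z. *)
Lemma factor_flip (F : fieldType) (z A A' B B' : F) : z != 0 ->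
  A != 0 -> A' != 0 -> B != 0 -> B' != 0 -> A * A' = B * B' ->
  ((1 - A / z) * (1 - A' / z)) / ((1 - B / z) * (1 - B' / z)) =
  ((1 - A^-1 * z) * (1 - A'^-1 * z)) / ((1 - B^-1 * z) * (1 - B'^-1 * z)).
Proof.
move=> z0 A0 A'0 B0 B'0 e.
have flip (C : F) : C != 0 -> 1 - C / z = - (C / z) * (1 - C^-1 * z).
  by move=> C0; field; rewrite z0 C0.
rewrite !flip // mulrACA [X in _ / X]mulrACA -mulf_div.
have -> : - (A / z) * - (A' / z) = - (B / z) * - (B' / z).
  by rewrite !mulrNN !mulf_div e.
by rewrite divff ?mul1r // mulf_neq0 // oppr_eq0 mulf_neq0 ?invr_eq0.
Qed.

Lemma psi_minus_coef la :
  expansion_coef (psi_eigen q1 q3 la) (zvar K) 1 =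
  \sum_(i < N) (1 - q1 * q3) * (1 - q3^-1) * (q1 ^ part la i * q3 ^ i%:Z)^-1.
Proof.
have zc (a : K) : a != 0 -> zcst a != 0 by rewrite fmorph_eq0.
have mn0 k l : q1 ^ k * q3 ^ l != 0 by rewrite mulf_neq0 ?expfz_neq0.
rewrite (@expansion_coef_prod (zvar K) 'I_N
  (fun i => (q1 ^ part la i * q3 ^ (i%:Z + 1))^-1)
  (fun i => (q1 ^ (part la i - 1) * q3 ^ (i%:Z - 1))^-1)
  (fun i => (q1 ^ part la i * q3 ^ i%:Z)^-1)
  (fun i => (q1 ^ (part la i - 1) * q3 ^ i%:Z)^-1) _ transcendental_zvar).
  apply: eq_bigr => i _; rewrite !expfzDr // !expr1z !exprN1.
  by field; rewrite ?q1_neq0 ?q3_neq0 ?expfz_neq0.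
apply: eq_bigr => i _; rewrite /= factor_flip ?zc ?zvar_neq0 ?mn0 // ?fmorphV //.
rewrite -!rmorphM /=; congr zcst; rewrite !expfzDr // !expr1z !exprN1.
by field; rewrite ?q1_neq0 ?q3_neq0.
Qed.

End Expansion.

(** * Dominant weights *)

Section DominantWeights.
Variable N : nat.
Implicit Types (la : domwt N) (w : 'I_N -> int).

(** Weights are functions on the rows, so that they can leave the dominant cone;
    the dominant ones are those with a value here. *)
Definition mkwt w : option (domwt N) := insub [tuple w i | i < N].

Lemma part_mono la (i j : 'I_N) : (i <= j)%N -> part la j <= part la i.
Proof.
move=> ij; rewrite /part !(tnth_nth 0).
have := valP la; rewrite (sorted_pairwise (ge_trans (T := int))) => /(pairwiseP 0) H.
have [->|neij] := eqVneq i j; first exact: lexx.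
apply: H; rewrite ?inE ?size_tuple //.
by rewrite ltn_neqAle ij andbT.
Qed.

Lemma mkwt_some w la : mkwt w = Some la -> part la =1 w.
Proof.
rewrite /mkwt; case: insubP => // u _ e [<-] i.
by rewrite /part e tnth_mktuple.
Qed.

Lemma mkwt_eq w w' : w =1 w' -> mkwt w = mkwt w'.
Proof.
by move=> e; rewrite /mkwt; congr insub; apply: eq_from_tnth => i; rewrite !tnth_mktuple.
Qed.

Lemma mkwt_part la : mkwt (part la) = Some la.
Proof.
rewrite /mkwt (_ : [tuple _ | _ < _] = val la) ?valK //.
by apply: eq_from_tnth => i; rewrite tnth_mktuple.
Qed.

Lemma part_inj la la' : part la =1 part la' -> la = la'.
Proof. by move=> /mkwt_eq; rewrite !mkwt_part => -[]. Qed.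

Lemma mkwt_none w : mkwt w = None ->
  exists i j : 'I_N, j = i.+1 :> nat /\ w i < w j.
Proof.
rewrite /mkwt; case: insubP => // nsorted _.
have : [exists i : 'I_N, exists j : 'I_N, (j == i.+1 :> nat) && (w i < w j)].
  apply: contraNT nsorted => /existsPn H.
  apply/(sortedP 0) => i; rewrite size_tuple => ltiN.
  have lti : (i < N)%N by lia.
  have /existsPn/(_ (Ordinal ltiN)) := H (Ordinal lti).
  rewrite eqxx /= -leNgt => le.
  have e (k : 'I_N) : [tuple w i | i < N]`_k = w k by rewrite -tnth_nth tnth_mktuple.
  by rewrite (e (Ordinal lti)) (e (Ordinal ltiN)).
by case/existsP => i /existsP[j /andP[/eqP ij lt]]; exists i, j.
Qed.

Lemma mkwt_mono w : (forall i j : 'I_N, (i <= j)%N -> w j <= w i) ->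
  exists2 la, mkwt w = Some la & part la =1 w.
Proof.
move=> mono; case e : (mkwt w) => [la|]; first by exists la => //; exact: mkwt_some.
have [i [j [ij]]] := mkwt_none e.
by rewrite ltNge mono // ij.
Qed.

Lemma last_partE la (i : 'I_N) : i.+1 = N -> last_part la = part la i.
Proof.
move=> iN; rewrite /last_part (last_nth 0) size_tuple /part (tnth_nth 0).
by have -> : nth 0 (0 :: val la) N = nth 0 (0 :: val la) i.+1 by rewrite iN.
Qed.

Lemma last_part_le la i : last_part la <= part la i.
Proof.
have ltN : (N.-1 < N)%N by have := ltn_ord i; lia.
rewrite (@last_partE la (Ordinal ltN)) /=; last by lia.
by apply: part_mono; have := ltn_ord i; rewrite /=; lia.
Qed.

Lemma mnm_of_partition la : 0 <= last_part la -> is_partition (mnm_of la).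
Proof.
move=> la0; rewrite /is_partition; apply/(sortedP 0%N) => i.
rewrite size_tuple => ltiN; have lti : (i < N)%N by lia.
rewrite -[nth _ _ i](mnm_nth 0%N (mnm_of la) (Ordinal lti)).
rewrite -[nth _ _ i.+1](mnm_nth 0%N (mnm_of la) (Ordinal ltiN)) !mnmE /=.
have := @part_mono la (Ordinal lti) (Ordinal ltiN) (leqnSn i).
have := last_part_le la (Ordinal ltiN); have := last_part_le la (Ordinal lti); lia.
Qed.

End DominantWeights.

(** * Linear extension from the basis *)

Section LinearExtension.
Variables (K : nzRingType) (X : choiceType) (M : lmodType K) (f : X -> M).

HB.instance Definition _ := GRing.isZmodMorphism.Build {freeg X / K} M
  (fglift f) (lift_is_additive f).

Lemma fglift_sumE v (s : seq X) : uniq s -> {subset dom v <= s} ->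
  fglift f v = \sum_(x <- s) coeff x v *: f x.
Proof.
move=> us sub; have -> : fglift f v = \sum_(x <- dom v) coeff x v *: f x.
  rewrite -{1}[v]freeg_sumE raddf_sum; apply: eq_bigr => x _.
  exact: liftU.
rewrite [RHS](bigID (mem (dom v))) /= [X in _ + X]big1 ?addr0; last first.
  by move=> x /coeff_outdom ->; rewrite scale0r.
rewrite -[RHS]big_filter; apply: perm_big; apply: uniq_perm; rewrite ?uniq_dom ?filter_uniq //.
by move=> x; rewrite mem_filter andb_idr //; exact: sub.
Qed.

Lemma fglift_is_linear : linear (fglift f).
Proof.
move=> c u v; rewrite raddfD /=; congr (_ + _).
rewrite (fglift_sumE (uniq_dom u) (fun=> id)) (fglift_sumE (uniq_dom u)); last first.
  exact: domZ_subset.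
by rewrite scaler_sumr; apply: eq_bigr => x _; rewrite coeffZ scalerA.
Qed.

End LinearExtension.

(** * The Macdonald family *)

Lemma mac_factor_inv (F : fieldType) (c a b : F) :
  b - a != 0 -> a - b != 0 -> c != 0 ->
  (c * b - a) / (b - a) = c * ((c^-1 * a - b) / (a - b)).
Proof. by move=> h1 h2 c0; field; rewrite h1 h2 c0. Qed.

Section MacdonaldFamily.
Variables (K : fieldType) (N : nat) (q t : K).
Hypothesis N_gt0 : (0 < N)%N.
Hypotheses (q_neq0 : q != 0) (t_neq0 : t != 0).
Hypotheses (q_neq1 : q != 1) (t_neq1 : t != 1) (q_neqt : q != t).
Local Notation R := (ratfun K N).
Implicit Types (f g h : R) (la mu nu : domwt N) (w : 'I_N -> int).

(** The point q^w t^rho; the eigenvalues of the D^r on P_w are elementary symmetric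
    functions of its coordinates. *)
Definition spec w (i : 'I_N) : K := q ^ w i * t ^+ (N - i.+1).

(** This makes the spectrum of D^1 simple. *)
Hypothesis spec_sum_inj : forall w w',
  \sum_i spec w i = \sum_i spec w' i -> w =1 w'.

Variable P : domwt N -> R.
Hypothesis hP : macdonald_family q t P.

Local Notation eN := (\prod_(i < N) xvar K i).
Local Notation e_sym := (@e_sym K N).

Lemma spec_eq w w' : w =1 w' -> spec w =1 spec w'.
Proof. by move=> e i; rewrite /spec e. Qed.

Lemma eN_neq0 : eN != 0 :> R.
Proof. by apply/prodf_neq0 => i _; exact: xvar_neq0. Qed.

Lemma P_poly la : 0 <= last_part la -> exists p,
  [/\ P la = ofpoly p, p \is symmetric, p@_(mnm_of la) = 1, mlead p = mnm_of la
    & forall r, macD q t r (P la) = elsym (spec (part la)) r *: P la].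
Proof.
move=> la0; have [p pmac Pp] := hP.1 la la0; exists p.
have [c1 lead] := macdonald_lead (mnm_of_partition la0) pmac.
split=> //; first by case: pmac.
move=> r; rewrite Pp (macdonald_eigen r pmac); congr (_ *: _).
apply: elsym_eq => i; rewrite /spec mnmE; congr (_ * _).
have : 0 <= part la i by exact: le_trans la0 (last_part_le la i).
by case: (part la i).
Qed.

Lemma base_weight la : exists la0, [/\ last_part la0 = 0,
  forall i, part la0 i = part la i - last_part la & P la = eN ^ last_part la * P la0].
Proof.
have [i j ij|la0 _ e] := @mkwt_mono N (fun i => part la i - last_part la).
  by rewrite lerD2r part_mono.
exists la0; split=> //; last exact: hP.2.
have ltN : (N.-1 < N)%N by lia.
have eN1 : (Ordinal ltN).+1 = N by rewrite /=; lia.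
by rewrite (last_partE _ eN1) e (last_partE _ eN1) subrr.
Qed.

(** Both sides are the same power of e_N times P at the common weight with last
    part 0. *)
Lemma P_shift (k : int) la la' : (forall i, part la' i = part la i + k) ->
  P la' = eN ^ k * P la.
Proof.
move=> e; have [la0 [_ e0 ->]] := base_weight la; have [la1 [_ e1 ->]] := base_weight la'.
have ltN : (N.-1 < N)%N by lia.
have el : last_part la' = last_part la + k.
  have eN1 : (Ordinal ltN).+1 = N by rewrite /=; lia.
  by rewrite !(last_partE _ eN1) e.
have -> : la1 = la0 by apply: part_inj => i; rewrite e0 e1 e el; ring.
by rewrite el mulrA -expfzDr ?eN_neq0 // addrC.
Qed.

Lemma P_eigen la r : macD q t r (P la) = elsym (spec (part la)) r *: P la.
Proof.
have [la0 [l0 e0 ->]] := base_weight la.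
have [|p [_ _ _ _ eig]] := @P_poly la0; first by rewrite l0.
rewrite macD_shift // eig -scale_ratfunAr scalerA; congr (_ *: _).
rewrite mulrC -exprz_exp.
have -> : elsym (spec (part la)) r = elsym (fun i => q ^ last_part la * spec (part la0) i) r.
  apply: elsym_eq => i; rewrite /spec e0 mulrA -expfzDr //.
  by congr (q ^ _ * _); ring.
rewrite elsymZ mulrC; congr (_ * _).
by rewrite exprz_exp mulrC -exprz_exp.
Qed.

Lemma P_neq0 la : P la != 0.
Proof.
have [la0 [l0 e0 ->]] := base_weight la.
rewrite mulf_neq0 ?expfz_neq0 ?eN_neq0 //.
have [|p [-> _ c1 _ _]] := @P_poly la0; first by rewrite l0.
rewrite ofpoly_eq0; apply/eqP => p0; move: c1; rewrite p0 mcoeff0 => /eqP.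
by rewrite eq_sym oner_eq0.
Qed.

Lemma Ttot_P la : Tset q setT (P la) =
  ((\prod_i spec (part la) i) / t ^+ (N * N.-1)./2) *: P la.
Proof.
have := P_eigen la N; rewrite macD_N //.
rewrite [elsym _ _](_ : _ = \prod_i spec (part la) i); last first.
  rewrite /elsym; have := @sum_cardT 'I_N K (fun I => \prod_(i in I) spec (part la) i).
  rewrite card_ord => ->; by apply: eq_bigl => i; rewrite inE.
move/(congr1 (fun f => (t ^+ (N * N.-1)./2)^-1 *: f)); rewrite !scalerA mulVf ?expf_neq0 //.
by rewrite scale1r => ->; rewrite mulrC.
Qed.

(** * Linear independence *)

Definition phi (v : WN K N) : R := fglift P v.

Lemma phi_sumE v (s : seq (domwt N)) : uniq s -> {subset dom v <= s} ->
  phi v = \sum_(la <- s) coeff la v *: P la.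
Proof. exact: fglift_sumE. Qed.

Lemma phiE v : phi v = \sum_(la <- dom v) coeff la v *: P la.
Proof. exact: phi_sumE (uniq_dom v) (fun=> id). Qed.

HB.instance Definition _ := GRing.isLinear.Build K (WN K N) R _ phi (fglift_is_linear P).

Lemma phi_ket la : phi (ket K la) = P la.
Proof. by rewrite /phi /ket liftU scale1r. Qed.

Definition diag (e : domwt N -> K) (v : WN K N) : WN K N :=
  \sum_(la <- dom v) << e la * coeff la v *g la >>.

Lemma coeff_diag e v la : coeff la (diag e v) = e la * coeff la v.
Proof.
rewrite /diag raddf_sum /=; have [ladom|ladom] := boolP (la \in dom v).
  rewrite (bigD1_seq la) ?uniq_dom //= coeffU eqxx mulr1 big1 ?addr0 // => mu /negPf ne.
  by rewrite coeffU ne mulr0.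
rewrite (coeff_outdom ladom) mulr0 big_seq big1 // => mu mudom.
by rewrite coeffU (_ : mu == la = false) ?mulr0 //; apply: contraNF ladom => /eqP <-.
Qed.

Lemma phi_diag e v : phi (diag e v) = \sum_(la <- dom v) (e la * coeff la v) *: P la.
Proof.
rewrite /diag raddf_sum /=; apply: eq_bigr => la _.
by rewrite /phi liftU.
Qed.

Definition eig1 la : K := elsym (spec (part la)) 1.

Lemma eig1_inj : injective eig1.
Proof. by move=> la mu; rewrite /eig1 !elsym1 => /spec_sum_inj; exact: part_inj. Qed.

Lemma macD_phi r v : macD q t r (phi v) = phi (diag (fun la => elsym (spec (part la)) r) v).
Proof.
rewrite phiE macD_sum // phi_diag; apply: eq_bigr => la _.
by rewrite macDZ // P_eigen scalerA mulrC.
Qed.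

(** Simplicity of the spectrum of D^1: applying D^1 minus one of its eigenvalues
    to a linear relation makes it shorter. *)
Lemma phi_inj0 v : phi v = 0 -> v = 0.
Proof.
have [n] := ubnP (size (dom v)); elim: n v => // n IHn v; rewrite ltnS => lev v0.
case e : (dom v) => [|la s]; first by apply/eqP; rewrite -dom_eq0 e.
have ladom : la \in dom v by rewrite e inE eqxx.
pose v' := diag (fun mu => eig1 mu - eig1 la) v.
have phiv' : phi v' = 0.
  rewrite phi_diag; under eq_bigr do rewrite mulrBl scalerBl.
  rewrite sumrB -phi_diag -macD_phi v0; under eq_bigr do rewrite -scalerA.
  rewrite -scaler_sumr -phiE v0 scaler0 subr0.
  by have := @macDZ K N q t q_neq0 1 0 0; rewrite !scale0r.
have dom' : {subset dom v' <= s}.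
  move=> mu; rewrite mem_dom coeff_diag mulf_eq0 negb_or => /andP[ne].
  rewrite -mem_dom e inE => /orP[/eqP emu|//].
  by rewrite emu subrr eqxx in ne.
have v'0 : v' = 0.
  apply: IHn => //; apply: leq_trans lev; rewrite e /= ltnS.
  exact: uniq_leq_size (uniq_dom _) dom'.
have only_la mu : coeff mu v != 0 -> mu = la.
  move=> cmu; have := coeff_diag (fun mu => eig1 mu - eig1 la) v mu.
  rewrite -/v' v'0 coeff0 => /esym/eqP; rewrite mulf_eq0 (negPf cmu) orbF subr_eq0.
  by move=> /eqP/eig1_inj.
have := v0; rewrite (@phi_sumE v [:: la]) // => [|mu]; last first.
  by rewrite mem_dom inE => /only_la ->.
rewrite big_seq1 scale_ratfunE => /eqP; rewrite mulf_eq0 (negPf (P_neq0 la)) orbF.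
by rewrite fmorph_eq0 => /eqP cla; move: ladom; rewrite mem_dom cla eqxx.
Qed.

Lemma phi_inj : injective phi.
Proof.
move=> u v e; apply/eqP; rewrite -subr_eq0; apply/eqP; apply: phi_inj0.
by rewrite raddfB /= e subrr.
Qed.

Lemma phi_diag_eq0 e v la : phi (diag e v) = 0 -> coeff la v != 0 -> e la = 0.
Proof.
move=> /phi_inj0 /(congr1 (coeff la)); rewrite coeff_diag coeff0 => /eqP.
by rewrite mulf_eq0 => /orP[/eqP //|->].
Qed.

(** * The span: symmetric Laurent polynomials *)

Lemma msym_eq0 (s : 'S_N) (p : {mpoly K[N]}) : msym s p = 0 -> p = 0.
Proof. by move=> e; apply: (inj_msym s); rewrite e msym0. Qed.

Lemma frac_msymD (s : 'S_N) : {morph frac_map (msym s) : f g / f + g : R}.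
Proof. exact: (frac_mapD (msymD s) (msymM s) (@msym_eq0 s)). Qed.

Lemma frac_msymM (s : 'S_N) : {morph frac_map (msym s) : f g / f * g : R}.
Proof. exact: (frac_mapM (msymM s) (@msym_eq0 s)). Qed.

Lemma frac_msym_poly (s : 'S_N) (p : {mpoly K[N]}) :
  frac_map (msym s) (ofpoly p) = ofpoly (msym s p).
Proof. exact: (frac_map_poly (msymM s) (msym1 K s) (@msym_eq0 s)). Qed.

Lemma eNE : eN = ofpoly (\prod_(i < N) 'X_i : {mpoly K[N]}).
Proof. by rewrite rmorph_prod. Qed.

Lemma eN_sym : (\prod_(i < N) 'X_i : {mpoly K[N]}) \is symmetric.
Proof. by rewrite -mesymnnE mesym_sym. Qed.

Lemma sym_laurentD f g : sym_laurent f -> sym_laurent g -> sym_laurent (f + g).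
Proof.
move=> [[k [p ep]] sf] [[k' [p' ep']] sg]; split; last first.
  by move=> s; rewrite frac_msymD sf sg.
exists (k + k')%N, (p * (\prod_(i < N) 'X_i) ^+ k' + p' * (\prod_(i < N) 'X_i) ^+ k).
rewrite rmorphD !rmorphM !rmorphXn /= -eNE -ep -ep' exprD; ring.
Qed.

Lemma sym_laurentM f g : sym_laurent f -> sym_laurent g -> sym_laurent (f * g).
Proof.
move=> [[k [p ep]] sf] [[k' [p' ep']] sg]; split; last first.
  by move=> s; rewrite frac_msymM sf sg.
exists (k + k')%N, (p * p').
by rewrite rmorphM /= -ep -ep' exprD; ring.
Qed.

Lemma sym_laurent_poly (p : {mpoly K[N]}) : p \is symmetric -> sym_laurent (ofpoly p).
Proof.
move=> /issymP sp; split; last by move=> s; rewrite frac_msym_poly sp.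
by exists 0%N, p; rewrite expr0 mulr1.
Qed.

Lemma sym_laurent_eN (l : int) : sym_laurent (eN ^ l).
Proof.
have e0 := eN_neq0; split.
  exists `|l|%N; have [m em] : exists m : nat, l + (`|l|%N)%:Z = m%:Z.
    by exists (absz (l + (absz l)%:Z)); lia.
  exists ((\prod_(i < N) 'X_i) ^+ m).
  by rewrite exprnP -expfzDr // em rmorphXn /= -eNE.
move=> s; have eNs : frac_map (msym s) eN = eN.
  by rewrite eNE frac_msym_poly (issymP _ eN_sym).
have m1 : frac_map (msym s) (1 : R) = 1.
  by rewrite -(rmorph1 (@ofpoly K N)) frac_msym_poly msym1.
have mn (n : nat) : frac_map (msym s) (eN ^+ n) = eN ^+ n.
  by elim: n => [|n IHn]; rewrite ?expr0 ?exprS ?frac_msymM ?IHn ?eNs.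
case: l => n; first exact: mn.
rewrite NegzE -exprnN; set u := eN ^+ n.+1.
have u0 : u != 0 by rewrite expf_neq0.
have : frac_map (msym s) (u * u^-1) = 1 by rewrite divff.
by rewrite frac_msymM mn => /(canRL (mulKf u0)); rewrite mulr1.
Qed.

Lemma sym_laurentZ a f : sym_laurent f -> sym_laurent (a *: f).
Proof.
rewrite scale_ratfunE; apply: sym_laurentM; apply: sym_laurent_poly.
by apply/issymP => s; rewrite -[a%:MP]mulr1 mul_mpolyC msymZ msym1.
Qed.

Lemma sym_laurent_P la : sym_laurent (P la).
Proof.
have [la0 [l0 _ ->]] := base_weight la.
have [|p [-> sp _ _ _]] := @P_poly la0; first by rewrite l0.
by apply: sym_laurentM; [exact: sym_laurent_eN|exact: sym_laurent_poly].
Qed.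

Lemma sym_laurent_phi v : sym_laurent (phi v).
Proof.
rewrite phiE; apply: (big_ind (@sym_laurent K N)) => [||la _].
- have := sym_laurent_poly (rpred0 _ : (0 : {mpoly K[N]}) \is symmetric).
  by rewrite rmorph0.
- exact: sym_laurentD.
- by apply: sym_laurentZ; apply: sym_laurent_P.
Qed.

Lemma partition_weight (m : 'X_{1..N}) : is_partition m ->
  exists2 la, 0 <= last_part la & mnm_of la = m.
Proof.
move=> pm; have [i j ij|la _ e] := @mkwt_mono N (fun i => (m i)%:Z).
  rewrite lez_nat !(mnm_nth 0%N).
  move: pm; rewrite /is_partition (sorted_pairwise (rev_trans leq_trans)).
  move=> /(pairwiseP 0%N) H.
  have [->//|neij] := eqVneq i j.
  by apply: H; rewrite ?inE ?size_tuple // ltn_neqAle ij andbT.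
have ltN : (N.-1 < N)%N by lia.
have eN1 : (Ordinal ltN).+1 = N by rewrite /=; lia.
exists la; first by rewrite (last_partE _ eN1) e.
by apply/mnmP => i; rewrite mnmE e.
Qed.

(** Subtracting a multiple of the P_la with the same leading monomial lowers the
    leading monomial, and the monomial order is well founded. *)
Lemma phi_onto_poly (p : {mpoly K[N]}) : p \is symmetric -> exists v, phi v = ofpoly p.
Proof.
move: {2}(mlead p) (erefl (mlead p)) => m; elim/(@ltmwf N): m p => m IHm p em sp.
have [->|p0] := eqVneq p 0; first by exists 0; rewrite raddf0 rmorph0.
have [la la0 ela] := partition_weight (mlead_partition sp).
have [pl [Pl spl c1 ml _]] := P_poly la0.
pose p' := p - mleadc p *: pl.
have sp' : p' \is symmetric by rewrite rpredB // rpredZ.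
have [p'0|p'0] := eqVneq p' 0.
  exists (mleadc p *: ket K la); rewrite linearZ /= phi_ket Pl -ofpolyZ.
  by congr ofpoly; apply/eqP; rewrite eq_sym -subr_eq0 -/p' p'0.
have lt : (mlead p' < m)%O.
  rewrite lt_neqAle; apply/andP; split.
    apply: contraNneq p'0 => e.
    rewrite -mleadc_eq0 e -em mcoeffB mcoeffZ -ela c1 mulr1.
    by rewrite ela subrr.
  apply: le_trans (mleadB_le _ _) _; rewrite leUx em lexx /=.
  by apply: le_trans (mleadZ_le _ _) _; rewrite ml ela em.
have [v ev] := IHm _ lt p' erefl sp'.
exists (v + mleadc p *: ket K la).
rewrite linearD linearZ /= ev phi_ket Pl -ofpolyZ -rmorphD /=.
by rewrite subrK.
Qed.

Lemma phi_eN (k : int) v : exists v', phi v' = eN ^ k * phi v.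
Proof.
rewrite phiE mulr_sumr; apply: (big_ind (fun f => exists v', phi v' = f)).
- by exists 0; rewrite raddf0.
- by move=> f g [u <-] [u' <-]; exists (u + u'); rewrite raddfD.
move=> la _; have [i j ij|la' _ e] := @mkwt_mono N (fun i => part la i + k).
  by rewrite lerD2r part_mono.
exists (coeff la v *: ket K la'); rewrite linearZ /= phi_ket (P_shift e).
by rewrite -scale_ratfunAr.
Qed.

Lemma phi_onto f : sym_laurent f <-> exists v, phi v = f.
Proof.
split=> [[[k [p ep]] sf]|[v <-]]; last exact: sym_laurent_phi.
have e0 := eN_neq0.
have sp : p \is symmetric.
  apply/issymP => s; apply: ofpoly_inj; rewrite -frac_msym_poly -ep frac_msymM sf.
  by congr (_ * _); have [_ ->] := sym_laurent_eN k%:Z.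
have [v ev] := phi_onto_poly sp.
have [v' ev'] := phi_eN (- k%:Z) v.
exists v'; rewrite ev' ev -ep mulrC -mulrA -exprnN divff ?mulr1 ?expf_neq0 //.
Qed.

(** * Spectral points *)

Hypothesis indep : forall a b : int, q ^ a * t ^ b = 1 -> a = 0 /\ b = 0.
Implicit Types (I J : {set 'I_N}).

Lemma monomial_inj a b a' b' : q ^ a * t ^ b = q ^ a' * t ^ b' -> a = a' /\ b = b'.
Proof.
move=> e; have [|ea eb] := indep (a := a - a') (b := b - b'); last by lia.
rewrite !expfzDr // -!invr_expz mulrACA e -invfM divff //.
by rewrite mulf_neq0 ?expfz_neq0.
Qed.

Lemma mul_exprz (c : K) (n : int) : c != 0 -> c * c ^ n = c ^ (1 + n).
Proof. by move=> c0; rewrite expfzDr // expr1z. Qed.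

Lemma specE w i : spec w i = q ^ w i * t ^ (N%:Z - i%:Z - 1).
Proof.
rewrite /spec exprnP; congr (_ * t ^ _).
by have := ltn_ord i; lia.
Qed.

Lemma spec_neq0 w i : spec w i != 0.
Proof. by rewrite mulf_neq0 ?expf_neq0 ?expfz_neq0. Qed.

Lemma spec_dist w w' i j : i != j -> spec w i != spec w' j.
Proof.
move=> ij; apply: contraNneq ij; rewrite !specE => /monomial_inj[_ e].
by apply/eqP/val_inj => /=; lia.
Qed.

Lemma spec_qdist w w' i j : i != j -> spec w i != q * spec w' j.
Proof.
move=> ij; apply: contraNneq ij; rewrite !specE mulrA mul_exprz // => /monomial_inj[_ e].
by apply/eqP/val_inj => /=; lia.
Qed.

Definition addw w J : 'I_N -> int := fun i => w i + (if i \in J then 1 else 0).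

Lemma spec_addw w J : spec (addw w J) =1 qshift q J (spec w).
Proof.
move=> i; rewrite /spec /qshift /addw; case: ifP => _; last by rewrite addr0.
by rewrite mulrA addrC mul_exprz.
Qed.

Lemma addw_eq w w' J : w =1 w' -> addw w J =1 addw w' J.
Proof. by move=> e i; rewrite /addw e. Qed.

(** If w is dominant and w + 1_J is not, some adjacent rows i, i + 1 have equal
    parts, i not in J and i + 1 in J; the factor t z_(i+1) - z_i of a_J is zero. *)
Lemma mac_coef_wall w J la : mkwt w = Some la -> mkwt (addw w J) = None ->
  mac_coef t (spec w) J = 0.
Proof.
move=> /mkwt_some e /mkwt_none[i [j [ij lt]]].
have le : w j <= w i by rewrite -!e part_mono // ij.
have [jJ iJ wij] : [/\ j \in J, i \notin J & w j = w i].
  move: lt; rewrite /addw; case: (boolP (i \in J)) => iJ; case: (boolP (j \in J)) => jJ lt;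
    by [exfalso; lia | split=> //; lia].
apply/eqP; rewrite /mac_coef (bigD1 j) //= (bigD1 i) ?inE //= mulf_eq0; apply/orP; left.
rewrite mulf_eq0; apply/orP; left; rewrite mulf_eq0 subr_eq0; apply/orP; left.
apply/eqP; rewrite !specE wij mulrCA mul_exprz //; congr (_ * _ ^ _).
by rewrite ij; lia.
Qed.

(** Conversely a factor t z_i - z_j can only vanish for equal parts in adjacent
    rows, in which case moving row i would leave the dominant cone. *)
Lemma mac_coef1_neq0 w i la : mkwt (addw w [set i]) = Some la ->
  mac_coef t (spec w) [set i] != 0.
Proof.
move=> /mkwt_some e; rewrite /mac_coef big_set1; apply/prodf_neq0 => j.
rewrite !inE => ji; have ij : i != j by rewrite eq_sym.
rewrite mulf_neq0 ?invr_eq0 ?subr_eq0 ?spec_dist //.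
apply: contraNneq ij; rewrite !specE mulrCA mul_exprz // => /monomial_inj[wij e'].
have lej : (j <= i)%N by lia.
have := part_mono la lej; rewrite !e /addw !inE eqxx (negPf ji); lia.
Qed.

(** * Support of the Pieri expansion *)

(** Extending the family by 0 lets sums run over all rows, dominant or not. *)
Definition P_wt w : R := if mkwt w is Some la then P la else 0.

Lemma P_wt_eq w w' : w =1 w' -> P_wt w = P_wt w'.
Proof. by move=> /mkwt_eq e; rewrite /P_wt e. Qed.

Lemma macD_P_wt r w : macD q t r (P_wt w) = elsym (spec w) r *: P_wt w.
Proof.
rewrite /P_wt; case e : (mkwt w) => [la|].
  rewrite P_eigen; congr (_ *: _); apply: elsym_eq; apply: spec_eq.
  exact: mkwt_some.
by rewrite scaler0; have := @macDZ K N q t q_neq0 r 0 0; rewrite !scale0r.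
Qed.

Lemma elsym1_addw w J :
  elsym (spec (addw w J)) 1 = elsym (spec w) 1 + (q - 1) * \sum_(i in J) spec w i.
Proof.
rewrite !elsym1 [X in _ = _ + _ * X]big_mkcond mulr_sumr -big_split /=.
apply: eq_bigr => i _; rewrite spec_addw /qshift; case: ifP => _; ring.
Qed.

Lemma spec_prod_addw w J :
  \prod_i spec (addw w J) i = q ^+ #|J| * \prod_i spec w i.
Proof.
rewrite -prodr_const [X in X * _]big_mkcond -big_split /=.
by apply: eq_bigr => i _; rewrite spec_addw /qshift; case: ifP; rewrite ?mul1r.
Qed.

(** The eigenvalue q^|la| of the total dilation, in the form in which D^N
    provides it. *)
Definition tot_eig la : K := (\prod_i spec (part la) i) / t ^+ (N * N.-1)./2.

Lemma Ttot_phi v : Tset q setT (phi v) = phi (diag tot_eig v).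
Proof.
rewrite phiE Tset_sum // phi_diag; apply: eq_bigr => la _.
by rewrite TsetZ // Ttot_P scalerA mulrC.
Qed.

Lemma diagB e c v : phi (diag e v) - c *: phi v = phi (diag (fun la => e la - c) v).
Proof.
rewrite !phi_diag phiE scaler_sumr -sumrB; apply: eq_bigr => la _.
by rewrite scalerA -scalerBl mulrBl.
Qed.

Lemma diag_comp e e' (v : WN K N) :
  diag e (diag e' v) = diag (fun la => e la * e' la) v.
Proof.
by apply/eqP/freeg_eqP => la; rewrite !coeff_diag mulrA.
Qed.

Lemma tot_eig_neq0 la : tot_eig la != 0.
Proof.
rewrite mulf_neq0 ?invr_eq0 ?expf_neq0 //.
by apply/prodf_neq0 => i _; apply: spec_neq0.
Qed.

Lemma q_exp_neq1 k : (0 < k)%N -> q ^+ k != 1.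
Proof.
move=> k0; apply/eqP => e; have [|k_eq0 _] := indep (a := k%:Z) (b := 0); last by lia.
by rewrite expr0z mulr1.
Qed.

Lemma e_sym1E : e_sym 1 = \sum_(i < N) xvar K i.
Proof. exact: elsym1. Qed.

Lemma e_sym_poly r : e_sym r = ofpoly (mesym N K r).
Proof.
rewrite /e_sym /elsym /mesym rmorph_sum; apply: eq_bigr => I _.
by rewrite rmorph_prod.
Qed.

Lemma sym_laurent_e_sym r : sym_laurent (e_sym r).
Proof. by rewrite e_sym_poly; apply: sym_laurent_poly; apply: mesym_sym. Qed.

Lemma Kop_comm h :
  Kop q t h = (q - 1)^-1 *: (macD q t 1 (e_sym 1 * h) - e_sym 1 * macD q t 1 h).
Proof.
have := macD_e1 q_neq0 t_neq0 q_neq1 t_neq1 q_neqt 0 h.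
rewrite -e_sym1E => ->; rewrite !macD_0 -[X in _ *: (_ - X)]scale1r -scalerBl scalerA.
by rewrite mulVf ?scale1r // subr_eq0.
Qed.

(** The operator relations between e_1 and the D^r become scalar relations
    between the eigenvalues at nu and mu, since the P_nu are independent. *)
Lemma pieri_support mu v nu : phi v = e_sym 1 * P mu -> coeff nu v != 0 ->
  exists i, part nu =1 addw (part mu) [set i].
Proof.
move=> ev cnu.
pose z := spec (part nu); pose zm := spec (part mu).
pose E r la := elsym (spec (part la)) r.
pose w la := (E 1%N la - E 1%N mu) / (q - 1).
have KP : Kop q t (P mu) = phi (diag w v).
  rewrite Kop_comm -ev macD_phi P_eigen -scale_ratfunAr -ev diagB.
  rewrite !phi_diag scaler_sumr; apply: eq_bigr => la _.
  by rewrite scalerA mulrCA mulrA.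
have rel r : E r.+1 nu - E r.+1 mu = w nu * (q * E r mu - E r nu).
  apply/eqP; rewrite -subr_eq0; apply/eqP.
  pose e la := E r.+1 la - E r.+1 mu - w la * (q * E r mu - E r la).
  apply: (@phi_diag_eq0 e v nu) => //.
  have := macD_e1 q_neq0 t_neq0 q_neq1 t_neq1 q_neqt r (P mu).
  rewrite -e_sym1E -ev macD_phi P_eigen -scale_ratfunAr -ev diagB.
  rewrite P_eigen KopZ // KP macD_phi diag_comp.
  move=> /eqP; rewrite -subr_eq0 => /eqP <-.
  rewrite !phi_diag !scaler_sumr -!sumrB; apply: eq_bigr => la _.
  rewrite !scalerA -!scalerBl; congr (_ *: _).
  by rewrite /e /E; ring.
have tl : tot_eig nu = q * tot_eig mu.
  apply/eqP; rewrite -subr_eq0; apply/eqP.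
  apply: (@phi_diag_eq0 (fun la => tot_eig la - q * tot_eig mu) v nu) => //.
  rewrite -diagB -Ttot_phi ev Ttot_e_sym // Ttot_P -scale_ratfunAr scalerA.
  by rewrite expr1 subrr.
have ne : nu != mu.
  apply: contra_eqN tl => /eqP ->.
  rewrite -{1}[tot_eig mu]mul1r (inj_eq (mulIf (tot_eig_neq0 mu))).
  by rewrite eq_sym.
have w0 : w nu != 0.
  rewrite mulf_neq0 ?invr_eq0 ?subr_eq0 //; apply: contraNneq ne => /eig1_inj ->.
  exact: eqxx.
(* The relations for all r, assembled into the generating functions of the e_r. *)
have gen y : (1 + y * w nu) * \prod_i (1 + y * z i) =
    (1 + q * y * w nu) * \prod_i (1 + y * zm i).
  rewrite !elsym_gen card_ord.
  have H (x : 'I_N -> K) : \sum_(r < N.+1) y ^+ r * elsym x r =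
      1 + y * \sum_(r < N.+1) y ^+ r * elsym x r.+1.
    rewrite big_ord_recl expr0 mul1r elsym0 big_ord_recr /=.
    rewrite (@elsym_gt _ _ _ N.+1) ?card_ord // mulr0 addr0 mulr_sumr.
    by congr (_ + _); apply: eq_bigr => r _; rewrite exprS mulrA.
  have : \sum_(r < N.+1) y ^+ r * elsym z r.+1 - \sum_(r < N.+1) y ^+ r * elsym zm r.+1 =
     w nu * (q * \sum_(r < N.+1) y ^+ r * elsym zm r - \sum_(r < N.+1) y ^+ r * elsym z r).
    rewrite -sumrB mulr_sumr -sumrB mulr_sumr; apply: eq_bigr => r _.
    rewrite -mulrBr; have -> : elsym z r.+1 - elsym zm r.+1 = _ := rel r.
    by rewrite -/(E r nu) -/(E r mu); ring.
  have := H z; have := H zm.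
  move: (\sum_(r < N.+1) y ^+ r * elsym z r) => a.
  move: (\sum_(r < N.+1) y ^+ r * elsym zm r) => b.
  move: (\sum_(r < N.+1) y ^+ r * elsym z r.+1) => a'.
  move: (\sum_(r < N.+1) y ^+ r * elsym zm r.+1) => b' Hb Ha Hab.
  have {}Hab : a' = b' + w nu * (q * b - a) by rewrite -Hab; ring.
  move: Ha; rewrite Hab => Ha; rewrite mulrDl {1}Ha Hb; ring.
(* The left-hand side vanishes at y = -1 / w, so -1 / w is a root on the right. *)
have := gen (- (w nu)^-1); rewrite mulNr mulVf // subrr mul0r => /esym/eqP.
rewrite mulf_eq0 => /orP[|].
  rewrite mulrN mulNr -mulrA mulVf // mulr1 subr_eq0 eq_sym => /eqP e.
  by move: q_neq1; rewrite e eqxx.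
move=> /prodf_eq0[i _]; rewrite mulNr subr_eq0 eq_sym => /eqP e; exists i.
have wz : w nu = zm i by rewrite -[LHS]mulr1 -e mulVKf.
apply: spec_sum_inj; rewrite -!elsym1 elsym1_addw big_set1 -/zm -wz /w.
by rewrite mulrC divfK ?subr_eq0 // addrC subrK.
Qed.

(** * Values at t^rho *)

Local Notation z0 := (spec (fun=> 0)).

Lemma evals_P z la : (forall i, z i != 0) -> exists a, evals z (P la) a.
Proof.
move=> z0; have [la0 [l0 _ ->]] := base_weight la.
have [|p [-> _ _ _ _]] := @P_poly la0; first by rewrite l0.
eexists; apply: evalsM; last exact: evals_poly.
apply: evals_exp; last by apply: evals_prod => i _; apply: evals_xvar.
by apply/prodf_neq0 => i _; apply: z0.
Qed.

(** P_la(t^rho); t^rho is the point z_0 of the weight 0. *)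
Definition rho_val la : K := classical_sets.xget 0 (evals z0 (P la)).

Lemma rho_valP la : evals z0 (P la) (rho_val la).
Proof. by apply: classical_sets.xgetPex; apply: evals_P => i; apply: spec_neq0. Qed.

Definition rho_val_wt w : K := if mkwt w is Some la then rho_val la else 0.

Lemma rho_val_wtP w : evals z0 (P_wt w) (rho_val_wt w).
Proof. by rewrite /P_wt /rho_val_wt; case: mkwt => [la|]; [exact: rho_valP|exact: evals0]. Qed.

Lemma evals_Tset z J f a : evals (qshift q J z) f a -> evals z (Tset q J f) a.
Proof.
move=> fa; apply: (evals_dilation (dilation_Tset J q_neq0)).
apply: evals_ext fa => i; rewrite /qshift /one_at.
by case: ifP; rewrite ?mul1r.
Qed.

Lemma evals_mac_coef w J :
  evals (spec w) (mac_coef (ofcst N t) (@xvar K N) J) (mac_coef t (spec w) J).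
Proof.
apply: evals_prod => i iJ; apply: evals_prod => j; rewrite inE => jJ.
have ij : i != j by apply: contraNneq jJ => <-.
have evB a b (f g : R) : evals (spec w) f a -> evals (spec w) g b ->
    evals (spec w) (f - g) (a - b).
  move=> fa gb; apply: evalsD => //; rewrite -scaleN1r -[- b]mulN1r.
  exact: evalsZ.
apply: evalsM; last apply: evalsV.
- by apply: evB; [apply: evalsM; [exact: evals_cst|]|]; apply: evals_xvar.
- by rewrite subr_eq0 spec_dist.
- by apply: evB; apply: evals_xvar.
Qed.

(** The index set {1, .., r}, also used for the fundamental weight omega_r. *)
Definition seg r : {set 'I_N} := [set i : 'I_N | (i < r)%N].

Lemma card_seg r : (r <= N)%N -> #|seg r| = r.
Proof.
move=> rN; rewrite -sum1_card -[RHS](card_ord r) -[RHS]sum1_card.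
rewrite (big_ord_widen N (fun=> 1%N) rN).
by apply: eq_bigl => i; rewrite inE.
Qed.

Lemma mkwt0 : exists2 la : domwt N, mkwt (fun=> 0) = Some la & part la =1 (fun=> 0).
Proof. exact: mkwt_mono. Qed.

(** From the weight 0 the only dominant move by 1_J with |J| = r is omega_r. *)
Lemma mac_coef_seg r J : #|J| = r -> J != seg r -> mac_coef t z0 J = 0.
Proof.
move=> cJ Jr; have [la0 e0 _] := mkwt0; apply: (mac_coef_wall e0).
case e : (mkwt _) => [la|] //; have e' := mkwt_some e.
have rN : (r <= N)%N by rewrite -cJ -[X in (_ <= X)%N]card_ord max_card.
case/negP: Jr; rewrite eqEcard card_seg // cJ leqnn andbT.
apply/subsetP => j jJ; rewrite inE -cJ.
have sub : seg j.+1 \subset J.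
  apply/subsetP => i; rewrite inE ltnS => ij.
  by have := part_mono la ij; rewrite !e' /addw jJ; case: (boolP (i \in J)).
by rewrite -(card_seg (ltn_ord j)) subset_leq_card.
Qed.

Lemma evals_macD r h (b : {set 'I_N} -> K) : (r <= N)%N ->
  (forall J, evals (qshift q J z0) h (b J)) ->
  evals z0 (macD q t r h)
    (t ^+ (r * r.-1)./2 * (mac_coef t z0 (seg r) * b (seg r))).
Proof.
move=> rN hb; have -> : t ^+ (r * r.-1)./2 * (mac_coef t z0 (seg r) * b (seg r)) =
   \sum_(J : {set 'I_N} | #|J| == r) t ^+ (r * r.-1)./2 * (mac_coef t z0 J * b J).
  rewrite (bigD1 (seg r)) ?card_seg //= [X in _ + X]big1 ?addr0 // => J /andP[/eqP cJ Jr].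
  by rewrite (mac_coef_seg cJ Jr) mul0r mulr0.
rewrite macDE; apply: evals_sum => J _; apply: evalsZ; apply: evalsM.
  exact: evals_mac_coef.
exact: evals_Tset.
Qed.

Lemma sum_seg r : (r <= N)%N ->
  \sum_(i in seg r) z0 i = (t ^+ N - t ^+ N * t^-1 ^+ r) / (t - 1).
Proof.
move=> rN; have t1 : t - 1 != 0 by rewrite subr_eq0.
transitivity (\sum_(i < r) t ^+ (N - i.+1)).
  rewrite (big_ord_widen N (fun i => t ^+ (N - i.+1)) rN).
  by apply: eq_big => i; rewrite ?inE // /spec expr0z mul1r.
elim: r rN => [|r IHr] rN; first by rewrite big_ord0 expr0 mulr1 subrr mul0r.
rewrite big_ord_recr /= IHr 1?ltnW //.
have -> : t ^+ N = t ^+ (N - r.+1) * t ^+ r.+1 by rewrite -exprD subnK.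
by rewrite !exprVn !exprS; field; rewrite t1 t_neq0 expf_neq0.
Qed.

(** * The Pieri rule for e_1 up to the values at t^rho *)

Lemma coeff_oket (o : option (domwt N)) la : coeff la (oket K o) = (o == Some la)%:R.
Proof.
case: o => [nu|]; last by rewrite coeff0.
by rewrite /oket /ket coeffU mul1r.
Qed.

Lemma addw1_inj w i j : addw w [set i] =1 addw w [set j] -> i = j.
Proof.
move=> /(_ i); rewrite /addw !inE eqxx; case: eqVneq => // _; lia.
Qed.

Lemma phi_oket (o : option (domwt N)) : phi (oket K o) = if o is Some la then P la else 0.
Proof. by case: o => [la|] /=; [exact: phi_ket|rewrite raddf0]. Qed.

Lemma pieri1_expansion mu : exists c : 'I_N -> K,
  e_sym 1 * P mu = \sum_i c i *: P_wt (addw (part mu) [set i]).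
Proof.
have [v ev] : exists v, phi v = e_sym 1 * P mu.
  by apply/phi_onto; apply: sym_laurentM; [exact: sym_laurent_e_sym|exact: sym_laurent_P].
pose o i : option (domwt N) := mkwt (addw (part mu) [set i]).
pose c i := if o i is Some la then coeff la v else 0.
exists c; rewrite -ev; have -> : v = \sum_i c i *: oket K (o i).
  apply/eqP/freeg_eqP => nu; rewrite raddf_sum /=.
  under eq_bigr do rewrite coeffZ coeff_oket.
  have [i0 /eqP oi0|no] := pickP (fun i => o i == Some nu).
    rewrite (bigD1 i0) //= oi0 eqxx mulr1 big1 ?addr0 => [|i ii0].
      by rewrite /c oi0.
    rewrite (_ : (o i == _) = false) ?mulr0 //; apply: contraNF ii0 => /eqP oi.
    apply/eqP; apply: (@addw1_inj (part mu)) => j.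
    by rewrite -(mkwt_some oi) (mkwt_some oi0).
  rewrite big1 => [|i _]; last by rewrite no mulr0.
  apply/eqP; apply: contraT => cnu; have [i e] := pieri_support ev cnu.
  by have := no i; rewrite /o -(mkwt_eq e) mkwt_part eqxx.
by rewrite raddf_sum /=; apply: eq_bigr => i _; rewrite linearZ /= phi_oket.
Qed.

(** D^r (e_1 P_mu) at t^rho equals, through its only surviving term, the value of
    e_1 at q^(omega_r) t^rho times that of D^r P_mu at t^rho; on the other hand
    it is computed from the expansion of e_1 P_mu. *)
Lemma pieri1_values mu c :
  e_sym 1 * P mu = \sum_i c i *: P_wt (addw (part mu) [set i]) ->
  forall i, c i * rho_val_wt (addw (part mu) [set i]) =
            mac_coef t (spec (part mu)) [set i] * rho_val mu.
Proof.
move=> eP; pose z := spec (part mu); pose zi i := spec (addw (part mu) [set i]).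
pose v i := c i * rho_val_wt (addw (part mu) [set i]).
pose b J := classical_sets.xget 0 (evals (qshift q J z0) (P mu)).
have bP J : evals (qshift q J z0) (P mu) (b J).
  apply: classical_sets.xgetPex; apply: evals_P => i.
  by rewrite /qshift; case: ifP => _; [apply: mulf_neq0 => //|]; apply: spec_neq0.
(* b J is the value of P_mu at t^rho with the variables in J multiplied by q. *)
have key r : (r <= N)%N -> \sum_i v i * elsym (zi i) r =
    (\sum_i qshift q (seg r) z0 i) * (elsym z r * rho_val mu).
  move=> rN.
  have e1 : t ^+ (r * r.-1)./2 * (mac_coef t z0 (seg r) * b (seg r)) = elsym z r * rho_val mu.
    apply: (evals_uniq (evals_macD rN bP)); rewrite P_eigen.
    by apply: evalsZ; apply: rho_valP.
  rewrite -e1; pose b' J := (\sum_i qshift q J z0 i) * b J.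
  have b'P J : evals (qshift q J z0) (e_sym 1 * P mu) (b' J).
    by apply: evalsM => //; rewrite e_sym1E; apply: evals_sum => i _; apply: evals_xvar.
  transitivity (t ^+ (r * r.-1)./2 * (mac_coef t z0 (seg r) * b' (seg r))); last first.
    by rewrite /b'; ring.
  apply/esym; apply: (evals_uniq (evals_macD rN b'P)).
  rewrite eP macD_sum //; apply: evals_sum => i _; rewrite macDZ // macD_P_wt.
  by rewrite /v mulrAC -mulrA; do 2!apply: evalsZ; apply: rho_val_wtP.
pose S := \sum_i z0 i; pose C := (q - 1) * t ^+ N / (t - 1).
have t1 : t - 1 != 0 by rewrite subr_eq0.
have sumq r : (r <= N)%N -> \sum_i qshift q (seg r) z0 i = S + C - C * t^-1 ^+ r.
  move=> rN; have := elsym1_addw (fun=> 0) (seg r); rewrite !elsym1 sum_seg //.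
  under eq_bigr do rewrite spec_addw.
  by move=> ->; rewrite -/S /C; field.
(* e_1 at q^(omega_r) t^rho is affine in t^(-r), so the generating function of the
   right-hand sides involves prod_j (1 + y z_j) at y and at y / t. *)
have gen y : \sum_i v i * \prod_j (1 + y * zi i j) =
    rho_val mu * ((S + C) * \prod_j (1 + y * z j) - C * \prod_j (1 + (y / t) * z j)).
  transitivity (\sum_(r < N.+1) y ^+ r * \sum_i v i * elsym (zi i) r).
    under eq_bigr do rewrite elsym_gen card_ord mulr_sumr.
    rewrite exchange_big /=; apply: eq_bigr => r _; rewrite mulr_sumr.
    by apply: eq_bigr => i _; rewrite mulrCA.
  rewrite !elsym_gen card_ord !mulr_sumr -sumrB mulr_sumr; apply: eq_bigr => r _.
  have rN : (r <= N)%N by rewrite -ltnS.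
  by rewrite key // sumq // exprMn; ring.
move=> i; have zi0 : z i != 0 by exact: spec_neq0.
(* At y = -1 / z_i all terms with a factor 1 + y z_i disappear, which leaves the
   i-th unknown on the left and the product at y / t on the right. *)
have := gen (- (z i)^-1).
rewrite [X in X = _](bigD1 i) //= [X in _ + X = _]big1 ?addr0; last first.
  move=> k ki; rewrite (bigD1 i) //= /zi spec_addw /qshift inE eq_sym (negPf ki) -/z.
  by rewrite mulNr mulVf // subrr mul0r mulr0.
rewrite [X in _ * X = _](bigD1 i) //= [X in (S + C) * X](bigD1 i) //=.
rewrite [X in C * X](bigD1 i) //=.
have -> : 1 + - (z i)^-1 * z i = 0 by rewrite mulNr mulVf // subrr.
rewrite mul0r mulr0 add0r {1}/zi spec_addw {1}/qshift inE eqxx -/z.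
pose Q1 := \prod_(j | j != i) (1 - z j / z i).
pose Q2 := \prod_(j | j != i) (1 - z j / (t * z i)).
have -> : \prod_(j | j != i) (1 + - (z i)^-1 * zi i j) = Q1.
  apply: eq_bigr => j ji; rewrite /zi spec_addw /qshift inE (negPf ji) -/z.
  by rewrite mulNr mulrC.
have -> : \prod_(j | j != i) (1 + - (z i)^-1 / t * z j) = Q2.
  by apply: eq_bigr => j ji; field; rewrite zi0 t_neq0.
have Q10 : Q1 != 0.
  apply/prodf_neq0 => j ji.
  by rewrite subr_eq0 eq_sym -(divff zi0) (inj_eq (mulIf (invr_neq0 zi0))) spec_dist.
have AE : mac_coef t z [set i] = t ^+ N.-1 * Q2 / Q1.
  rewrite /mac_coef big_set1 /Q1 /Q2 -mulrA -prodf_div.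
  rewrite (_ : t ^+ N.-1 = \prod_(j < N | j != i) t); last first.
    rewrite prodr_const; congr (_ ^+ _).
    by rewrite (_ : #|_| = #|predC1 i|) // cardC1 card_ord.
  rewrite -big_split /=; apply: eq_big => j; first by rewrite !inE.
  rewrite !inE => ji; have ij : i != j by rewrite eq_sym.
  have h1 : z i - z j != 0 by rewrite subr_eq0 spec_dist.
  by field; rewrite zi0 t_neq0 h1.
move=> e; rewrite -/(v i) -/z AE.
have q1 : 1 - q != 0 by rewrite subr_eq0 eq_sym.
apply: (mulfI (mulf_neq0 q1 Q10)).
transitivity (v i * ((1 + - (z i)^-1 * (q * z i)) * Q1)).
  by field.
rewrite e /C.
have -> : t ^+ N = t * t ^+ N.-1 by rewrite -exprS prednK.
by field; rewrite zi0 t1 t_neq0 Q10.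
Qed.

(** * Nonvanishing of the values at t^rho *)

Lemma mkwt_shift la k : exists2 la', mkwt (fun i => part la i + k) = Some la' &
  part la' =1 (fun i => part la i + k).
Proof. by apply: mkwt_mono => i j ij; rewrite lerD2r part_mono. Qed.

Lemma rho_val_shift k la la' : (forall i, part la' i = part la i + k) ->
  rho_val la' = (\prod_i z0 i) ^ k * rho_val la.
Proof.
move=> e; apply: (evals_uniq (rho_valP la')); rewrite (P_shift e).
apply: evalsM; last exact: rho_valP.
apply: evals_exp; last by apply: evals_prod => i _; apply: evals_xvar.
by apply/prodf_neq0 => i _; apply: spec_neq0.
Qed.

Lemma rho_val_zero la : part la =1 (fun=> 0) -> rho_val la = 1.
Proof.
move=> e; have ltN : (N.-1 < N)%N by lia.
have eN1 : (Ordinal ltN).+1 = N by rewrite /=; lia.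
have [|p [Pp _ c1 ml _]] := @P_poly la; first by rewrite (last_partE _ eN1) e.
have m0 : mnm_of la = 0%MM by apply/mnmP => i; rewrite !mnmE e.
have p0 : p != 0.
  by apply/eqP => p0; move: c1; rewrite p0 mcoeff0 => /eqP; rewrite eq_sym oner_eq0.
have := mlead_deg p0; rewrite ml m0 mdeg0 => sp.
have pE : p = 1 by rewrite [p]msize1_polyC -?sp // -m0 c1.
by apply: (evals_uniq (rho_valP la)); rewrite Pp pE rmorph1; apply: evals1.
Qed.

(** A nonzero partition becomes smaller by removing the last box of its last
    nonzero row. *)
Lemma part_sum_ind (Q : domwt N -> Prop) :
  (forall la, part la =1 (fun=> 0) -> Q la) ->
  (forall mu i la, mkwt (addw (part mu) [set i]) = Some la -> Q mu -> Q la) ->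
  forall la, 0 <= last_part la -> Q la.
Proof.
move=> Q0 Q1 la la0; have [n] := ubnP (\sum_i `|part la i|%N).
elim: n la la0 => // n IHn la la0; rewrite ltnS => le_n.
have pos i : 0 <= part la i by exact: le_trans la0 (last_part_le la i).
have [i0 i0P|all0] := pickP (fun i => part la i != 0); last first.
  by apply: Q0 => i; apply/eqP; rewrite -[_ == _]negbK all0.
have [i ine0 maxi] := @arg_maxnP 'I_N i0 (fun i => part la i != 0) val i0P.
pose w j := part la j + (if j == i then -1 else 0).
have [j k jk|mu emu pmu] := @mkwt_mono N w.
  rewrite /w; have := part_mono la jk; have := pos k; have := pos j.
  case: (eqVneq j i) => ji; case: (eqVneq k i) => ki; try lia.
  have [k0|kne] := eqVneq (part la k) 0.
    by move: ine0; rewrite ji; have := pos i; lia.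
  by have /= := maxi k kne; move: jk ki; rewrite ji -val_eqE /= => *; lia.
apply: (Q1 mu i la).
  rewrite -(mkwt_part la); apply: mkwt_eq => j; rewrite /addw pmu /w !inE.
  by case: eqP => _; lia.
have ltN : (N.-1 < N)%N by lia.
have eN1 : (Ordinal ltN).+1 = N by rewrite /=; lia.
apply: IHn.
  rewrite (last_partE _ eN1) pmu /w; have := pos (Ordinal ltN).
  by case: eqVneq => [->|] //; have := pos i; move: ine0; lia.
apply: leq_trans le_n; rewrite (bigD1 i) //= [X in (_ < X)%N](bigD1 i) //=.
rewrite (eq_bigr (fun j => `|part la j|%N)) => [|j /negPf ji]; last first.
  by rewrite pmu /w ji addr0.
rewrite ltn_add2r pmu /w eqxx; have := pos i; move: ine0; lia.
Qed.

Lemma rho_val_step mu i la : mkwt (addw (part mu) [set i]) = Some la ->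
  rho_val mu != 0 -> rho_val la != 0.
Proof.
move=> e g0; have [c eP] := pieri1_expansion mu.
have := pieri1_values eP i; rewrite /rho_val_wt e => H.
have : mac_coef t (spec (part mu)) [set i] * rho_val mu != 0.
  by rewrite mulf_neq0 // (mac_coef1_neq0 e).
by rewrite -H mulf_eq0 negb_or => /andP[].
Qed.

Lemma rho_val_neq0 la : rho_val la != 0.
Proof.
have [la0 [l0 e0 _]] := base_weight la.
rewrite (@rho_val_shift (last_part la) la0) => [|i]; last by rewrite e0 subrK.
rewrite mulf_neq0 ?expfz_neq0 //; first by apply/prodf_neq0 => i _; apply: spec_neq0.
apply: (@part_sum_ind (fun la => rho_val la != 0)); rewrite ?l0 //.
  by move=> la1 /rho_val_zero ->; apply: oner_neq0.
exact: rho_val_step.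
Qed.

(** * The Pieri rule for all e_r, in the normalization P_la(t^rho) = 1 *)

Definition P_norm w : R := if mkwt w is Some la then (rho_val la)^-1 *: P la else 0.

Lemma P_norm_eq w w' : w =1 w' -> P_norm w = P_norm w'.
Proof. by move=> /mkwt_eq e; rewrite /P_norm e. Qed.

Lemma P_norm_wt w : P_norm w = (rho_val_wt w)^-1 *: P_wt w.
Proof. by rewrite /P_norm /rho_val_wt /P_wt; case: mkwt => //; rewrite invr0 scale0r. Qed.

Lemma macD_P_norm r w : macD q t r (P_norm w) = elsym (spec w) r *: P_norm w.
Proof. by rewrite P_norm_wt macDZ // macD_P_wt !scalerA mulrC. Qed.

Lemma P_norm_wall w J la : mkwt w = Some la ->
  mac_coef t (spec w) J != 0 -> exists nu, mkwt (addw w J) = Some nu.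
Proof.
move=> e; case e' : (mkwt (addw w J)) => [nu|]; first by exists nu.
by rewrite (mac_coef_wall e e') eqxx.
Qed.

Lemma pieri1_P_norm w la : mkwt w = Some la ->
  e_sym 1 * P_norm w = \sum_i mac_coef t (spec w) [set i] *: P_norm (addw w [set i]).
Proof.
move=> e; have ew := mkwt_some e; rewrite /P_norm e -/(P_norm _) -scale_ratfunAr.
have [c eP] := pieri1_expansion la; have cg := pieri1_values eP.
rewrite eP scaler_sumr; apply: eq_bigr => i _.
rewrite -/(P_norm _) -(P_norm_eq (addw_eq [set i] ew)) -(mac_coef_eq t [set i] (spec_eq ew)).
rewrite P_norm_wt !scalerA.
case e' : (mkwt (addw (part la) [set i])) => [nu|]; last first.
  by rewrite /P_wt e' !scaler0.
have gg0 : rho_val_wt (addw (part la) [set i]) != 0 by rewrite /rho_val_wt e' rho_val_neq0.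
congr (_ *: _); apply: (mulIf gg0); rewrite divfK // -mulrA cg.
by field; rewrite rho_val_neq0.
Qed.

Lemma Kop_P_norm w la : mkwt w = Some la ->
  Kop q t (P_norm w) =
  \sum_i (spec w i * mac_coef t (spec w) [set i]) *: P_norm (addw w [set i]).
Proof.
move=> e; rewrite Kop_comm macD_P_norm -scale_ratfunAr (pieri1_P_norm e) macD_sum //.
rewrite !scaler_sumr -sumrB scaler_sumr; apply: eq_bigr => i _.
rewrite macDZ // macD_P_norm elsym1_addw big_set1 !scalerA -scalerBl scalerA.
by congr (_ *: _); field; rewrite subr_eq0.
Qed.

Lemma sym_laurent_P_norm w : sym_laurent (P_norm w).
Proof.
rewrite /P_norm; case: mkwt => [la|]; first exact/sym_laurentZ/sym_laurent_P.
by have := sym_laurent_phi 0; rewrite raddf0.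
Qed.

Lemma Ttot_P_norm w : Tset q setT (P_norm w) =
  ((\prod_i spec w i) / t ^+ (N * N.-1)./2) *: P_norm w.
Proof.
rewrite /P_norm; case e : (mkwt w) => [la|]; last first.
  by have := @TsetZ K N q q_neq0 setT 0 0; rewrite !scale0r scaler0.
rewrite TsetZ // Ttot_P !scalerA mulrC; congr (_ / _ * _ *: _).
by apply: eq_bigr => i _; rewrite (spec_eq (mkwt_some e)).
Qed.

Lemma sym_laurent_sum (S0 : Type) (s : seq S0) (Q : pred S0) (G : S0 -> R) :
  (forall i, sym_laurent (G i)) -> sym_laurent (\sum_(i <- s | Q i) G i).
Proof.
move=> HG; apply: (big_ind (@sym_laurent K N)) => //.
  by have := sym_laurent_phi 0; rewrite raddf0.
exact: sym_laurentD.
Qed.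

(** The spectrum of D^1 is simple, so such an f would be a multiple of P_mu,
    which has a different degree. *)
Lemma eigen_unique mu f k : sym_laurent f -> (0 < k)%N ->
  macD q t 1 f = elsym (spec (part mu)) 1 *: f ->
  Tset q setT f = (q ^+ k * tot_eig mu) *: f -> f = 0.
Proof.
move=> /phi_onto[v <-] k0; rewrite macD_phi Ttot_phi => e1 e2.
suff -> : v = 0 by rewrite raddf0.
apply/eqP/freeg_eqP => nu; rewrite coeff0; apply/eqP; apply: contraT => cnu.
have := @phi_diag_eq0 (fun la => elsym (spec (part la)) 1 - elsym (spec (part mu)) 1) v nu.
rewrite -diagB e1 subrr => /(_ erefl cnu)/eqP; rewrite subr_eq0 => /eqP/eig1_inj numu.
have := @phi_diag_eq0 (fun la => tot_eig la - q ^+ k * tot_eig mu) v nu.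
rewrite -diagB e2 subrr => /(_ erefl cnu)/eqP.
rewrite numu subr_eq0 -{1}[tot_eig mu]mul1r (inj_eq (mulIf (tot_eig_neq0 mu))) eq_sym.
by rewrite (negPf (q_exp_neq1 k0)).
Qed.

Definition pieri_coef r w I : K := t ^+ (r * r.-1)./2 * mac_coef t (spec w) I.

(** By induction on r, the two sides X and Y of the rule for e_(r+1) satisfy the
    same inhomogeneous equation for D^1 - e_1(z_w): for X it is the commutation of
    D^1 with e_(r+1), for Y the identity mac_coef_comm at z_w. So X - Y is an
    eigenvector of D^1 of the wrong degree, hence zero. *)
Lemma pieri_P_norm r w la : mkwt w = Some la ->
  e_sym r * P_norm w =
  \sum_(I : {set 'I_N} | #|I| == r) pieri_coef r w I *: P_norm (addw w I).
Proof.
elim: r w la => [|r IHr] w la e.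
  rewrite (big_pred1 set0) => [|I]; last by rewrite cards_eq0.
  rewrite /e_sym elsym0 mul1r /pieri_coef /mac_coef big_set0 mulr1 expr0 scale1r.
  by apply: P_norm_eq => i; rewrite /addw inE addr0.
pose Y : R := \sum_(I : {set 'I_N} | #|I| == r.+1) pieri_coef r.+1 w I *: P_norm (addw w I).
rewrite -/Y; apply/eqP; rewrite -subr_eq0; apply/eqP.
have ew := mkwt_some e.
have step1 : e_sym r * Kop q t (P_norm w) = \sum_i \sum_(J : {set 'I_N} | #|J| == r)
    (spec w i * mac_coef t (spec w) [set i] * (t ^+ (r * r.-1)./2 *
       mac_coef t (qshift q [set i] (spec w)) J)) *: P_norm (addw (addw w J) [set i]).
  rewrite (Kop_P_norm e) mulr_sumr; apply: eq_bigr => i _.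
  rewrite -scale_ratfunAr.
  (* The induction hypothesis needs a dominant weight; at a wall the coefficient
     vanishes. *)
  have [A0|A0] := eqVneq (mac_coef t (spec w) [set i]) 0.
    by rewrite A0 mulr0 scale0r big1 // => J _; rewrite mul0r scale0r.
  have [nu enu] := P_norm_wall e A0.
  rewrite (IHr _ _ enu) scaler_sumr; apply: eq_bigr => J _; rewrite scalerA.
  rewrite /pieri_coef (mac_coef_eq t J (spec_addw w [set i])); congr (_ *: _).
  by apply: P_norm_eq => j; rewrite /addw addrAC.
have step2 : Kop q t (e_sym r * P_norm w) = \sum_i \sum_(J : {set 'I_N} | #|J| == r)
    (t ^+ (r * r.-1)./2 * (mac_coef t (spec w) J * (qshift q J (spec w) i *
       mac_coef t (qshift q J (spec w)) [set i]))) *: P_norm (addw (addw w J) [set i]).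
  rewrite (IHr _ _ e) Kop_sum // [RHS]exchange_big /=; apply: eq_bigr => J _; rewrite KopZ //.
  have [A0|A0] := eqVneq (mac_coef t (spec w) J) 0.
    by rewrite /pieri_coef A0 mulr0 scale0r big1 // => i _; rewrite mul0r mulr0 scale0r.
  have [nu enu] := P_norm_wall e A0.
  rewrite (Kop_P_norm enu) scaler_sumr; apply: eq_bigr => i _; rewrite scalerA.
  rewrite /pieri_coef (mac_coef_eq t [set i] (spec_addw w J)) spec_addw.
  by congr (_ *: _); rewrite mulrA.
have DY : macD q t 1 Y - elsym (spec w) 1 *: Y =
    q *: (e_sym r * Kop q t (P_norm w)) - Kop q t (e_sym r * P_norm w).
  have PhiPsi i (J : {set 'I_N}) : i \notin J ->
      P_norm (addw (addw w J) [set i]) = P_norm (addw w (i |: J)).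
    move=> iJ; apply: P_norm_eq => j; rewrite /addw !inE.
    by case: (eqVneq j i) => [->|_]; rewrite ?(negPf iJ) /= ?addr0.
  have key := @mac_coef_comm K 'I_N q t q_neq0 t_neq0 q_neq1 t_neq1 q_neqt R (spec w) r
    (fun i J => P_norm (addw (addw w J) [set i])) (fun I => P_norm (addw w I)) (spec_neq0 w)
    (@spec_dist w w) (@spec_qdist w w) PhiPsi.
  rewrite step1 step2 [q *: _]scaler_sumr -[RHS]sumrB.
  transitivity (t ^+ (r * r.-1)./2 *: \sum_(I : {set 'I_N} | #|I| == r.+1)
    ((q - 1) * t ^+ r * (\sum_(i in I) spec w i) * mac_coef t (spec w) I) *:
      P_norm (addw w I)).
    rewrite /Y macD_sum // !scaler_sumr -sumrB; apply: eq_bigr => I _.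
    rewrite macDZ // macD_P_norm elsym1_addw !scalerA -scalerBl; congr (_ *: _).
    by rewrite /pieri_coef half_mulS exprD; ring.
  rewrite -key scaler_sumr; apply: eq_bigr => i _.
  rewrite !scaler_sumr -sumrB; apply: eq_bigr => J _.
  by rewrite !scalerA -scalerBl; congr (_ *: _); ring.
have symXY : sym_laurent (e_sym r.+1 * P_norm w - Y).
  rewrite -scaleN1r; apply: sym_laurentD.
    by apply: sym_laurentM; [exact: sym_laurent_e_sym|exact: sym_laurent_P_norm].
  apply: sym_laurentZ; apply: sym_laurent_sum => I.
  exact/sym_laurentZ/sym_laurent_P_norm.
have DN f : macD q t 1 (- f) = - macD q t 1 f by rewrite -scaleN1r macDZ // scaleN1r.
apply: (@eigen_unique la _ r.+1) => //.
  have := macD1_e_sym t q_neq0 r (P_norm w); rewrite -DY macD_P_norm => H.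
  rewrite (elsym_eq 1 (spec_eq ew)) macDD // DN scalerBr.
  have -> : macD q t 1 (e_sym r.+1 * P_norm w) = macD q t 1 Y - elsym (spec w) 1 *: Y +
     elsym (spec w) 1 *: (e_sym r.+1 * P_norm w).
    by rewrite -H -scale_ratfunAr subrK.
  by rewrite addrAC [_ - _ - macD _ _ _ _]addrAC subrr add0r addrC.
have tot_eigE : tot_eig la = (\prod_i spec w i) / t ^+ (N * N.-1)./2.
  by congr (_ / _); apply: eq_bigr => i _; apply: spec_eq.
rewrite TsetD // TsetN // Ttot_e_sym // Ttot_P_norm -scale_ratfunAr scalerA -tot_eigE scalerBr.
congr (_ - _); rewrite /Y Tset_sum // scaler_sumr; apply: eq_bigr => I /eqP cI.
rewrite TsetZ // Ttot_P_norm spec_prod_addw cI !scalerA tot_eigE; congr (_ *: _); ring.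
Qed.

(** * Leading monomials in the Pieri rule *)

(** A relation, so that coefficients of a rational function known to be a
    polynomial are compared without choosing that polynomial. *)
Definition mpoly_coef (m : 'X_{1..N}) f (c : K) : Prop :=
  exists2 p : {mpoly K[N]}, f = ofpoly p & p@_m = c.

Lemma mpoly_coef_uniq m f c c' : mpoly_coef m f c -> mpoly_coef m f c' -> c = c'.
Proof. by move=> [p -> <-] [p' /ofpoly_inj -> <-]. Qed.

Lemma mpoly_coef_sum m (S0 : Type) (s : seq S0) (Q : pred S0) (F : S0 -> R) (G : S0 -> K) :
  (forall i, Q i -> mpoly_coef m (F i) (G i)) ->
  mpoly_coef m (\sum_(i <- s | Q i) F i) (\sum_(i <- s | Q i) G i).
Proof.
move=> FG; apply: (big_ind2 (mpoly_coef m)) => //.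
  by exists 0; rewrite ?rmorph0 ?mcoeff0.
move=> f c g d [p -> <-] [p' -> <-]; exists (p + p'); first by rewrite rmorphD.
by rewrite mcoeffD.
Qed.

Lemma mpoly_coefZ m a f c : mpoly_coef m f c -> mpoly_coef m (a *: f) (a * c).
Proof. by move=> [p -> <-]; exists (a *: p); rewrite ?ofpolyZ ?mcoeffZ. Qed.

Lemma mnm_of_addw mu nu I : 0 <= last_part mu -> part nu =1 addw (part mu) I ->
  mnm_of nu = (mnm_of mu + mesym1 I)%MM.
Proof.
move=> mu0 e; apply/mnmP => i; rewrite mnmDE !mnmE e /addw.
have := last_part_le mu i; case: (i \in I) => /=; lia.
Qed.

Lemma mesym1_seg r : (r <= N)%N -> mlead (mesym N K r) = mesym1 (seg r).
Proof.
by move=> rN; rewrite mlead_mesym //; apply/mnmP => i; rewrite !mnmE inE.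
Qed.

Lemma mesym1_lt r I : (r <= N)%N -> #|I| = r -> I != seg r ->
  (mesym1 I < mesym1 (seg r) :> 'X_{1..N})%O.
Proof.
move=> rN cI Ir; rewrite lt_neqAle (inj_eq (@inj_mesym1 N)) Ir -mesym1_seg //.
by apply: msupp_le_mlead; rewrite -cI mem_mesym1_mesym.
Qed.

Lemma addw_last_ge0 mu nu I : 0 <= last_part mu -> part nu =1 addw (part mu) I ->
  0 <= last_part nu.
Proof.
move=> mu0 e; have ltN : (N.-1 < N)%N by lia.
have eN1 : (Ordinal ltN).+1 = N by rewrite /=; lia.
move: mu0; rewrite !(last_partE _ eN1) e /addw; case: ifP => _; lia.
Qed.

(** In the Pieri rule for e_r the monomial x^(mu + omega_r) has coefficient 1 in
    e_r P_mu and occurs on the right only in P_(mu + omega_r), the leading monomials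
    of the other terms being smaller. *)
Lemma rho_val_seg_ge0 mu la r : (r <= N)%N -> 0 <= last_part mu ->
  mkwt (addw (part mu) (seg r)) = Some la ->
  rho_val la = pieri_coef r (part mu) (seg r) * rho_val mu.
Proof.
move=> rN mu0 e; pose m := (mnm_of mu + mesym1 (seg r))%MM.
have [p [Pp _ c1 ml _]] := P_poly mu0.
have p0 : p != 0 by rewrite -ofpoly_eq0 -Pp P_neq0.
have lhs : mpoly_coef m (e_sym r * P_norm (part mu)) (rho_val mu)^-1.
  exists ((rho_val mu)^-1 *: (mesym N K r * p)).
    by rewrite ofpolyZ rmorphM /= -e_sym_poly -Pp scale_ratfunAr /P_norm mkwt_part.
  rewrite mcoeffZ; have -> : m = (mlead (mesym N K r) + mlead p)%MM.
    by rewrite mesym1_seg // ml addmC.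
  by rewrite mleadcM mleadc_mesym // ml c1 !mulr1.
have rhs : mpoly_coef m (\sum_(I : {set 'I_N} | #|I| == r)
    pieri_coef r (part mu) I *: P_norm (addw (part mu) I))
  (\sum_(I : {set 'I_N} | #|I| == r)
    pieri_coef r (part mu) I * (if I == seg r then (rho_val la)^-1 else 0)).
  apply: mpoly_coef_sum => I /eqP cI; apply: mpoly_coefZ.
  rewrite /P_norm; case e' : (mkwt (addw (part mu) I)) => [nu|]; last first.
    rewrite (_ : (I == seg r) = false); first by exists 0; rewrite ?rmorph0 ?mcoeff0.
    by apply/eqP => eI; rewrite eI e in e'.
  have enu := mkwt_some e'.
  have [pn [Pn _ cn mn _]] := P_poly (addw_last_ge0 mu0 enu).
  have mE := mnm_of_addw mu0 enu.
  exists ((rho_val nu)^-1 *: pn); first by rewrite ofpolyZ -Pn.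
  rewrite mcoeffZ; case: eqVneq => [eI|neI].
    have -> : m = mnm_of nu by rewrite mE /m eI.
    by rewrite cn mulr1; move: e'; rewrite eI e => -[->].
  rewrite (@mcoeff_gt_mlead _ _ pn) ?mulr0 // mn mE /m ltmc_add2r.
  exact: mesym1_lt.
have := mpoly_coef_uniq lhs; rewrite (pieri_P_norm r (mkwt_part mu)) => /(_ _ rhs).
rewrite (bigD1 (seg r)) ?card_seg //= eqxx big1 ?addr0 => [|I /andP[_ /negPf->]].
  move=> H; apply: (mulIf (invr_neq0 (rho_val_neq0 mu))).
  rewrite mulfK ?rho_val_neq0 // H mulrCA divff ?rho_val_neq0 ?mulr1 //.
by rewrite mulr0.
Qed.

(** Multiplication by a power of e_N reduces to weights with last part at least 0. *)
Lemma rho_val_seg mu la r : (r <= N)%N -> mkwt (addw (part mu) (seg r)) = Some la ->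
  rho_val la = pieri_coef r (part mu) (seg r) * rho_val mu.
Proof.
move=> rN e; have ela := mkwt_some e.
have [mu0 [l0 e0 _]] := base_weight mu.
have [la0 ela0 pla0] := mkwt_shift la (- last_part mu).
have e' : mkwt (addw (part mu0) (seg r)) = Some la0.
  by rewrite -ela0; apply: mkwt_eq => i; rewrite ela /addw e0 addrAC.
have := rho_val_seg_ge0 rN _ e'; rewrite l0 => /(_ (lexx _)) H.
rewrite (@rho_val_shift (last_part mu) la0 la) => [|i]; last by rewrite pla0 subrK.
rewrite (@rho_val_shift (last_part mu) mu0 mu) => [|i]; last by rewrite e0 subrK.
rewrite H mulrCA; congr (_ * _); congr (_ * _).
rewrite -(@mac_coef_scale K 'I_N t (q ^ last_part mu)) ?expfz_neq0 //.
apply: mac_coef_eq => i; rewrite /spec e0 mulrA -expfzDr //.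
by congr (q ^ _ * _); ring.
Qed.

(** * Explicit Pieri coefficients *)

Local Notation phi2 u v := ((t * u - v) / (u - v)).

Lemma pieri_term (a b : K) : a != 0 -> b != 0 -> a - b != 0 -> b - q * a != 0 ->
  t * (((1 - t * (a / b)) * (1 - q * (a / b) / t)) /
       ((1 - a / b) * (1 - q * (a / b)))) = phi2 a b * phi2 (b / q) a.
Proof.
move=> a0 b0 ab bqa; have ba : b - a != 0 by rewrite -opprB oppr_eq0.
field; rewrite q_neq0 b0 t_neq0 ab ba /= mulNr [a * q]mulrC bqa.
by [].
Qed.

Lemma spec_ratio w i j :
  q ^ (w i - w j) * t^-1 ^ (i%:Z - j%:Z) = spec w i / spec w j.
Proof.
have sj := spec_neq0 w j; apply: (canRL (mulfK sj)).
rewrite !specE mulrACA exprz_inv -!expfzDr //; congr (q ^ _ * t ^ _); ring.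
Qed.

(** One factor of the structure constants of e and f, in terms of spectral points;
    the two factors on the right come from a_i(z) and from the quotient of the
    values at t^rho. *)
Lemma pieri_spec_term w i j : i != j ->
  let d := w i - w j in let r := i%:Z - j%:Z in
  t * (((1 - q ^ d * t^-1 ^ (r - 1)) * (1 - q ^ (d + 1) * t^-1 ^ (r + 1))) /
       ((1 - q ^ d * t^-1 ^ r) * (1 - q ^ (d + 1) * t^-1 ^ r))) =
  phi2 (spec w i) (spec w j) * phi2 (spec w j / q) (spec w i).
Proof.
move=> ij d r; have ji : j != i by rewrite eq_sym.
have t'0 : t^-1 != 0 by rewrite invr_eq0.
rewrite -pieri_term ?spec_neq0 ?subr_eq0 ?spec_dist ?spec_qdist //.
have e := spec_ratio w i j; rewrite -/d -/r in e; clearbody d r.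
rewrite !expfzDr // -e expr1z exprN1 invrK; congr (_ * (_ / _)).
  by congr ((1 - _) * (1 - _)); ring.
by congr (_ * (1 - _)); ring.
Qed.

Lemma seg_setD1 i : seg (i : 'I_N) = seg i.+1 :\ i.
Proof.
by apply/setP => j; rewrite !inE -val_eqE /= ltnS ltn_neqAle.
Qed.

Lemma in_seg_lt (i k : 'I_N) : (k \in seg i.+1) && (k != i) = (k < i)%N.
Proof. by rewrite inE -val_eqE /= ltnS andbC -ltn_neqAle. Qed.

Lemma notin_seg (i k : 'I_N) : (k \in ~: seg i.+1) = (i < k)%N.
Proof. by rewrite !inE ltnS -ltnNge. Qed.

Lemma prod_const_lt (i : 'I_N) : \prod_(j < N | (j < i)%N) t = t ^+ i.
Proof.
rewrite -(big_ord_widen N (fun=> t)) 1?ltnW ?ltn_ord //.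
by rewrite prodr_const card_ord.
Qed.

Lemma prod_const_gt (i : 'I_N) : t ^+ i * \prod_(j < N | (i < j)%N) t = t ^+ N.-1.
Proof.
rewrite -prod_const_lt; transitivity (\prod_(j < N | j != i) t).
  rewrite [RHS](bigID (fun j : 'I_N => (j < i)%N)) /=; congr (_ * _); apply: eq_bigl => j.
    by rewrite -val_eqE /= neq_ltn; case: ltngtP.
  by rewrite -val_eqE /= neq_ltn; case: ltngtP.
rewrite prodr_const; congr (_ ^+ _).
by rewrite (_ : #|_| = #|predC1 i|) // cardC1 card_ord.
Qed.

(** With kappa = mu - omega_(i-1), dominant because mu + 1_i is, the weights mu and
    mu + 1_i are kappa moved by consecutive fundamental weights; the quotient of
    the two coefficients supplied by rho_val_seg reduces to a product over j < i. *)
Lemma e_factor_rho_val mu i la : mkwt (addw (part mu) [set i]) = Some la ->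
  e_factor q t^-1 mu i * rho_val la = mac_coef t (spec (part mu)) [set i] * rho_val mu.
Proof.
move=> e; have ela := mkwt_some e.
pose wk j := part mu j - (if (j < i)%N then 1 else 0).
have [j k jk|ka eka pka] := @mkwt_mono N wk.
  rewrite /wk; have := part_mono mu jk; case: (ltnP k i) => ki.
    by rewrite (leq_ltn_trans jk ki); lia.
  case: (ltnP j i) => ji; last by lia.
  have := part_mono la (ltnW ji); rewrite !ela /addw !inE eqxx -val_eqE /= (ltn_eqF ji).
  by have := part_mono mu ki; lia.
have e1 : mkwt (addw (part ka) (seg i)) = Some mu.
  rewrite -(mkwt_part mu); apply: mkwt_eq => j; rewrite /addw pka /wk inE.
  by case: ifP => _; lia.
have e2 : mkwt (addw (part ka) (seg i.+1)) = Some la.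
  rewrite -e; apply: mkwt_eq => j; rewrite /addw pka /wk !inE ltnS -val_eqE /=.
  by case: (ltngtP (j : nat) i) => _ /=; lia.
rewrite (rho_val_seg _ e2) ?ltn_ord // (rho_val_seg _ e1) ?(ltnW (ltn_ord i)) //.
rewrite !mulrA; congr (_ * _); rewrite /pieri_coef half_mulS exprD.
set x := spec (part ka); set z := spec (part mu); pose I := seg i.+1.
have iI : i \in I by rewrite inE ltnSn.
have zge (k : 'I_N) : (i <= k)%N -> z k = x k.
  by move=> ik; rewrite /z /x /spec pka /wk ltnNge ik subr0.
have zlt (k : 'I_N) : (k < i)%N -> z k / q = x k.
  by move=> ik; rewrite /z /x /spec pka /wk ik expfzDr // mulrAC.
suff key : e_factor q t^-1 mu i * t ^+ i * mac_coef t x I =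
    mac_coef t z [set i] * mac_coef t x (I :\ i).
  rewrite -/I [seg i](seg_setD1 i) -/I.
  transitivity (t ^+ (i * i.-1)./2 *
    (e_factor q t^-1 mu i * t ^+ i * mac_coef t x I)); first by ring.
  by rewrite key; ring.
rewrite (mac_coefD1 t x iI) (mac_coef_setD1 t x iI) (mac_coef1 t z iI).
rewrite mulrCA -[RHS]mulrA; congr (_ * _).
  apply: eq_bigr => l; rewrite notin_seg => il.
  by rewrite !zge // ltnW.
rewrite -prod_const_lt /e_factor.
under [X in _ * X = _]eq_bigl do rewrite in_seg_lt.
under [X in _ = X * _]eq_bigl do rewrite in_seg_lt.
under [X in _ = _ * X]eq_bigl do rewrite in_seg_lt.
rewrite -!big_split /=; apply: eq_bigr => j ji.
have ij : i != j by rewrite -val_eqE /= gtn_eqF.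
have := pieri_spec_term (part mu) ij; rewrite /= [t * _]mulrC => ->.
by rewrite -/z zlt // -(zge i (leqnn i)) [RHS]mulrA.
Qed.

(** The same for mu - 1_i, which with kappa = mu - omega_i is kappa + omega_(i-1);
    the target mu + (1^N) - 1_i is mu - 1_i moved by omega_N. *)
Lemma f_factor_rho_val mu i la nu :
  part la =1 (fun j => part mu j + (if j == i then -1 else 0)) ->
  mkwt (addw (part mu) (~: [set i])) = Some nu ->
  f_factor q t^-1 mu i * rho_val nu = pieri_coef N.-1 (part mu) (~: [set i]) * rho_val mu.
Proof.
move=> pla enu; have pnu := mkwt_some enu.
pose wk j := part mu j - (if (j <= i)%N then 1 else 0).
have [j k jk|ka eka pka] := @mkwt_mono N wk.
  rewrite /wk; have := part_mono mu jk; case: (leqP k i) => ki.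
    by rewrite (leq_trans jk ki); lia.
  case: (leqP j i) => ji; last by lia.
  have := part_mono la (ltnW ki); rewrite !pla eqxx -val_eqE /= (gtn_eqF ki).
  by have := part_mono mu ji; lia.
have e1 : mkwt (addw (part ka) (seg i.+1)) = Some mu.
  rewrite -(mkwt_part mu); apply: mkwt_eq => j; rewrite /addw pka /wk inE ltnS.
  by case: ifP => _; lia.
have e2 : mkwt (addw (part ka) (seg i)) = Some la.
  rewrite -(mkwt_part la); apply: mkwt_eq => j; rewrite /addw pka /wk !inE pla -val_eqE /=.
  by case: (ltngtP (j : nat) i) => _ /=; lia.
have e3 : mkwt (addw (part la) (seg N)) = Some nu.
  rewrite -enu; apply: mkwt_eq => j; rewrite /addw pla !inE ltn_ord.
  by case: (eqVneq j i) => _ /=; lia.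
rewrite (rho_val_seg _ e3) // (rho_val_seg _ e2) ?(ltnW (ltn_ord i)) //.
rewrite (rho_val_seg _ e1) ?ltn_ord //.
rewrite !mulrA; congr (_ * _); rewrite /pieri_coef [(i.+1 * _)%N]/= half_mulS exprD.
have -> : mac_coef t (spec (part la)) (seg N) = 1.
  rewrite /mac_coef (_ : ~: seg N = set0); last by apply/setP => j; rewrite !inE ltn_ord.
  by rewrite big1 // => j _; rewrite big_set0.
have -> : t ^+ (N * N.-1)./2 = t ^+ (N.-1 * N.-1.-1)./2 * t ^+ N.-1.
  by rewrite -exprD -half_mulS prednK.
set x := spec (part ka); set z := spec (part mu); pose I := seg i.+1.
have iI : i \in I by rewrite inE ltnSn.
have zgt (k : 'I_N) : (i < k)%N -> z k = x k.
  by move=> ik; rewrite /z /x /spec pka /wk leqNgt ik subr0.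
have zle (k : 'I_N) : (k <= i)%N -> z k / q = x k.
  by move=> ik; rewrite /z /x /spec pka /wk ik expfzDr // mulrAC.
suff key : f_factor q t^-1 mu i * t ^+ N.-1 * mac_coef t x (I :\ i) =
    t ^+ i * (mac_coef t z (~: [set i]) * mac_coef t x I).
  rewrite -/I [seg i](seg_setD1 i) -/I.
  transitivity (t ^+ (N.-1 * N.-1.-1)./2 * t ^+ (i * i.-1)./2 *
    (f_factor q t^-1 mu i * t ^+ N.-1 * mac_coef t x (I :\ i))); first by ring.
  by rewrite key; ring.
have Az : mac_coef t z (~: [set i]) =
   (\prod_(k < N | (k < i)%N) phi2 (x k) (x i)) * (\prod_(k < N | (i < k)%N) phi2 (z k) (z i)).
  rewrite /mac_coef setCK; under eq_bigr do rewrite big_set1.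
  rewrite (bigID (fun k : 'I_N => (k < i)%N)) /=; congr (_ * _).
    apply: eq_big => [k|k /andP[_ ki]].
      by rewrite !inE -val_eqE /=; case: ltngtP.
    rewrite -!zle // 1?ltnW // mulrA -mulrBl -mulrBl -mulf_div divff ?mulr1 //.
    by rewrite invr_eq0.
  by apply: eq_bigl => k; rewrite !inE -val_eqE /=; case: ltngtP.
rewrite Az (mac_coefD1 t x iI) (mac_coef_setD1 t x iI).
under [X in _ * X = _]eq_bigl do rewrite in_seg_lt.
under [X in _ = _ * (_ * (_ * X))]eq_bigl do rewrite in_seg_lt.
rewrite [X in _ * X = _]big_split /= -(prod_const_gt i).
under [X in _ = _ * (_ * (X * _))]eq_bigl do rewrite notin_seg.
have fE : f_factor q t^-1 mu i * \prod_(j < N | (i < j)%N) t =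
   (\prod_(k < N | (i < k)%N) phi2 (z k) (z i)) * \prod_(k < N | (i < k)%N) phi2 (x i) (x k).
  rewrite /f_factor -!big_split /=; apply: eq_bigr => j ij.
  have ji : j != i by rewrite -val_eqE /= gtn_eqF.
  have := pieri_spec_term (part mu) ji; rewrite /= -/z zle // [X in _ * phi2 _ X]zgt // => <-.
  rewrite [RHS]mulrC; congr (_ * _).
  by rewrite [X in X / _ = _]mulrC [X in _ / X = _]mulrC.
rewrite [f_factor _ _ _ _ * _]mulrCA fE; ring.
Qed.

Lemma pieri_e mu : e_sym 1 * P mu =
  \sum_i e_factor q t^-1 mu i *: P_wt (addw (part mu) [set i]).
Proof.
have [c eP] := pieri1_expansion mu; rewrite eP; apply: eq_bigr => i _.
have := pieri1_values eP i; rewrite /P_wt /rho_val_wt.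
case e : (mkwt _) => [la|]; last by rewrite !scaler0.
by rewrite -(e_factor_rho_val e) => /(mulIf (rho_val_neq0 la)) ->.
Qed.

Lemma e_sym_pred : e_sym N.-1 = eN * \sum_(i < N) (xvar K i)^-1.
Proof.
have := @elsym_pred R 'I_N (@xvar K N); rewrite card_ord; apply=> // i.
exact: xvar_neq0.
Qed.

Lemma pieri_f mu : (\sum_(i < N) (xvar K i)^-1) * P mu =
  \sum_i f_factor q t^-1 mu i *: P_wt (fun j => part mu j + (if j == i then -1 else 0)).
Proof.
apply: (mulfI eN_neq0); rewrite mulrA -e_sym_pred.
have PE : P mu = rho_val mu *: P_norm (part mu).
  by rewrite /P_norm mkwt_part scalerA divff ?rho_val_neq0 ?scale1r.
rewrite {1}PE -scale_ratfunAr (pieri_P_norm _ (mkwt_part mu)).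
have := @sum_cardC1 'I_N R (fun I => pieri_coef N.-1 (part mu) I *: P_norm (addw (part mu) I)).
rewrite card_ord => /(_ N_gt0) ->; rewrite mulr_sumr scaler_sumr; apply: eq_bigr => i _.
rewrite -scale_ratfunAr; pose w j := part mu j + (if j == i then -1 else 0).
have ew : addw (part mu) (~: [set i]) =1 (fun j => w j + 1).
  by move=> j; rewrite /addw /w !inE; case: (eqVneq j i) => _ /=; lia.
rewrite -/w /P_wt; case e : (mkwt w) => [la|].
  have pla := mkwt_some e; have [nu enu pnu] := mkwt_shift la 1.
  have enu' : mkwt (addw (part mu) (~: [set i])) = Some nu.
    by rewrite -enu; apply: mkwt_eq => j; rewrite ew pla.
  have := @P_shift 1 la nu; rewrite expr1z => <- //.
  rewrite /P_norm enu' !scalerA; congr (_ *: _).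
  apply: (mulIf (rho_val_neq0 nu)); rewrite (f_factor_rho_val pla enu').
  by rewrite divfK ?rho_val_neq0 // mulrC.
rewrite mulr0 scaler0 /P_norm; case e' : (mkwt _) => [nu|]; last by rewrite !scaler0.
have [la ela _] := mkwt_shift nu (-1).
suff : mkwt w = Some la by rewrite e.
by rewrite -ela; apply: mkwt_eq => j; rewrite (mkwt_some e') ew addrK.
Qed.

(** * The operator with inverted parameters *)

(** The complement of the i-th shift is the total dilation times the inverse of
    the i-th shift; this turns D^(N-1) into D^(-1) on homogeneous functions. *)
Lemma macD_inv_P mu :
  macD q^-1 t^-1 1 (P mu) = (\sum_i (spec (part mu) i)^-1) *: P mu.
Proof.
have q'0 : q^-1 != 0 by rewrite invr_eq0.
have TE i : Tset q (~: [set i]) (P mu) = tot_eig mu *: Tset q^-1 [set i] (P mu).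
  rewrite -(dilationZ _ _ (dilation_Tset [set i] q'0)) -[tot_eig mu *: P mu]Ttot_P.
  apply: (dilation_eq (dilation_Tset (~: [set i]) q_neq0)
    (dilation_comp (dilation_Tset [set i] q'0) (dilation_Tset setT q_neq0))) => j.
  by rewrite /one_at !inE; case: eqVneq => _ /=; rewrite ?mulVf ?mul1r.
have AE i : mac_coef (ofcst N t) (@xvar K N) (~: [set i]) =
    ofcst N (t ^+ N.-1) * mac_coef (ofcst N t^-1) (@xvar K N) [set i].
  rewrite /mac_coef setCK big_set1; under eq_bigr do rewrite big_set1.
  rewrite rmorphXn /= (_ : _ ^+ N.-1 = \prod_(j in ~: [set i]) ofcst N t); last first.
    by rewrite prodr_const cardsC1 card_ord.
  rewrite -big_split /=; apply: eq_bigr => j; rewrite !inE => ji.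
  have h1 : xvar K j - xvar K i != 0 by rewrite subr_eq0 xvar_dist.
  have h2 : xvar K i - xvar K j != 0 by rewrite subr_eq0 xvar_dist // eq_sym.
  have oct : ofcst N t != 0 by rewrite fmorph_eq0.
  have := mac_factor_inv h1 h2 oct; rewrite -(fmorphV (@ofcst K N)).
  by move=> e; rewrite e.
have := P_eigen mu N.-1.
have := @sum_cardC1 'I_N R (fun I => t ^+ (N.-1 * N.-1.-1)./2 *:
  (mac_coef (ofcst N t) (@xvar K N) I * Tset q I (P mu))).
rewrite card_ord => /(_ N_gt0); rewrite -macDE => -> H.
have t0 k : t ^+ k != 0 by rewrite expf_neq0.
have c0 : t ^+ (N.-1 * N.-1.-1)./2 * (t ^+ N.-1 * tot_eig mu) != 0.
  by apply: mulf_neq0; rewrite ?t0 // mulf_neq0 ?tot_eig_neq0.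
have scaleI (c : K) (f g : R) : c != 0 -> c *: f = c *: g -> f = g.
  by move=> cn /(congr1 (fun h => c^-1 *: h)); rewrite !scalerA mulVf // !scale1r.
apply: (scaleI _ _ _ c0); rewrite macD1E.
transitivity (elsym (spec (part mu)) N.-1 *: P mu).
  rewrite -H scaler_sumr; apply: eq_bigr => i _.
  by rewrite AE TE !scale_ratfunE !rmorphM /=; ring.
have := @elsym_pred K 'I_N (spec (part mu)); rewrite card_ord => -> //; last first.
  exact: spec_neq0.
rewrite scalerA; congr (_ *: _); congr (_ * _).
have -> : t ^+ (N.-1 * N.-1.-1)./2 * (t ^+ N.-1 * tot_eig mu) =
    t ^+ (N * N.-1)./2 * tot_eig mu.
  by rewrite mulrA -exprD -half_mulS prednK.
by rewrite /tot_eig mulrCA divff ?mulr1.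
Qed.

(** * The identifications *)

Lemma linear_ketE (f : WN K N -> R) v : linear f ->
  f v = \sum_(la <- dom v) coeff la v *: f (ket K la).
Proof.
move=> fl; rewrite -{1}[v]freeg_sumE; elim: (dom v) => [|la s IHs].
  by have := fl (-1) 0 0; rewrite !big_nil !scaler0 addr0 scaleN1r addNr.
rewrite !big_cons -IHs; have -> : << coeff la v *g la >> = coeff la v *: ket K la.
  by apply/eqP/freeg_eqP => mu; rewrite coeffZ /ket !coeffU mul1r.
exact: fl.
Qed.

Lemma ket_ext (f g : WN K N -> R) : linear f -> linear g ->
  (forall la, f (ket K la) = g (ket K la)) -> forall v, f v = g v.
Proof.
move=> fl gl fg v; rewrite (linear_ketE v fl) (linear_ketE v gl).
by apply: eq_bigr => la _; rewrite fg.
Qed.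

Lemma fglift_ket (M : lmodType K) (f : domwt N -> M) la : fglift f (ket K la) = f la.
Proof. by rewrite /ket liftU scale1r. Qed.

Lemma phi_fglift_linear (c : K) (f : domwt N -> WN K N) :
  linear (fun v => phi (c *: fglift f v)).
Proof.
move=> a u v; rewrite fglift_is_linear scalerDr scalerA mulrC -scalerA.
by rewrite linearD linearZ.
Qed.

Lemma mul_phi_linear (a : R) : linear (fun v => a * phi v).
Proof. by move=> c u v; rewrite linearP mulrDr -scale_ratfunAr. Qed.

Lemma phi_move la i (d : int) : phi (oket K (move la i d)) =
  P_wt (fun j => part la j + (if j == i then d else 0)).
Proof. exact: phi_oket. Qed.

Lemma e_identification v : phi ((1 - q) *: e_op q t^-1 0 v) = (\sum_(i < N) xvar K i) * phi v.
Proof.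
have q1 : 1 - q != 0 by rewrite subr_eq0 eq_sym.
move: v; apply: ket_ext; [exact: phi_fglift_linear|exact: mul_phi_linear|].
move=> la; rewrite phi_ket -e_sym1E pieri_e /e_op fglift_ket scalerA divff // scale1r.
rewrite raddf_sum /=; apply: eq_bigr => i _.
rewrite linearZ /= /delta_coef expr0z mulr1 phi_move; congr (_ *: _).
by apply: P_wt_eq => j; rewrite /addw inE.
Qed.

Lemma f_identification v : phi (- (1 - q^-1) *: f_op q t^-1 0 v) =
  (\sum_(i < N) (xvar K i)^-1) * phi v.
Proof.
have q1 : - (1 - q^-1) != 0.
  by rewrite oppr_eq0 subr_eq0 eq_sym invr_eq1.
move: v; apply: ket_ext; [exact: phi_fglift_linear|exact: mul_phi_linear|].
move=> la; rewrite phi_ket pieri_f /f_op fglift_ket scalerA divff // scale1r.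
rewrite raddf_sum /=; apply: eq_bigr => i _.
by rewrite linearZ /= /delta_coef expr0z mulr1 phi_move.
Qed.

Lemma macD_phi_linear (c p u : K) r : p != 0 -> linear (fun v => c *: macD p u r (phi v)).
Proof.
move=> p0 a v v'; rewrite linearP /= macDD // macDZ // scalerDr.
by rewrite scalerA mulrC -scalerA.
Qed.

Lemma psi_linear (f : domwt N -> WN K N) : linear (fun v => phi (fglift f v)).
Proof. by move=> a u v; rewrite fglift_is_linear linearP. Qed.

Lemma psi_plus_identification v : phi (psi_plus q t^-1 1 v) =
  (t^-1 ^ (N%:Z - 1) * (1 - q^-1 * t) * (1 - t^-1)) *: macD q t 1 (phi v).
Proof.
have t'0 : t^-1 != 0 by rewrite invr_eq0.
move: v; apply: ket_ext; [exact: psi_linear|exact: macD_phi_linear|] => la.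
rewrite /psi_plus fglift_ket linearZ /= phi_ket P_eigen scalerA elsym1.
congr (_ *: _); rewrite psi_plus_coef // invrK !mulr_sumr; apply: eq_bigr => i _.
have -> : t^-1 ^ (N%:Z - 1) * (1 - q^-1 * t) * (1 - t^-1) * spec (part la) i =
   (1 - q^-1 * t) * (1 - t^-1) * (t^-1 ^ (N%:Z - 1) * spec (part la) i) by ring.
congr (_ * _); rewrite specE [RHS]mulrCA; congr (_ * _).
by rewrite !exprz_inv -expfzDr //; congr (t ^ _); ring.
Qed.

Lemma psi_minus_identification v : phi (psi_minus q t^-1 1 v) =
  (t^-1 ^ (1 - N%:Z) * (1 - (q^-1 * t)^-1) * (1 - (t^-1)^-1)) *:
    macD q^-1 t^-1 1 (phi v).
Proof.
have t'0 : t^-1 != 0 by rewrite invr_eq0.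
have q'0 : q^-1 != 0 by rewrite invr_eq0.
move: v; apply: ket_ext; [exact: psi_linear|exact: macD_phi_linear|] => la.
rewrite /psi_minus fglift_ket linearZ /= phi_ket macD_inv_P scalerA.
congr (_ *: _); rewrite psi_minus_coef // invfM !invrK !mulr_sumr; apply: eq_bigr => i _.
have -> : t^-1 ^ (1 - N%:Z) * (1 - q / t) * (1 - t) * (spec (part la) i)^-1 =
   (1 - q / t) * (1 - t) * (t^-1 ^ (1 - N%:Z) * (spec (part la) i)^-1) by ring.
congr (_ * _); rewrite specE !invfM [RHS]mulrCA; congr (_ * _).
by rewrite !exprz_inv !invr_expz -expfzDr //; congr (t ^ _); ring.
Qed.

(** Nothing about the field C(q, t) enters except the independence of q and t. *)
Lemma macdonald_identification :
  exists f : {linear WN K N -> R},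
    [/\ forall la : domwt N, f (ket K la) = P la,
        injective f
      & forall h : R, sym_laurent h <-> exists v, f v = h] /\
    [/\ forall v, f ((1 - q) *: e_op q t^-1 0 v) = (\sum_(i < N) xvar K i) * f v,
        forall v, f (- (1 - q^-1) *: f_op q t^-1 0 v) =
          (\sum_(i < N) (xvar K i)^-1) * f v,
        forall v, f (psi_plus q t^-1 1 v) =
          (t^-1 ^ (N%:Z - 1) * (1 - q^-1 * t) * (1 - t^-1)) *: macD q t 1 (f v)
      & forall v, f (psi_minus q t^-1 1 v) =
          (t^-1 ^ (1 - N%:Z) * (1 - (q^-1 * t)^-1) * (1 - (t^-1)^-1)) *:
            macD q^-1 t^-1 1 (f v)].
Proof.
exists (GRing.Linear.clone _ _ _ _ phi _); split; split.
- exact: phi_ket.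
- exact: phi_inj.
- exact: phi_onto.
- exact: e_identification.
- exact: f_identification.
- exact: psi_plus_identification.
- exact: psi_minus_identification.
Qed.

End MacdonaldFamily.

(** * The parameters q and t are independent *)

Section ClearDenominators.
Variables (F : fieldType) (q t : F).
Hypotheses (q_neq0 : q != 0) (t_neq0 : t != 0).

Lemma int_diff (a : int) : exists n m : nat, a = n%:Z - m%:Z.
Proof. by case: a => n; [exists n, 0%N | exists 0%N, n.+1]; lia. Qed.

Lemma indep_int :
  (forall n m n' m' : nat, q ^+ n * t ^+ m = q ^+ n' * t ^+ m' -> n = n' /\ m = m') ->
  forall a b : int, q ^ a * t ^ b = 1 -> a = 0 /\ b = 0.
Proof.
move=> H a b; have [n [m ->]] := int_diff a; have [n' [m' ->]] := int_diff b.
rewrite !expfzDr // -!invr_expz mulrACA -invfM => e.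
have z0 : q ^ m%:Z * t ^ m'%:Z != 0 by rewrite mulf_neq0 ?expf_neq0.
have [|-> ->] := H n n' m m'; last by rewrite !subrr.
by apply: (mulIf (invr_neq0 z0)); rewrite [LHS]e divff.
Qed.

(** Multiplying by a large power of q makes all exponents nonnegative. *)
Lemma sum_inj_int N :
  (forall v v' : 'I_N -> nat, \sum_i q ^+ v i * t ^+ (N - i.+1) =
     \sum_i q ^+ v' i * t ^+ (N - i.+1) -> v =1 v') ->
  forall w w' : 'I_N -> int, \sum_i q ^ w i * t ^+ (N - i.+1) =
     \sum_i q ^ w' i * t ^+ (N - i.+1) -> w =1 w'.
Proof.
move=> H w w'; pose M := (\sum_i `|w i| + \sum_i `|w' i|)%N.
have shift (v : 'I_N -> int) : (forall i, (`|v i| <= M)%N) ->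
  q ^+ M * (\sum_i q ^ v i * t ^+ (N - i.+1)) =
  \sum_i q ^+ absz (v i + M%:Z) * t ^+ (N - i.+1).
  move=> vM; rewrite mulr_sumr; apply: eq_bigr => i _.
  rewrite mulrA; congr (_ * _).
  rewrite (exprnP q M) (exprnP q (absz _)) -expfzDr //; congr (_ ^ _).
  by have := vM i; lia.
have wM i : (`|w i| <= M)%N by rewrite /M (bigD1 i) //= -!addnA leq_addr.
have w'M i : (`|w' i| <= M)%N.
  by rewrite /M addnC (bigD1 i) //= -!addnA leq_addr.
move=> /(congr1 ( *%R (q ^+ M))); rewrite !shift // => /H e i.
by have := e i; have := wM i; have := w'M i; rewrite /=; lia.
Qed.

End ClearDenominators.

Section Generic.
Variable R : realType.
Local Notation K := (Cqt R).
Local Notation q := (qvar R).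
Local Notation t := (tvar R).

Lemma qvar_neq0 : q != 0.
Proof. by rewrite tofrac_eq0 polyC_eq0 polyX_eq0. Qed.

Lemma tvar_neq0 : t != 0.
Proof. by rewrite tofrac_eq0 polyX_eq0. Qed.

Lemma qt_monomial n m :
  q ^+ n * t ^+ m = tofrac (('X^n : {poly R[i]})%:P * 'X^m : {poly {poly R[i]}}).
Proof. by rewrite tofracM tofracXn polyC_exp tofracXn. Qed.

Lemma qt_indep (a b : int) : q ^ a * t ^ b = 1 -> a = 0 /\ b = 0.
Proof.
apply: (indep_int qvar_neq0 tvar_neq0) => n m n' m'.
rewrite !qt_monomial => /eqP; rewrite tofrac_eq => /eqP e.
have coefE k l j : (('X^k : {poly R[i]})%:P * 'X^l : {poly {poly R[i]}})`_j =
    if j == l then 'X^k else 0.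
  by rewrite coefCM coefXn; case: eqP; rewrite ?mulr1 ?mulr0.
have := congr1 (fun s : {poly {poly R[i]}} => s`_m) e; rewrite !coefE eqxx.
case: eqP => [->|_] /eqP; last by rewrite -size_poly_eq0 size_polyXn.
by move=> /eqP /(congr1 (fun s : {poly R[i]} => size s)); rewrite !size_polyXn => -[].
Qed.

Lemma qt_sum_inj N (w w' : 'I_N -> int) :
  \sum_i q ^ w i * t ^+ (N - i.+1) = \sum_i q ^ w' i * t ^+ (N - i.+1) -> w =1 w'.
Proof.
move: w w'; apply: (sum_inj_int qvar_neq0 tvar_neq0) => v v'.
under eq_bigr do rewrite qt_monomial.
under [in RHS]eq_bigr do rewrite qt_monomial.
rewrite -!rmorph_sum /= => /eqP; rewrite tofrac_eq => /eqP e i.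
have coefE (u : 'I_N -> nat) :
    (\sum_j ('X^(u j) : {poly R[i]})%:P * 'X^(N - j.+1))`_(N - i.+1) = 'X^(u i).
  rewrite coef_sum (bigD1 i) //= coefCM coefXn eqxx mulr1 big1 ?addr0 // => j ji.
  rewrite coefCM coefXn (_ : (_ == _) = false) ?mulr0 //.
  apply: contraNF ji => /eqP eji; apply/eqP/val_inj => /=.
  by have := ltn_ord i; have := ltn_ord j; lia.
have := congr1 (fun s : {poly {poly R[i]}} => s`_(N - i.+1)) e; rewrite !coefE.
by move=> /(congr1 (fun s : {poly R[i]} => size s)); rewrite !size_polyXn => -[].
Qed.

End Generic.

Theorem proposition5p1 (R : realType) (N : nat) (hN : (0 < N)%N)
    (P : domwt N -> ratfun (Cqt R) N)
    (hP : macdonald_family (qvar R) (tvar R) P) :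
  let K := Cqt R in
  let q := qvar R in
  let t := tvar R in
  let q1 := q in
  let q2 := q^-1 * t in
  let q3 := t^-1 in
  exists phi : {linear WN K N -> ratfun K N},
    [/\ forall la : domwt N, phi (ket K la) = P la,
        injective phi
      & forall f : ratfun K N, sym_laurent f <-> exists v, phi v = f] /\
    [/\ forall v, phi ((1 - q1) *: e_op q1 q3 0 v) =
          (\sum_(i < N) xvar K i) * phi v,
        forall v, phi (- (1 - q1^-1) *: f_op q1 q3 0 v) =
          (\sum_(i < N) (xvar K i)^-1) * phi v,
        forall v, phi (psi_plus q1 q3 1 v) =
          (q3 ^ (N%:Z - 1) * (1 - q2) * (1 - q3)) *: macD q t 1 (phi v)
      & forall v, phi (psi_minus q1 q3 1 v) =
          (q3 ^ (1 - N%:Z) * (1 - q2^-1) * (1 - q3^-1)) *: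
            macD q^-1 t^-1 1 (phi v)].
Proof.
move=> K q t q1 q2 q3.
have q_neq0 : q != 0 by exact: qvar_neq0.
have t_neq0 : t != 0 by exact: tvar_neq0.
have indep : forall a b : int, q ^ a * t ^ b = 1 -> a = 0 /\ b = 0 by exact: qt_indep.
have q_neq1 : q != 1.
  by apply/eqP => e; have [|] := indep 1 0; rewrite ?expr0z ?expr1z ?mulr1.
have t_neq1 : t != 1.
  by apply/eqP => e; have [|_] := indep 0 1; rewrite ?expr0z ?expr1z ?mul1r.
have q_neqt : q != t.
  apply/eqP => e; have [|] := indep 1 (-1); last by [].
  by rewrite expr1z exprN1 e divff.
exact: (macdonald_identification hN q_neq0 t_neq0 q_neq1 t_neq1 q_neqt
  (@qt_sum_inj R N) hP indep).
Qed.
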